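(* Let $G$ be a connected graph. If $G$ has at least $7$ bicliques, then $G$ diverges under the biclique operator, i.e. $\lim_{k\to\infty}|V(KB^k(G))|=\infty$.
   Context: All graphs are finite, simple, undirected and connected. A biclique of a graph $G$ is a maximal (under inclusion of vertex sets) induced complete bipartite subgraph of $G$ with both sides nonempty. The biclique graph $KB(G)$ is the intersection graph of the bicliques of $G$: its vertices are the bicliques of $G$, and two distinct bicliques are adjacent iff they share at least one vertex. The iterated biclique graph is defined by $KB^0(G)=G$ and $KB^k(G)=KB(KB^{k-1}(G))$ for $k\ge 1$. $G$ diverges under $KB$ if $\lim_{k\to\infty}|V(KB^k(G))|=\infty$. *)

(* Defs.v *)
From mathcomp Require Import all_boot.
Set Implicit Arguments. Unset Strict Implicit. Unset Printing Implicit Defensive.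

Record bgraph := FGraph { gV : finType; gadj : rel gV }.

Section Biclique.
Variable G : bgraph.
Local Notation V := (gV G).
Local Notation adj := (@gadj G).

Definition induces_cbip (S : {set V}) : bool :=
  [exists X : {set V}, exists Y : {set V},
    [&& X :|: Y == S, [disjoint X & Y], X != set0, Y != set0,
        [forall x in X, forall x' in X, ~~ adj x x'],
        [forall y in Y, forall y' in Y, ~~ adj y y'] &
        [forall x in X, forall y in Y, adj x y]]].

Definition is_biclique (S : {set V}) : bool := maxset induces_cbip S.

Definition biclique := {S : {set V} | is_biclique S}.

Definition kb_adj : rel biclique :=
  fun B1 B2 => (B1 != B2) && (val B1 :&: val B2 != set0).

End Biclique.

Definition KB (G : bgraph) : bgraph := @FGraph (biclique G) (@kb_adj G).

Definition KBiter (k : nat) (G : bgraph) : bgraph := iter k KB G.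

Definition simple_graph (G : bgraph) : Prop :=
  symmetric (@gadj G) /\ irreflexive (@gadj G).

Definition connected_graph (G : bgraph) : Prop :=
  (0 < #|gV G|)%N /\ forall x y : gV G, connect (@gadj G) x y.

Definition diverges_KB (G : bgraph) : Prop :=
  forall N : nat, exists k0 : nat, forall k : nat, (k0 <= k)%N ->
    (N <= #|gV (KBiter k G)|)%N.

(* Main.v *)
Require Import Defs.
From mathcomp Require Import all_boot.
From mathcomp Require Import zify.
Set Implicit Arguments. Unset Strict Implicit. Unset Printing Implicit Defensive.

(** If a graph contains a clique K with n >= 5 vertices, then KB(G) or KB(KB(G)) contains a clique
    with n + 1 vertices.  A vertex z with 2 <= p <= n - 2 neighbours in K lies in p (n - p) bicliques,
    one for each pair consisting of a neighbour and a non-neighbour of z in K; without such a z,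
    bicliques extending disjoint edges of K are disjoint, so that KB(G) contains the line graph of K
    as an induced subgraph, and each vertex ab of that line graph is the centre of (n - 2)(n - 3)
    paths ax - ab - by.  Hence a clique with 5 vertices in an iterated biclique graph gives divergence.

    Assume that neither H = KB(G) nor KB(H) contains K5.  The bicliques of a gem are pairwise
    intersecting, and so are five of the bicliques of a K4 with an extra vertex adjacent to exactly
    two of its vertices; thus H contains neither graph.  Two nonadjacent neighbours of a vertex of H
    always have, inside a gem or a diamond, a further common neighbour, which then forces H to be
    paw-free, and therefore complete multipartite with at most four classes.  So "equal or disjoint"
    is an equivalence relation on the bicliques of G with at most four classes.  It remains to show
    that no class has three members and that three classes of size two together with a fourth
    nonempty class are impossible; this leaves at most 6 bicliques.  Both facts are finite case
    analyses on small induced subgraphs of G whose vertices are labelled by the bicliques containing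
    them, and they are verified by computation from explicit certificates. *)

(** * Bicliques *)

(** Maximality is the obstacle: a small complete bipartite set extends to some biclique, but the
    added vertices are unknown. Hence everything is phrased through parity. A set with an edge
    induces a complete bipartite graph exactly when each of its triples spans an even number of
    edges. So sets whose union has an odd triple have different extensions, whatever these are,
    while a common vertex keeps the extensions adjacent in [KB]. Disjointness is harder to obtain,
    since extensions may meet outside the given sets; it always comes from an assumption on the
    whole graph.

    The constant 5 is the least [n] at which both [2 * (n - 2)] and [(n - 2) * (n - 3)] reach
    [n + 1]; the bound 6 is [2 + 2 + 2] or [2 + 2 + 1 + 1]. Growth is not monotone: a clique may
    lose a vertex before it gains one, so divergence also needs a bound on the steps in between.

    As [G] has unbounded size, the two case analyses cannot enumerate graphs. They enumerate tuples
    of vertices: each rule asserts that a further vertex exists, and a tuple is excluded once all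
    its possible extensions are. *)

Definition par (T : Type) (e : rel T) (a b c : T) : bool := e a b (+) e b c (+) e a c.

Definition has_clique (G : bgraph) (n : nat) : Prop :=
  exists2 K : {set gV G}, n <= #|K| & {in K &, forall x y, x != y -> gadj x y}.

Lemma KB_simple (G : bgraph) : simple_graph (KB G).
Proof.
split=> [x y | x]; first by rewrite /= /kb_adj eq_sym setIC.
by rewrite /= /kb_adj eqxx.
Qed.

Section Bicliques.
Variables (G : bgraph) (sG : simple_graph G).
Local Notation V := (gV G).
Local Notation adj := (@gadj G).

(** Repeated entries are harmless, since a triple with two equal vertices is even in a simple graph.
    Edgeless sets are even too, which is why an edge is always demanded separately. *)
Definition even_set (S : {set V}) : Prop :=
  {in S & &, forall a b c, par adj a b c = false}.

Lemma adjC : symmetric adj. Proof. by case: sG. Qed.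
Lemma adjxx x : adj x x = false. Proof. by case: sG. Qed.

(* The sides of [S] are the neighbours and the non-neighbours in [S] of any end of an edge. *)
Lemma cbipP (S : {set V}) :
  induces_cbip S <-> even_set S /\ exists x y, [/\ x \in S, y \in S & adj x y].
Proof.
split.
- case/existsP=> X /existsP[Y /and5P[/eqP defS dXY X0 Y0 /and3P[HX HY HXY]]].
  have {}HX : {in X &, forall x x', adj x x' = false}.
    by move=> x x' xX x'X; apply/negbTE; move/forall_inP: HX => /(_ _ xX) /forall_inP ->.
  have {}HY : {in Y &, forall x x', adj x x' = false}.
    by move=> x x' xX x'X; apply/negbTE; move/forall_inP: HY => /(_ _ xX) /forall_inP ->.
  have {}HXY x y : x \in X -> y \in Y -> adj x y.
    by move=> xX yY; move/forall_inP: HXY => /(_ _ xX) /forall_inP ->.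
  have Ydis y : y \in Y -> y \in X = false by move=> yY; apply: (disjointFl dXY).
  (* Inside [S], adjacency is the sum modulo 2 of the memberships in [X]; around a triple each
     membership occurs twice and cancels. *)
  have adjE a b : a \in S -> b \in S -> adj a b = (a \in X) (+) (b \in X).
    rewrite -defS !inE; case aX: (a \in X) => /=; case bX: (b \in X) => //= aY bY.
    - by rewrite HX.
    - by rewrite HXY.
    - by rewrite adjC HXY.
    - by rewrite HY.
  split.
    move=> a b c aS bS cS; rewrite /par !adjE //.
    by case: (a \in X); case: (b \in X); case: (c \in X).
  case/set0Pn: X0 => x xX; case/set0Pn: Y0 => y yY.
  by exists x, y; rewrite -defS !inE xX yY orbT HXY.
- case=> ev [x [y [xS yS xy]]].
  pose X := [set z in S | ~~ adj x z]; pose Y := [set z in S | adj x z].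
  apply/existsP; exists X; apply/existsP; exists Y; apply/and5P; split.
  + by apply/eqP/setP=> z; rewrite !inE; case: (z \in S); case: (adj x z).
  + by rewrite -setI_eq0; apply/eqP/setP=> z; rewrite !inE; case: (z \in S); case: (adj x z).
  + by apply/set0Pn; exists x; rewrite inE xS adjxx.
  + by apply/set0Pn; exists y; rewrite inE yS xy.
  apply/and3P; split; apply/forall_inP=> a; rewrite inE => /andP[aS xa];
    apply/forall_inP=> b; rewrite inE => /andP[bS xb];
    move: (ev x a b xS aS bS); rewrite /par.
  all: by move: xa xb; case: (adj x a); case: (adj x b); case: (adj a b).
Qed.

Lemma biclique_even (B : biclique G) : even_set (val B).
Proof. by case: B => B /= /maxsetp/cbipP[]. Qed.

Lemma biclique_edge (B : biclique G) : exists x y, [/\ x \in val B, y \in val B & adj x y].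
Proof. by case: B => B /= /maxsetp/cbipP[]. Qed.

Lemma biclique_ext (S : {set V}) : induces_cbip S -> exists B : biclique G, S \subset val B.
Proof. by case/maxset_exists=> B mB sSB; exists (exist _ B mB). Qed.

(** An edge of [B] forms an even triple with [u], so [u] is adjacent to exactly one of its ends. *)
Lemma biclique_nbr (B : biclique G) u : u \in val B -> exists2 w, w \in val B & adj w u.
Proof.
move=> uB; have [x [y [xB yB xy]]] := biclique_edge B.
have := biclique_even xB yB uB; rewrite /par xy.
by case E: (adj y u); [exists y | case F: (adj x u) => // _; exists x].
Qed.

(* Contrapositive of maximality: [B :|: [set v]] would be even and contain an edge. *)
Lemma biclique_max (B : biclique G) u v :
  u \in val B -> v \notin val B -> exists2 w, w \in val B & par adj v u w.
Proof.
move=> uB vB.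
case: (boolP [exists w in val B, par adj v u w]) => [/exists_inP[w] | /exists_inPn/= H]; first by exists w.
have {}H w : w \in val B -> par adj v u w = false by move=> wB; apply/negbTE/H.
have [x [y [xB yB xy]]] := biclique_edge B.
(* The parities of the four triples of a quadruple add up to zero, each pair being counted twice. So
   the triples through [u] control all triples through [v]. *)
have E a b : a \in val B -> b \in val B -> par adj v a b = false.
  move=> aB bB; move: (H _ aB) (H _ bB) (biclique_even aB bB uB); rewrite /par.
  rewrite (adjC b u) (adjC a u).
  by case: (adj v a); case: (adj v b); case: (adj u a); case: (adj u b); case: (adj a b); case: (adj v u).
have Bp := valP B; case/maxsetP: Bp => _ /(_ (v |: val B)) Bmax.
have: val B = v |: val B.
  apply/esym/Bmax; last by rewrite subsetUr.
  apply/cbipP; split; last by exists x, y; rewrite !inE xB yB !orbT.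
  move=> a b c; rewrite !inE => /orP[/eqP->|aB] /orP[/eqP->|bB] /orP[/eqP->|cB].
  all: try exact: (biclique_even aB bB cB).
  all: try exact: E.
  - by rewrite /par !adjxx.
  - by rewrite /par adjxx addFb addbb.
  - by rewrite /par adjxx (adjC b v) addbF addbb.
  - by rewrite /par adjxx addbF addbb.
  - by move: (E a c aB cB); rewrite /par (adjC a v); case: (adj v a); case: (adj v c); case: (adj a c).
  - by move: (E a b aB bB); rewrite /par (adjC a v) (adjC b v); case: (adj v a); case: (adj v b); case: (adj a b).
by move/setP=> /(_ v); rewrite (negbTE vB) !inE eqxx.
Qed.

(** A vertex of [C] missed by [B] would, by maximality of [B], form an odd triple with two vertices
    of [B], and that triple would lie in [C]. *)
Lemma biclique_sub (B C : biclique G) : val B \subset val C -> B = C.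
Proof.
move=> sBC; apply/val_inj/eqP; rewrite eqEsubset sBC /=; apply/subsetP=> v vC.
apply/negPn/negP=> vB; have [x [_ [xB _ _]]] := biclique_edge B.
have [w wB] := biclique_max xB vB.
by rewrite (biclique_even vC (subsetP sBC _ xB) (subsetP sBC _ wB)).
Qed.

Lemma cbip2 a b : adj a b -> induces_cbip [set a; b].
Proof.
move=> ab; apply/cbipP; split; last by exists a, b; rewrite !inE !eqxx orbT.
move=> x y z; rewrite !inE => /orP[]/eqP-> /orP[]/eqP-> /orP[]/eqP->.
all: by rewrite /par ?(adjC b a) ?adjxx ?ab.
Qed.

Lemma cbip3 a b c : adj b a -> adj b c -> ~~ adj a c -> induces_cbip [set a; b; c].
Proof.
move=> ba bc /negbTE ac; apply/cbipP; split; last by exists b, c; rewrite !inE !eqxx !orbT.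
move=> x y z; rewrite !inE -!orbA => /or3P[]/eqP-> /or3P[]/eqP-> /or3P[]/eqP->.
all: by rewrite /par ?(adjC a b) ?(adjC c b) ?(adjC c a) ?adjxx ?ba ?bc ?ac.
Qed.

(** * Extending pairwise intersecting complete bipartite sets to distinct bicliques *)

Section Family.
Variables (I : finType) (J : {set I}) (D : I -> {set V}).
Hypothesis Dc : {in J, forall i, induces_cbip (D i)}.
Hypothesis Di : {in J &, forall i j, D i :&: D j != set0}.
Hypothesis Do : {in J &, forall i j, i != j ->
  exists a b c, [/\ a \in D i :|: D j, b \in D i :|: D j, c \in D i :|: D j & par adj a b c]}.

(** The extensions are arbitrary. An odd triple in the union of two sets prevents one biclique from
    containing both, which gives injectivity, and the common vertices of the sets survive in the
    extensions, which gives adjacency. *)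
Lemma KB_family i0 : i0 \in J -> exists f : I -> biclique G,
  [/\ {in J, forall i, D i \subset val (f i)}, {in J &, injective f} &
      {in J &, forall i j, i != j -> gadj (f i : gV (KB G)) (f j)}].
Proof.
move=> i0J; have [B0 _] := biclique_ext (Dc i0J).
(* [B0] only makes [f] total: for indices in [J] the [pick] succeeds. *)
pose f i := odflt B0 [pick B : biclique G | D i \subset val B].
have fP i : i \in J -> D i \subset val (f i).
  move=> iJ; rewrite /f; case: pickP => //= H.
  by have [B sB] := biclique_ext (Dc iJ); rewrite H in sB.
have finj : {in J &, injective f}.
  move=> i j iJ jJ eqf; apply/eqP/negP => /negP ne.
  have [a [b [c [aD bD cD]]]] := Do iJ jJ ne.
  have s : D i :|: D j \subset val (f i) by rewrite subUset fP //= eqf fP.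
  by rewrite (biclique_even (subsetP s _ aD) (subsetP s _ bD) (subsetP s _ cD)).
exists f; split=> // i j iJ jJ ne; rewrite /= /kb_adj (inj_in_eq finj) // ne /=.
case/set0Pn: (Di iJ jJ) => z; rewrite inE => /andP[zi zj].
by apply/set0Pn; exists z; rewrite inE (subsetP (fP _ iJ)) // (subsetP (fP _ jJ)).
Qed.

Lemma KB_clique : has_clique (KB G) #|J|.
Proof.
have [->|[i0 i0J]] := set_0Vmem J; first by exists set0; rewrite ?cards0 // => x; rewrite inE.
have [f [_ finj fadj]] := KB_family i0J.
exists (f @: J); first by rewrite card_in_imset.
move=> x y /imsetP[i iJ ->] /imsetP[j jJ ->] ne; apply: fadj => //.
by apply: contraNneq ne => ->.
Qed.
End Family.

End Bicliques.

(** * Growth of cliques *)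

Lemma has_clique_leq (G : bgraph) m n : m <= n -> has_clique G n -> has_clique G m.
Proof. by move=> mn [K nK HK]; exists K => //; apply: leq_trans nK. Qed.

Section Growth.
Variables (G : bgraph) (sG : simple_graph G) (K : {set gV G}).
Hypothesis K5 : 4 < #|K|.
Hypothesis HK : {in K &, forall x y, x != y -> gadj x y}.
Local Notation V := (gV G).
Local Notation adj := (@gadj G).
Local Notation adjC := (adjC sG).
Local Notation adjxx := (adjxx sG).

Let nb z := [set k in K | adj z k].

(** The paths [p.1 - p.2 - z] share [z], and the union of two of them contains a triangle of [K], an
    odd triple. With both factors at least 2, the number of pairs is at least [2 * (#|K| - 2)],
    which is at least [#|K| + 1] because [#|K| >= 5]. *)
Lemma clique_grow_split z : 1 < #|nb z| -> 1 < #|K :\: nb z| -> has_clique (KB G) #|K|.+1.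
Proof.
move=> h1 h2.
pose J := setX (K :\: nb z) (nb z).
have JP p : p \in J -> [/\ p.1 \in K, p.2 \in K, ~~ adj z p.1, adj z p.2 & p.1 != p.2].
  rewrite !inE => /andP[/andP[n1 k1] /andP[k2 a2]]; rewrite k1 /= in n1.
  by split=> //; apply: contraNneq n1 => ->.
apply: (@has_clique_leq _ _ #|J|).
  have := cardsID (nb z) K; rewrite cardsX.
  have -> : K :&: nb z = nb z by apply/setIidPr/subsetP=> x; rewrite inE => /andP[].
  by nia.
apply: (@KB_clique _ sG _ J (fun p => [set p.1; p.2; z])).
- move=> p /JP[k1 k2 n1 a2 ne]; apply: (cbip3 sG).
  + by rewrite HK // eq_sym.
  + by rewrite adjC.
  + by rewrite adjC.
- move=> p q _ _; apply/set0Pn; exists z.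
  by rewrite !inE eqxx !orbT.
- move=> p q /JP[k1 k2 n1 a2 ne] /JP[l1 l2 m1 b2 me].
  case: (eqVneq p.1 q.1) => [e1 | e1] pq.
    have e2 : p.2 != q.2 by apply: contraNneq pq => e2; rewrite -pair_eqE /pair_eq e1 e2 !eqxx.
    exists p.1, p.2, q.2; rewrite !inE !eqxx ?orbT; split=> //.
    by rewrite /par !HK // e1.
  exists p.1, q.1, p.2; rewrite !inE !eqxx ?orbT; split=> //.
  rewrite /par !HK //; apply: contraNneq m1 => ->; exact: a2.
Qed.

Hypothesis nosplit : forall z, #|nb z| <= 1 \/ #|K :\: nb z| <= 1.

(** By parity a common vertex [z] is adjacent to exactly one end of each of the edges [a b] and
    [c d]. It would thus have two neighbours and two non-neighbours in [K], against [nosplit]. *)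
Lemma disjoint_edges (B C : biclique G) a b c d :
  a \in val B -> b \in val B -> c \in val C -> d \in val C ->
  {subset [:: a; b; c; d] <= K} -> uniq [:: a; b; c; d] -> val B :&: val C = set0.
Proof.
move=> aB bB cC dC sK /=; rewrite !inE !negb_or andbT => /and3P[/and3P[ab ac ad] /andP[bc bd] cd].
have [aK bK cK dK] : [/\ a \in K, b \in K, c \in K & d \in K] by split; apply: sK; rewrite !inE eqxx ?orbT.
apply/eqP/set0Pn => [[z]]; rewrite inE => /andP[zB zC].
have key x y (D : biclique G) : x \in K -> y \in K -> x != y -> x \in val D -> y \in val D ->
  z \in val D -> exists u v, [/\ u \in [set x; y], v \in [set x; y], u \in nb z & v \in K :\: nb z].
  move=> xK yK xy xD yD zD; have := biclique_even sG zD xD yD; rewrite /par (HK xK yK xy).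
  case zx: (adj z x); case zy: (adj z y) => // _; [exists x, y | exists y, x];
   by rewrite !inE !eqxx ?orbT xK yK zx zy.
have [u [v [ux vx un vn]]] := key _ _ _ aK bK ab aB bB zB.
have [u' [v' [ux' vx' un' vn']]] := key _ _ _ cK dK cd cC dC zC.
have sep x y : x \in [set a; b] -> y \in [set c; d] -> x != y.
  by rewrite !inE => /orP[]/eqP-> /orP[]/eqP->.
have two (S : {set V}) x y : x \in S -> y \in S -> x != y -> 1 < #|S|.
  by move=> xS yS xy; apply/card_gt1P; exists x, y.
case: (nosplit z); rewrite leqNgt.
  by rewrite (two _ u u') // sep.
by rewrite (two _ v v') // sep.
Qed.

(** The first clique consists of bicliques on the edges at one vertex [a]. It is smaller than [K],
    but it bounds the loss at the step that is skipped on the way to the larger clique in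
    [KB (KB G)]. *)
Lemma clique_grow_nosplit :
  has_clique (KB G) #|K|.-1 /\ has_clique (KB (KB G)) #|K|.+1.
Proof.
have [a [b [aK bK ab]]] : exists a b, [/\ a \in K, b \in K & a != b].
  by apply/card_gt1P; apply: leq_trans K5.
have [B0 _] := biclique_ext (cbip2 sG (HK aK bK ab)).
pose e x y : biclique G := odflt B0 [pick B : biclique G | [set x; y] \subset val B].
have eP x y : x \in K -> y \in K -> x != y -> x \in val (e x y) /\ y \in val (e x y).
  move=> xK yK xy; suff: [set x; y] \subset val (e x y) by rewrite subUset !sub1set => /andP.
  rewrite /e; case: pickP => //= H.
  by have [B sB] := biclique_ext (cbip2 sG (HK xK yK xy)); rewrite H in sB.
(* A triangle is an odd triple, so no biclique contains three vertices of [K]; bicliques on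
   different edges at one vertex therefore differ. *)
have tri (B : biclique G) x y z : x \in K -> y \in K -> z \in K -> x != y -> y != z -> x != z ->
    x \in val B -> y \in val B -> z \in val B = false.
  move=> xK yK zK xy yz xz xB yB; apply/negP=> zB.
  by have := biclique_even sG xB yB zB; rewrite /par !HK.
pose A := K :\: [set a; b].
have AP x : x \in A -> [/\ x \in K, x != a & x != b].
  by rewrite !inE negb_or => /andP[/andP[-> ->] ->].
have cA : #|A| = #|K| - 2.
  by rewrite cardsD (setIidPr _) ?cards2 ?ab // subUset !sub1set aK.
have adjE (B C : biclique G) x : x \in val B -> x \in val C -> B != C -> @gadj (KB G) B C.
  by move=> xB xC ne; rewrite /= /kb_adj ne /=; apply/set0Pn; exists x; rewrite inE xB.
have star c x y : c \in K -> x \in K -> y \in K -> x != c -> y != c -> x != y ->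
    @gadj (KB G) (e c x) (e c y).
  move=> cK xK yK xc yc xy.
  have [c1 x1] : c \in val (e c x) /\ x \in val (e c x) by apply: eP; rewrite // eq_sym.
  have [c2 y2] : c \in val (e c y) /\ y \in val (e c y) by apply: eP; rewrite // eq_sym.
  apply: (adjE _ _ c) => //; apply/eqP=> E.
  have := tri (e c x) c x y cK xK yK; rewrite ![c == _]eq_sym xc yc xy => /(_ isT isT isT c1 x1).
  by rewrite E y2.
split.
  exists [set e a x | x in K :\ a].
    rewrite card_in_imset; first by have := cardsD1 a K; rewrite aK; lia.
    move=> x y; rewrite !inE => /andP[xa xK] /andP[ya yK] E; apply/eqP/negP=> /negP xy.
    by have := star a x y aK xK yK xa ya xy; rewrite E ((KB_simple G).2).
  move=> _ _ /imsetP[x + ->] /imsetP[y + ->]; rewrite !inE => /andP[xa xK] /andP[ya yK] ne.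
  by apply: star => //; apply: contraNneq ne => ->.
(* The pair [(x, y)] stands for the path [e a x], [e a b], [e b y]; its ends are non-adjacent
   because [x != y] makes the edges [a x] and [b y] disjoint. The count [(n - 2) * (n - 3)] equals
   [n + 1] when [n = 5]. *)
pose J := [set p in setX A A | p.1 != p.2].
apply: (@has_clique_leq _ _ #|J|).
  have -> : #|J| = #|A| * #|A| - #|A|.
    rewrite -cardsX -(cardsID [set p | p.1 != p.2] (setX A A)).
    have -> : setX A A :\: [set p | p.1 != p.2] = [set (x, x) | x in A].
      apply/setP=> [[x y]]; rewrite in_setD in_setX in_set /= negbK; apply/idP/imsetP.
        by case/andP=> /eqP-> /andP[yA _]; exists y.
      by case=> z zA [-> ->]; rewrite eqxx zA.
    rewrite card_imset ?addnK; last by move=> x y [].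
    by apply: eq_card => p; rewrite in_setI !in_set.
  rewrite cA; nia.
have sH := KB_simple G.
pose v := e a b.
have JP p : p \in J -> [/\ p.1 \in A, p.2 \in A & p.1 != p.2].
  by case: p => x y; rewrite in_set in_setX => /andP[/andP[-> ->] ->].
have ba : b != a by rewrite eq_sym.
(* The choice of [e x y] depends only on the set of the two ends, so the centre [v] belongs both to
   the star at [a] and to the star at [b]. *)
have vb : v = e b a by rewrite /v /e; congr odflt; apply: eq_pick => B; rewrite setUC.
apply: (@KB_clique _ sH _ J (fun p => [set e a p.1; v; e b p.2])).
- move=> p /JP[/AP[k1 a1 b1] /AP[k2 a2 b2] ne]; apply: (cbip3 sH).
  + by apply: star; rewrite // eq_sym.
  + by rewrite vb; apply: star; rewrite // eq_sym.
  + rewrite /= /kb_adj negb_and negbK; apply/orP; right; rewrite negbK; apply/eqP.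
    have [h1 h2] : a \in val (e a p.1) /\ p.1 \in val (e a p.1) by apply: eP; rewrite // eq_sym.
    have [h3 h4] : b \in val (e b p.2) /\ p.2 \in val (e b p.2) by apply: eP; rewrite // eq_sym.
    apply: (disjoint_edges h1 h2 h3 h4).
      by move=> x; rewrite !inE => /or4P[]/eqP->.
    by rewrite /= !inE !negb_or ![a == _]eq_sym ba a1 a2 b1 ne eq_sym b2.
- by move=> p q _ _; apply/set0Pn; exists v; rewrite !inE eqxx !orbT.
- move=> p q /JP[/AP[k1 a1 b1] /AP[k2 a2 b2] ne] /JP[/AP[l1 c1 d1] /AP[l2 c2 d2] me] pq.
  case: (eqVneq p.1 q.1) => [e1 | e1].
    have e2 : p.2 != q.2 by apply: contraNneq pq => e2; rewrite -pair_eqE /pair_eq e1 e2 !eqxx.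
    exists v, (e b p.2), (e b q.2); rewrite !inE !eqxx ?orbT; split=> //.
    by rewrite /par vb !(star b) // eq_sym.
  exists v, (e a p.1), (e a q.1); rewrite !inE !eqxx ?orbT; split=> //.
  by rewrite /par !(star a) // eq_sym.
Qed.
End Growth.

Lemma clique_grow (G : bgraph) n : simple_graph G -> 4 < n -> has_clique G n ->
  has_clique (KB G) n.+1 \/ has_clique (KB G) n.-1 /\ has_clique (KB (KB G)) n.+1.
Proof.
move=> sG n5 [K nK HK]; have K5 := leq_trans n5 nK.
case: (boolP [exists z, (1 < #|[set k in K | gadj z k]|) &&
                        (1 < #|K :\: [set k in K | gadj z k]|)]).
  case/existsP=> z /andP[z1 z2]; left.
  by apply: has_clique_leq (clique_grow_split sG K5 HK z1 z2).
move/existsPn=> H; right.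
have [z|h1 h2] := clique_grow_nosplit sG K5 HK.
  by have := H z; rewrite negb_and -!leqNgt => /orP.
by split; [apply: has_clique_leq h1; lia | apply: has_clique_leq h2].
Qed.

Lemma KBiter_simple (G : bgraph) k : simple_graph G -> simple_graph (KBiter k G).
Proof. by case: k => // k _; apply: KB_simple. Qed.

(** Growth alone gives large cliques at certain steps ([reach]). The limit needs all later steps,
    and [keep] provides them: after a clique of size [n] the size never falls below [n - 1]. *)
Lemma KBiter_clique_diverges (G : bgraph) j :
  simple_graph G -> has_clique (KBiter j G) 5 -> diverges_KB G.
Proof.
move=> sG j5.
have grow k n : 4 < n -> has_clique (KBiter k G) n ->
    has_clique (KBiter k.+1 G) n.+1 \/
    has_clique (KBiter k.+1 G) n.-1 /\ has_clique (KBiter k.+2 G) n.+1.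
  by move=> n5; apply: clique_grow; first apply: KBiter_simple.
have reach n : exists k, has_clique (KBiter k G) (n + 5).
  elim: n => [|n [k Hk]]; first by exists j.
  have [|H|[_ H]] := grow k (n + 5) _ Hk; first by rewrite addnC.
    by exists k.+1.
  by exists k.+2.
(* The induction advances by one step or by two and always restarts from a clique of size [n], so
   the losses of one vertex do not accumulate. *)
have keep n : 4 < n -> forall i k, has_clique (KBiter k G) n -> has_clique (KBiter (k + i) G) n.-1.
  move=> n5; elim/ltn_ind=> -[|[|i]] IH k Hk.
  - by rewrite addn0; apply: has_clique_leq Hk; lia.
  - rewrite addn1; case: (grow k n n5 Hk) => [H|[H _]] //.
    by apply: has_clique_leq H; lia.
  case: (grow k n n5 Hk) => [H|[_ H]].
    by rewrite addnS -addSn; apply: IH => //; apply: has_clique_leq H.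
  rewrite 2!addnS -2!addSn; apply: (IH i) => //.
  exact: has_clique_leq H.
move=> N; have [k0 Hk0] := reach N.
exists k0 => k le; have := keep (N + 5) _ (k - k0) k0 Hk0; rewrite subnKC //.
case; first by lia.
by move=> C NC _; apply: leq_trans (max_card C); apply: leq_trans NC; lia.
Qed.

(** * Patterns *)

(* A pattern describes a tuple of vertices of a labelled graph: the k-th entry holds the label of
   the k-th vertex and its adjacencies to the vertices k+1, k+2, and so on.  New vertices are thus
   added at the head.  The tuple may contain repetitions. *)
Notation pattern := (seq (seq nat * seq bool)).

Section Patterns.
Variables (V : Type) (adj : rel V).
Hypothesis adjC : symmetric adj.
Hypothesis adjxx : irreflexive adj.

Fixpoint pat (tag : V -> seq nat) (vs : seq V) : pattern :=
  if vs is v :: vs' then (tag v, map (adj v) vs') :: pat tag vs' else [::].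

Definition ptag (P : pattern) k := (nth ([::], [::]) P k).1.
Definition padj (P : pattern) i j :=
  if i < j then nth false (nth ([::], [::]) P i).2 (j - i.+1)
  else if j < i then nth false (nth ([::], [::]) P j).2 (i - j.+1) else false.

Lemma size_pat tag vs : size (pat tag vs) = size vs.
Proof. by elim: vs => //= v vs ->. Qed.

Lemma ptag_pat tag vs v0 k : k < size vs -> ptag (pat tag vs) k = tag (nth v0 vs k).
Proof. by elim: vs k => //= v vs IH [|k] //= /IH. Qed.

Lemma padj_pat tag vs v0 i j : i < size vs -> j < size vs ->
  padj (pat tag vs) i j = adj (nth v0 vs i) (nth v0 vs j).
Proof.
have key k l : k < l -> l < size vs ->
    nth false (nth ([::], [::]) (pat tag vs) k).2 (l - k.+1) = adj (nth v0 vs k) (nth v0 vs l).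
  elim: vs k l => //= v vs IH [|k] [|l] //=; last by rewrite !ltnS => kl lv; rewrite -IH // subSS.
  by move=> _ lt; rewrite subn1 /= (nth_map v0).
move=> iv jv; rewrite /padj; case: ltngtP => [lt|lt|->].
- exact: key.
- by rewrite adjC; apply: key.
- by rewrite adjxx.
Qed.

Lemma pat_map tag f vs : pat (f \o tag) vs = [seq (f w.1, w.2) | w <- pat tag vs].
Proof. by elim: vs => //= v vs ->. Qed.

End Patterns.

Section Family.
Variables (G : bgraph) (sG : simple_graph G).
Local Notation V := (gV G).
Local Notation adj := (@gadj G).

Definition peven (P : pattern) (d : seq nat) :=
  all (fun a => all (fun b => all (fun c => ~~ par (padj P) a b c) d) d) d.
Definition pedge (P : pattern) (d : seq nat) := has (fun a => has (padj P a) d) d.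
Definition pcbip (P : pattern) d := [&& all (gtn (size P)) d, peven P d & pedge P d].
(** Computable form of the hypotheses of [KB_family]: a shared index yields a common vertex, and
    failure of evenness for the concatenation yields an odd triple in the union. *)
Definition pcrowd (P : pattern) (ds : seq (seq nat)) :=
  all (pcbip P) ds && pairwise (fun d d' => has (mem d') d && ~~ peven P (d ++ d')) ds.

Definition pset v0 (vs : seq V) (d : seq nat) : {set V} := [set v in map (nth v0 vs) d].

Lemma pset_even tag v0 vs d : all (gtn (size vs)) d ->
  peven (pat adj tag vs) d <-> even_set (pset v0 vs d).
Proof.
move=> /allP dv; have {}dv k : k \in d -> k < size vs by move/dv.
have E a b c : a \in d -> b \in d -> c \in d ->
    par (padj (pat adj tag vs)) a b c = par adj (nth v0 vs a) (nth v0 vs b) (nth v0 vs c).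
  by move=> ad bd cd; rewrite /par !(padj_pat (adjC sG) (adjxx sG) _ v0) ?dv.
split.
  rewrite /peven => /allP ev x y z; rewrite !inE => /mapP[a ad ->] /mapP[b bd ->] /mapP[c cd ->].
  rewrite -E //; apply/negbTE.
  by have /allP/(_ b bd)/allP/(_ c cd) := ev a ad.
move=> ev; rewrite /peven; apply/allP=> a ad; apply/allP=> b bd; apply/allP=> c cd.
by rewrite E // ev // inE map_f.
Qed.

Lemma pset_cbip tag v0 vs d : pcbip (pat adj tag vs) d -> induces_cbip (pset v0 vs d).
Proof.
rewrite /pcbip size_pat => /and3P[dv ev ed]; apply/(cbipP sG); split.
  by apply/(pset_even tag).
case/hasP: ed => a ad /hasP[b bd]; move/allP: dv => dv; have {}dv k : k \in d -> k < size vs by move/dv.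
rewrite (padj_pat (adjC sG) (adjxx sG) _ v0) ?dv // => ab.
by exists (nth v0 vs a), (nth v0 vs b); rewrite !inE !map_f.
Qed.

Lemma pcrowd_ext tag v0 vs ds : 0 < size ds -> pcrowd (pat adj tag vs) ds ->
  exists f : 'I_(size ds) -> biclique G,
  [/\ forall i : 'I_(size ds), pset v0 vs (nth [::] ds i) \subset val (f i), injective f &
      forall i j, i != j -> gadj (f i : gV (KB G)) (f j)].
Proof.
move=> ds0 /andP[/allP cb /(pairwiseP [::]) pw].
have [||||f [f1 f2 f3]] := @KB_family G sG _ setT (fun i : 'I_(size ds) => pset v0 vs (nth [::] ds i)) _ _ _ (Ordinal ds0).
- by move=> i _; apply: (@pset_cbip tag); apply/cb/mem_nth.
- have sym i j : i < j -> j < size ds -> pset v0 vs (nth [::] ds i) :&: pset v0 vs (nth [::] ds j) != set0.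
    move=> ij jd; case/andP: (pw i j (ltn_trans ij jd) jd ij) => /hasP[k ki kj] _.
    by apply/set0Pn; exists (nth v0 vs k); rewrite !inE !map_f.
  move=> i j _ _; case: (ltngtP i j) => [lt|lt|/val_inj->].
  + exact: sym.
  + by rewrite setIC; apply: sym.
  + rewrite setIid; have := cb _ (mem_nth [::] (ltn_ord j)); case/and3P=> _ _ /hasP[k kd _].
    by apply/set0Pn; exists (nth v0 vs k); rewrite inE map_f.
- have sym (i j : nat) : i < j -> j < size ds -> ~ even_set (pset v0 vs (nth [::] ds i) :|: pset v0 vs (nth [::] ds j)).
    move=> ij jd ev; case/andP: (pw i j (ltn_trans ij jd) jd ij) => _ /negP; apply.
    apply/(pset_even tag v0).
      rewrite all_cat; have /and3P[+ _ _] := cb _ (mem_nth [::] (ltn_trans ij jd)).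
      by have /and3P[+ _ _] := cb _ (mem_nth [::] jd); rewrite !size_pat => -> ->.
    have <- : pset v0 vs (nth [::] ds i) :|: pset v0 vs (nth [::] ds j) = pset v0 vs (nth [::] ds i ++ nth [::] ds j).
      by apply/setP=> x; rewrite !inE map_cat mem_cat.
    exact: ev.
  have nev (S : {set V}) : ~ even_set S -> exists a b c, [/\ a \in S, b \in S, c \in S & par adj a b c].
    case: (boolP [exists a in S, exists b in S, exists c in S, par adj a b c]).
      by case/exists_inP=> a aS /exists_inP[b bS /exists_inP[c cS p]] _; exists a, b, c.
    move/exists_inPn=> H ev; case: ev => a b c aS bS cS; apply/negbTE.
    by have /exists_inPn/(_ b bS)/exists_inPn/(_ c cS) := H a aS.
  move=> i j _ _ ij; apply: nev; case: (ltngtP i j) => [lt|lt|/val_inj E].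
  + exact: sym.
  + by rewrite setUC; apply: sym.
  + by rewrite E eqxx in ij.
- by [].
exists f; split.
- by move=> i; apply: f1.
- by move=> i j; apply: f2.
- by move=> i j; apply: f3.
Qed.

Lemma pcrowd_clique tag vs ds : pcrowd (pat adj tag vs) ds -> has_clique (KB G) (size ds).
Proof.
case: ds => [|d ds'] fam; first by exists set0; rewrite ?cards0 // => x; rewrite inE.
case: vs fam => [|v0 vs'] fam.
  by move: fam => /andP[/andP[/and3P[]]]; case: d.
have [//|f [_ finj fadj]] := pcrowd_ext v0 _ fam.
exists (f @: setT); first by rewrite card_imset // cardsT card_ord.
move=> x y /imsetP[i _ ->] /imsetP[j _ ->] ne; apply: fadj.
by apply: contraNneq ne => ->.
Qed.

End Family.

(** * The biclique graph without large cliques *)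

Section Small.
Variables (G : bgraph) (sG : simple_graph G).
Local Notation adj := (@gadj G).

(** A gem is an induced path [p q r s] together with a vertex [c] adjacent to all of it. The five
    sets are its induced paths on three vertices, [p - c - r], [q - c - s], [p - c - s], [p - q - r]
    and [q - r - s], any two of which meet. *)
Lemma gem_clique c p q r s : adj c p -> adj c q -> adj c r -> adj c s ->
  adj p q -> adj q r -> adj r s -> adj p r = false -> adj p s = false -> adj q s = false ->
  has_clique (KB G) 5.
Proof.
move=> h1 h2 h3 h4 h5 h6 h7 h8 h9 h10.
apply: (@pcrowd_clique G sG (fun=> [::]) [:: c; p; q; r; s]
  [:: [:: 0; 1; 3]; [:: 0; 2; 4]; [:: 0; 1; 4]; [:: 1; 2; 3]; [:: 2; 3; 4]]).
by rewrite /pat /= h1 h2 h3 h4 h5 h6 h7 h8 h9 h10.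
Qed.

(** The four paths from [z] through [b] or [d] to [a] or [c] share [z], and the edge [a c] meets
    each of them. *)
Lemma rocket_clique a b c d z : adj a b -> adj a c -> adj a d -> adj b c -> adj b d -> adj c d ->
  adj z b -> adj z d -> adj z a = false -> adj z c = false -> has_clique (KB G) 5.
Proof.
move=> h1 h2 h3 h4 h5 h6 h7 h8 h9 h10.
apply: (@pcrowd_clique G sG (fun=> [::]) [:: z; a; b; c; d]
  [:: [:: 1; 3]; [:: 0; 1; 2]; [:: 0; 3; 2]; [:: 0; 1; 4]; [:: 0; 3; 4]]).
by rewrite /pat /= h1 h2 h3 h4 h5 h6 h7 h8 h9 h10.
Qed.
End Small.

(** * If [KB (KB G)] has no clique of size 5, then non-adjacency in [KB G] is transitive *)

Section Multipartite.
Variables (G : bgraph) (sG : simple_graph G).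
Local Notation V := (gV G).
Local Notation adj := (@gadj G).
Local Notation hadj := (@gadj (KB G)).
Implicit Types B C D : biclique G.

Lemma hadjI B C x : x \in val B -> x \in val C -> B != C -> hadj B C.
Proof.
by move=> xB xC ne; rewrite /= /kb_adj ne /=; apply/set0Pn; exists x; rewrite inE xB.
Qed.

Lemma hadjE B C : hadj B C -> exists2 x, x \in val B & x \in val C.
Proof. by case/andP=> _ /set0Pn[x]; rewrite inE => /andP[xB xC]; exists x. Qed.

Lemma hadjN B C x : hadj B C = false -> B != C -> x \in val B -> x \in val C = false.
Proof. by move=> n ne xB; apply/negP=> xC; rewrite (hadjI xB xC ne) in n. Qed.

Lemma notin_neq (B C : biclique G) x : x \in val B -> x \notin val C -> B != C.
Proof. by move=> xB; apply: contraNneq => <-. Qed.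

Hypothesis no5 : ~ has_clique (KB (KB G)) 5.

(* With x in B1, B2 and y in B2, B3: if some biclique through an edge or path at x or y meets all
   three bicliques, it is D; otherwise the bicliques extending x' x w and w y y', where w is a common
   neighbour of x and y in B2, x' one of x in B1 and y' one of y in B3, complete B1, B2, B3 to a gem. *)
Lemma KB_path3 B1 B2 B3 : hadj B1 B2 -> hadj B2 B3 -> hadj B1 B3 = false -> B1 != B3 ->
  exists D, [/\ hadj D B1, hadj D B2 & hadj D B3].
Proof.
move=> a12 a23 n13 ne13.
have d13 x : x \in val B1 -> x \notin val B3 by move=> xB; rewrite (hadjN n13 ne13 xB).
have d31 x : x \in val B3 -> x \notin val B1 by move=> xB; apply/negP=> /d13; rewrite xB.
case: (boolP [exists D : biclique G, [&& hadj D B1, hadj D B2 & hadj D B3]]).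
  by case/existsP=> D /and3P[]; exists D.
move/existsPn=> noD; case: no5.
(* From here on, [B2] is the only biclique that meets all three of [B1], [B2], [B3]. *)
have sub (D : biclique G) x y w : x \in val D -> x \in val B1 -> y \in val D -> y \in val B3 ->
    w \in val D -> w \in val B2 -> D = B2.
  move=> xD x1 yD y3 wD w2; apply/eqP; apply/negPn/negP=> ne.
  have := noD D; rewrite (hadjI xD x1) ?(hadjI wD w2) ?(hadjI yD y3) //.
    exact: notin_neq xD (d13 _ x1).
  exact: notin_neq yD (d31 _ y3).
have subS (S : {set V}) x y w : induces_cbip S -> x \in S -> x \in val B1 -> y \in S -> y \in val B3 ->
    w \in S -> w \in val B2 -> S \subset val B2.
  move=> cS xS x1 yS y3 wS w2; have [D sD] := biclique_ext cS; have sDs := subsetP sD.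
  by rewrite -(sub D x y w) // sDs.
have ev2 := biclique_even sG (B := B2).
have left x y x' : x \in val B1 -> x \in val B2 -> y \in val B3 -> y \in val B2 -> adj x y ->
    x' \in val B1 -> adj x' x -> x' \in val B2.
  move=> x1 x2 y3 y2 xy x1' x'x.
  case x'y: (adj x' y).
    have /subsetP s := subS [set x'; y] x' y y (cbip2 sG x'y) (set21 _ _) x1' (set22 _ _) y3 (set22 _ _) y2.
    exact: s (set21 _ _).
  have c3 : induces_cbip [set x'; x; y] by apply: (cbip3 sG); rewrite // ?(adjC sG x) // x'y.
  have /subsetP s : [set x'; x; y] \subset val B2 by apply: (subS _ x y x c3); rewrite // !inE eqxx ?orbT.
  by apply: s; rewrite !inE eqxx ?orbT.
have right x y y' : x \in val B1 -> x \in val B2 -> y \in val B3 -> y \in val B2 -> adj x y ->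
    y' \in val B3 -> adj y' y -> y' \in val B2.
  move=> x1 x2 y3 y2 xy y3' y'y.
  case y'x: (adj y' x).
    have /subsetP s := subS [set y'; x] x y' x (cbip2 sG y'x) (set22 _ _) x1 (set21 _ _) y3' (set22 _ _) x2.
    exact: s (set21 _ _).
  have c3 : induces_cbip [set y'; y; x] by apply: (cbip3 sG); rewrite // ?(adjC sG y) // y'x.
  have /subsetP s : [set y'; y; x] \subset val B2 by apply: (subS _ x y x c3); rewrite // !inE eqxx ?orbT.
  by apply: s; rewrite !inE eqxx ?orbT.
(* If [x] and [y] were adjacent, [left] and [right] would put their neighbours [x'] and [y'] into
   [B2], and [x' y'] would again be an edge. Each vertex of [B1] is adjacent to [x] or to [x'], so
   [left] would give [B1] inside [B2]. *)
have nadj x y : x \in val B1 -> x \in val B2 -> y \in val B3 -> y \in val B2 -> adj x y = false.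
  move=> x1 x2 y3 y2; apply/negP=> xy.
  have [x' x1' x'x] := biclique_nbr sG x1; have [y' y3' y'y] := biclique_nbr sG y3.
  have x2' := left x y x' x1 x2 y3 y2 xy x1' x'x.
  have y2' := right x y y' x1 x2 y3 y2 xy y3' y'y.
  have x'y' : adj x' y'.
    have := ev2 _ _ _ x2' x2 y2; have := ev2 _ _ _ x2' y2 y2'; rewrite /par x'x xy (adjC sG y y') y'y.
    by case: (adj x' y); case: (adj x' y').
  have s12 : val B1 \subset val B2.
    apply/subsetP=> u u1; case ux: (adj u x); first exact: left x1 x2 y3 y2 xy u1 ux.
    have := biclique_even sG u1 x1 x1'; rewrite /par ux (adjC sG x x') x'x => /(canRL (addKb _))/= ux'.
    by apply: left x1' x2' y3' y2' x'y' u1 _; rewrite ux'.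
  by have := a12; rewrite (biclique_sub sG s12) (KB_simple G).2.
have [x x1 x2] := hadjE a12; have [y y2 y3] := hadjE a23.
have [w w2 wx] := biclique_nbr sG x2.
have xy := nadj _ _ x1 x2 y3 y2.
(* Being non-adjacent, [x] and [y] lie on the same side of [B2], so a neighbour of one in [B2] is a
   neighbour of both. *)
have wy : adj w y by have := ev2 _ _ _ w2 x2 y2; rewrite /par wx xy; case: (adj w y).
have w1 : w \notin val B1 by apply/negP=> w1; rewrite nadj in wy.
have w3 : w \notin val B3 by apply/negP=> w3; rewrite (adjC sG) nadj in wx.
have [x' x1' x'x] := biclique_nbr sG x1; have [y' y3' y'y] := biclique_nbr sG y3.
have x2' : x' \notin val B2.
  apply/negP=> x2'; have := ev2 _ _ _ x2' x2 y2.
  by rewrite /par x'x xy (nadj x' y).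
have y2' : y' \notin val B2.
  apply/negP=> y2'; have := ev2 _ _ _ y2' y2 x2.
  by rewrite /par y'y (adjC sG y x) xy (adjC sG y' x) (nadj x y').
have x'y : adj x' y = false.
  apply/negP=> x'y; case/negP: x2'.
  have /subsetP s := subS [set x'; y] x' y y (cbip2 sG x'y) (set21 _ _) x1' (set22 _ _) y3 (set22 _ _) y2.
  exact: s (set21 _ _).
have y'x : adj y' x = false.
  apply/negP=> y'x; case/negP: y2'.
  have /subsetP s := subS [set y'; x] x y' x (cbip2 sG y'x) (set22 _ _) x1 (set21 _ _) y3' (set22 _ _) x2.
  exact: s (set21 _ _).
have x'w : adj x' w = false.
  apply/negP=> x'w; case/negP: x2'.
  have c3 : induces_cbip [set x'; w; y] by apply: (cbip3 sG); rewrite // ?(adjC sG w x') // x'y.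
  have /subsetP s : [set x'; w; y] \subset val B2 by apply: (subS _ x' y w c3); rewrite // !inE eqxx ?orbT.
  by apply: s; rewrite !inE eqxx ?orbT.
have y'w : adj y' w = false.
  apply/negP=> y'w; case/negP: y2'.
  have c3 : induces_cbip [set y'; w; x] by apply: (cbip3 sG); rewrite // ?(adjC sG w y') // y'x.
  have /subsetP s : [set y'; w; x] \subset val B2 by apply: (subS _ x y' w c3); rewrite // !inE eqxx ?orbT.
  by apply: s; rewrite !inE eqxx ?orbT.
have [D1 /subsetP s1] : exists D : biclique G, [set x'; x; w] \subset val D.
  by apply/biclique_ext/(cbip3 sG); rewrite ?x'w // (adjC sG) ?x'w.
have [D3 /subsetP s3] : exists D : biclique G, [set y'; y; w] \subset val D.
  by apply/biclique_ext/(cbip3 sG); rewrite ?y'w // (adjC sG) ?y'w.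
have [xD1 xD wD1] : [/\ x' \in val D1, x \in val D1 & w \in val D1].
  by split; apply: s1; rewrite !inE eqxx ?orbT.
have [yD3 yD wD3] : [/\ y' \in val D3, y \in val D3 & w \in val D3].
  by split; apply: s3; rewrite !inE eqxx ?orbT.
(* [D1] already contains [x] from [B1] and [w] from [B2]; a vertex of [B3] would force it to be
   [B2], which misses [x']. *)
have D13 : hadj D1 B3 = false.
  by apply/negP=> /hadjE[t tD t3]; case/negP: x2'; rewrite -(sub D1 x t w).
have D31 : hadj B1 D3 = false.
  by apply/negP=> /hadjE[t t1 tD]; case/negP: y2'; rewrite -(sub D3 t y w).
have nD31 : B1 != D3 by rewrite eq_sym; apply: notin_neq wD3 w1.
apply: (gem_clique (KB_simple G) (c := B2 : gV (KB G)) (p := B1) (q := D1) (r := D3) (s := B3)) => //.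
- by rewrite (KB_simple G).1.
- by rewrite (KB_simple G).1; apply: hadjI xD x2 _; apply: notin_neq xD1 x2'.
- by rewrite (KB_simple G).1; apply: hadjI yD y2 _; apply: notin_neq yD3 y2'.
- by rewrite (KB_simple G).1; apply: hadjI xD x1 _; apply: notin_neq wD1 w1.
- apply: hadjI wD1 wD3 _; apply: notin_neq xD1 _.
  by rewrite (hadjN D31 nD31 x1').
- by apply: hadjI yD y3 _; apply: notin_neq wD3 w3.
Qed.

Hypothesis cG : forall x y : V, connect adj x y.

Lemma KB_connect B C : connect hadj B C.
Proof.
have [x [_ [xB _ _]]] := biclique_edge sG B; have [y [_ [yC _ _]]] := biclique_edge sG C.
have /connectP[p pth yE] := cG x y; subst y.
have step (D E : biclique G) z : z \in val D -> z \in val E -> connect hadj D E.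
  move=> zD zE; case: (eqVneq D E) => [->|ne]; first exact: connect0.
  by apply/connect1/(hadjI zD zE).
elim: p x B xB pth yC => [|z p IH] x B xB /=; first by move=> _; apply: step.
case/andP=> xz pth yC; have [E /subsetP sE] := biclique_ext (cbip2 sG xz).
apply: (connect_trans (step _ _ x xB (sE _ (set21 _ _)))).
exact: IH (sE _ (set22 _ _)) pth yC.
Qed.

(** A common neighbour [X] of [S], [R], [P] exists by [KB_path3]. If [X] is adjacent to [Q], then
    [P R Q X] is a clique in which [S] sees only [R] and [X]; otherwise [R] is the centre of a gem
    with path [S X P Q]. Both give a clique of size 5 in [KB (KB G)]. *)
Lemma KB_paw_free P Q R S : hadj P Q -> hadj Q R -> hadj P R -> hadj S R ->
  hadj S P = false -> hadj S Q = false -> S != P -> S != Q -> False.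
Proof.
have [hC hI] := KB_simple G.
move=> pq qr pr sr sp sq nsp nsq.
have rp : hadj R P by rewrite hC.
have [X [xs xr xp]] := KB_path3 sr rp sp nsp.
case xq: (hadj X Q).
  by apply: no5; apply: (rocket_clique (KB_simple G) (a := P) (b := R : gV (KB G)) (c := Q) (d := X) (z := S)) => //; rewrite hC.
by apply: no5; apply: (gem_clique (KB_simple G) (c := R : gV (KB G)) (p := S) (q := X) (r := P) (s := Q)) => //; rewrite hC.
Qed.

(** Domination by the edge [A B] spreads along paths. If [E] is dominated but its neighbour [D] is
    not, then [D] hangs on a triangle as in a paw: on [A B E] if [E] sees both ends, and otherwise
    on a triangle through the vertex [X] given by [KB_path3]. *)
Lemma KB_dominating A B C : hadj A B -> [|| C == A, C == B, hadj C A | hadj C B].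
Proof.
have [hC hI] := KB_simple G.
move=> ab; have /connectP[p pth ->] := KB_connect A C.
have: [|| A == A, A == B, hadj A A | hadj A B] by rewrite eqxx.
pose dom D := [|| D == A, D == B, hadj D A | hadj D B].
suff key q E : path hadj E q -> dom E -> dom (last E q) by apply: key.
elim: q E => [|D q IH] E //= /andP[ED pq] domE; apply: IH => //.
apply/negP=> /negP; rewrite !negb_or => /and4P[nA nB /negbTE hA /negbTE hB].
have DE : hadj D E by rewrite hC.
case/or4P: domE => [/eqP eE|/eqP eE|EA|EB].
- by rewrite -eE DE in hA.
- by rewrite -eE DE in hB.
- case EB: (hadj E B).
    by apply: (@KB_paw_free A B E D); rewrite // hC.
  have nBE : B != E by apply: contraFneq hB => ->.
  have [X [xb xa xe]] : exists X, [/\ hadj X B, hadj X A & hadj X E].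
    by apply: KB_path3 => //; rewrite hC.
  case xD: (hadj D X).
    by apply: (@KB_paw_free A B X D) => //; rewrite hC.
  apply: (@KB_paw_free X A E D) => //; first by rewrite hC.
  by apply: contraFneq hA => ->.
- case EA: (hadj E A).
    by apply: (@KB_paw_free A B E D); rewrite // hC.
  have nAE : A != E by apply: contraFneq hA => ->.
  have [X [xa xb xe]] : exists X, [/\ hadj X A, hadj X B & hadj X E].
    by apply: KB_path3 => //; rewrite hC.
  case xD: (hadj D X).
    by apply: (@KB_paw_free A B X D) => //; rewrite hC.
  apply: (@KB_paw_free X B E D) => //; first by rewrite hC.
  by apply: contraFneq hB => ->.
Qed.

(** If [A] and [C] were adjacent, the edge [A C] would have to dominate [B]. *)
Lemma KB_nonadj_trans A B C : hadj A B = false -> hadj B C = false -> B != A -> B != C ->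
  hadj A C = false.
Proof.
move=> ab bc nA nC; apply/negP=> /(@KB_dominating _ _ B).
by rewrite (negbTE nA) (negbTE nC) bc (KB_simple G).1 ab.
Qed.

End Multipartite.

(** * Absent patterns *)

Notation vertex := (seq nat * seq bool)%type.

(* Component [c] of a label is the number of the biclique of the c-th family that contains the
   vertex, or 0 if there is none.  A symmetry [s] permutes the families and the numbers in each. *)
Definition act (s : seq (nat * seq nat)) (t : seq nat) : seq nat :=
  [seq nth 0 p.2 (nth 0 t p.1) | p <- s].

(** The index lists along which [P] occurs in [Q]. They need not be injective, since absence of a
    pattern also covers tuples with repetitions. *)
Fixpoint embeddings (Q P : pattern) : seq (seq nat) :=
  if P is (t, row) :: P' then
    [seq k :: ks | ks <- embeddings Q P',
       k <- [seq k <- iota 0 (size Q) | (ptag Q k == t) && (row == map (padj Q k) ks)]]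
  else [:: [::]].

Section Engine.
Variables (V : Type) (adj : rel V).
Hypotheses (adjC : symmetric adj) (adjxx : irreflexive adj).
Variables (model : (V -> seq nat) -> Prop) (symmetries : seq (seq (nat * seq nat))).
Variables (rule : Type) (base : pattern -> rule -> bool).
Variables (bad : pattern -> bool) (candidates : pattern -> rule -> option (seq vertex)).

(** Absence refers to all labellings in the model at once, so that an absent pattern can be reused
    after a symmetry has changed the labels. *)
Definition absent (P : pattern) : Prop :=
  forall tag, model tag -> forall vs, pat adj tag vs <> P.

(* A certificate is a list of patterns, each of them absent because of a rule: some vertex extends
   the pattern in one of the ways listed in [candidates], and each of these is [bad] or contains
   an earlier pattern up to a symmetry.  A hint (i, s) names the i-th last pattern (from 0) and
   the s-th symmetry. *)
Definition check_lemma (st : seq pattern) (l : pattern * rule * seq (nat * nat)) : bool :=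
  let: (P, r, hints) := l in
  base P r ||
  if candidates P r is Some ws then
    all (fun w => bad (w :: P) ||
      has (fun h =>
             if (onth st h.1, onth symmetries h.2) is (Some P', Some s) then
               embeddings [seq (act s u.1, u.2) | u <- w :: P] P' != [::]
             else false) hints) ws
  else false.

Fixpoint check (st : seq pattern) (ls : seq (pattern * rule * seq (nat * nat))) : bool :=
  if ls is l :: ls' then check_lemma st l && check (l.1.1 :: st) ls' else true.

Hypothesis model_act : forall s tag, s \in symmetries -> model tag -> model (act s \o tag).
Hypothesis base_sound : forall P r, base P r -> absent P.
Hypothesis bad_sound : forall tag vs, model tag -> bad (pat adj tag vs) = false.
Hypothesis candidates_sound : forall tag vs r ws, model tag ->
  candidates (pat adj tag vs) r = Some ws -> exists v, (tag v, map (adj v) vs) \in ws.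

Lemma embeddings_sound tag v0 vs P ks : ks \in embeddings (pat adj tag vs) P ->
  all (gtn (size vs)) ks /\ pat adj tag [seq nth v0 vs k | k <- ks] = P.
Proof.
elim: P ks => [|[t row] P IH] ks /=; first by rewrite inE => /eqP->.
case/allpairsPdep=> ks' [k [/IH[ksv padjE]]]; rewrite mem_filter mem_iota size_pat /=.
case/andP=> /andP[/eqP tE /eqP rE] kv ->; split=> /=; first by rewrite kv.
rewrite padjE -tE (ptag_pat _ _ v0) //; congr ((_, _) :: _).
rewrite rE -map_comp; apply/eq_in_map => j jk /=.
by rewrite (padj_pat adjC adjxx _ v0) //; move/allP: ksv => /(_ j jk).
Qed.

(** The rule supplies an actual vertex [v], whose label and row must be on the list of candidates.
    The extended tuple occurs in the graph and so is not [bad]; hence, relabelled by a symmetry, it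
    contains an earlier pattern, which is absent for the relabelled model as well. *)
Lemma check_lemma_sound st l : {in st, forall P, absent P} -> check_lemma st l -> absent l.1.1.
Proof.
case: l => [[P r] hints] Hst /= /orP[/base_sound //|].
case cE: (candidates P r) => [ws|//] /allP Hws tag mt vs vsE.
rewrite -vsE in cE; have [v vw] := candidates_sound mt cE.
have := Hws _ vw; rewrite -vsE -[_ :: pat _ _ _]/(pat adj tag (v :: vs)) bad_sound //=.
case/hasP=> h _; case oE: (onth st h.1) => [P'|//]; case sE: (onth symmetries h.2) => [s|//].
have onthM (T : eqType) (x : T) u n : onth u n = Some x -> x \in u.
  by move=> E; rewrite -(@onth_nth _ x _ _ _ E) mem_nth // -onthTE E.
have qE := pat_map adj tag (act s) (v :: vs); rewrite /= in qE; rewrite -qE.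
case eE: embeddings => [|ks kss] // _.
have [|_ PE] := @embeddings_sound (act s \o tag) v (v :: vs) P' ks.
  by rewrite eE mem_head.
case: (Hst P' (onthM _ _ _ _ oE) (act s \o tag) (model_act (onthM _ _ _ _ sE) mt) _ PE).
Qed.

Lemma check_sound st ls : {in st, forall P, absent P} -> check st ls ->
  {in [seq l.1.1 | l <- ls], forall P, absent P}.
Proof.
elim: ls st => //= l ls IH st Hst /andP[/(check_lemma_sound Hst) aP /IH H] P.
rewrite inE => /orP[/eqP->//|]; apply: H => P'.
by rewrite inE => /orP[/eqP->//|/Hst].
Qed.
End Engine.

(* Reasons why a pattern is absent or extends by a further vertex w.  [Neighbour u c]: w is a
   neighbour of u in its biclique of family c.  [Maximal v u c]: v is outside that biclique, so by
   maximality it has an odd triple v, u, w with w inside.  [Meet c x d y]: w is common to two given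
   bicliques.  [Cross ds x]: the biclique extending [ds] is not in the family but meets one of its
   members, so it meets the member x at w.  [Crowd dss]: four pairwise intersecting bicliques
   outside the family, which form a K5 in KB(G) with any member.  [OddTriple a b c]: three vertices
   of a biclique of the family spanning an odd number of edges. *)
Inductive rule :=
  | Neighbour of nat & nat
  | Maximal of nat & nat & nat
  | Meet of nat & nat & nat & nat
  | Cross of seq nat & nat
  | Crowd of seq (seq nat)
  | OddTriple of nat & nat & nat.

(** [link] tells which labels adjacent vertices may carry, [meet] which members (family, number) are
    known to intersect, and [crossed] which members are met by every biclique that contains
    differently labelled vertices. The precise meaning is given by [named]. *)
Record theory := Theory {
  tags : seq (seq nat);
  link : rel (seq nat);
  meet : rel (nat * nat);
  crossed : pred nat }.

(** * The candidates allowed by each rule, and their soundness *)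

Section Rules.
Variable T : theory.

Fixpoint rows (t : seq nat) (P : pattern) : seq (seq bool) :=
  if P is (t', _) :: P' then
    [seq b :: r | b <- if link T t t' then [:: true; false] else [:: false], r <- rows t P']
  else [:: [::]].

(** With a single family, two different labels have a double effect on a biclique containing [ds]:
    it is no member of the family, and as one of the labels is nonzero it meets some member. *)
Definition mixed (P : pattern) (ds : seq nat) :=
  has (fun a => has (fun b => ptag P a != ptag P b) ds) ds.

Definition rule_ok (P : pattern) (r : rule) : bool :=
  match r with
  | Neighbour u c => (u < size P) && (nth 0 (ptag P u) c != 0)
  | Maximal v u c => [&& v < size P, u < size P, nth 0 (ptag P u) c != 0 &
                         nth 0 (ptag P v) c != nth 0 (ptag P u) c]
  | Meet c x d y => meet T (c, x) (d, y)
  | Cross ds x => [&& pcbip P ds, mixed P ds & crossed T x]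
  | _ => false
  end.

Definition rule_tag (P : pattern) (r : rule) (t : seq nat) : bool :=
  match r with
  | Neighbour u c | Maximal _ u c => nth 0 t c == nth 0 (ptag P u) c
  | Meet c x d y => (nth 0 t c == x) && (nth 0 t d == y)
  | Cross _ x => t == [:: x]
  | _ => false
  end.

Definition rule_row (P : pattern) (r : rule) (row : seq bool) : bool :=
  match r with
  | Neighbour u _ => nth false row u
  | Maximal v u _ => padj P v u (+) nth false row u (+) nth false row v
  | Cross ds _ =>
      all (fun a => all (fun b => ~~ (nth false row a (+) padj P a b (+) nth false row b)) ds) ds
  | _ => true
  end.

Definition candidates (P : pattern) (r : rule) : option (seq vertex) :=
  if rule_ok P r then
    Some [seq (t, row) | t <- [seq t <- tags T | rule_tag P r t],
                         row <- [seq row <- rows t P | rule_row P r row]]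
  else None.

Variables (G : bgraph) (sG : simple_graph G).
Local Notation V := (gV G).
Local Notation adj := (@gadj G).

Record named (tag : V -> seq nat) : Prop := Named {
  named_tag : forall v, tag v \in tags T;
  named_biclique : forall v c, nth 0 (tag v) c != 0 ->
    exists B : biclique G, forall w, (w \in val B) = (nth 0 (tag w) c == nth 0 (tag v) c);
  named_link : forall v u, adj v u -> link T (tag v) (tag u);
  named_meet : forall p q, meet T p q ->
    exists v, nth 0 (tag v) p.1 = p.2 /\ nth 0 (tag v) q.1 = q.2;
  named_cross : forall (B : biclique G) a b x, a \in val B -> b \in val B -> tag a != tag b ->
    crossed T x -> exists2 z, z \in val B & tag z = [:: x] }.

Lemma candidates_sound (model : (V -> seq nat) -> Prop) : (forall tag, model tag -> named tag) ->
  forall tag vs r ws, model tag -> candidates (pat adj tag vs) r = Some ws ->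
  exists v, (tag v, map (adj v) vs) \in ws.
Proof.
move=> mN tag vs r ws /mN[Ht Hb Hl Hm Hc]; rewrite /candidates.
case ok: (rule_ok _ r) => // -[<-].
have rowsP v us : map (adj v) us \in rows (tag v) (pat adj tag us).
  elim: us => [|u us IH] /=; first by rewrite inE.
  apply/allpairsPdep; exists (adj v u), (map (adj v) us); split=> //.
  by case E: (adj v u); [rewrite Hl | case: ifP]; rewrite ?inE.
set P := pat adj tag vs in ok *.
suff [v vt vr] : exists2 v, rule_tag P r (tag v) & rule_row P r (map (adj v) vs).
  exists v; apply/allpairsPdep; exists (tag v), (map (adj v) vs); rewrite !mem_filter vt vr Ht.
  by split=> //; apply: rowsP.
have pt v0 k : k < size P -> ptag P k = tag (nth v0 vs k).
  by rewrite size_pat => kP; rewrite (ptag_pat _ _ v0).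
have pa v0 i j : i < size P -> j < size P -> padj P i j = adj (nth v0 vs i) (nth v0 vs j).
  by rewrite !size_pat => ? ?; rewrite (padj_pat (adjC sG) (adjxx sG) _ v0).
have nr v v0 k : k < size P -> nth false (map (adj v) vs) k = adj v (nth v0 vs k).
  by rewrite size_pat => kP; rewrite (nth_map v0).
have v0P : 0 < size P -> exists v0 : V, True by rewrite size_pat; case: (vs) => // v; exists v.
case: r ok => //= [u c|v u c|c x d y|ds x].
- case/andP=> uP nz; have [v0 _] := v0P (leq_ltn_trans (leq0n _) uP).
  rewrite (pt v0) // in nz *; have [B BE] := Hb _ _ nz.
  have uB : nth v0 vs u \in val B by rewrite BE.
  by have [w wB wu] := biclique_nbr sG uB; exists w; rewrite ?(nr _ v0) // -BE.
- case/and4P=> vP uP nz ne; have [v0 _] := v0P (leq_ltn_trans (leq0n _) uP).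
  rewrite !(pt v0) // in nz ne *; have [B BE] := Hb _ _ nz.
  have uB : nth v0 vs u \in val B by rewrite BE.
  have vB : nth v0 vs v \notin val B by rewrite BE.
  have [w wB wp] := biclique_max sG uB vB; exists w; first by rewrite -BE.
  rewrite !(nr _ v0) // (pa v0) //; move: wp; rewrite /par (adjC sG _ w) (adjC sG _ w).
  by case: (adj w _); case: (adj w _); case: (adj _ _).
- by move=> /Hm[v [/= <- <-]]; exists v; rewrite // !eqxx.
- case/and3P=> cb mx cx; have [v0 _] : exists v0 : V, True.
    by apply: v0P; case/and3P: cb; case: (ds) mx => // d ds' _ /andP[/= /(leq_ltn_trans (leq0n _))].
  have [D /subsetP sD] := biclique_ext (pset_cbip sG v0 cb).
  have dsP k : k \in ds -> k < size P by case/and3P: cb => /allP + _ _ kd => /(_ k kd).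
  have inD k : k \in ds -> nth v0 vs k \in val D by move=> kd; apply: sD; rewrite inE map_f.
  case/hasP: mx => a ad /hasP[b bd]; rewrite !(pt v0) ?dsP // => ab.
  have [z zD zE] := Hc D _ _ x (inD a ad) (inD b bd) ab cx.
  exists z; first by rewrite zE.
  apply/allP=> i id; apply/allP=> j jd; rewrite !(nr _ v0) ?(pa v0) ?dsP //.
  by have := biclique_even sG zD (inD i id) (inD j jd); rewrite /par => ->.
Qed.

End Rules.

(** * Three disjoint bicliques *)

(** Rows of the certificates are packed into numbers; the least significant bit is the adjacency to
    the vertex listed next. *)
Fixpoint bits (n m : nat) : seq bool :=
  if n is n'.+1 then odd m :: bits n' m./2 else [::].

Fixpoint decode (tag_of : nat -> seq nat) (l : seq (nat * nat)) : pattern :=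
  if l is (t, m) :: l' then (tag_of t, bits (size l') m) :: decode tag_of l' else [::].

Definition decode_certificate (tag_of : nat -> seq nat)
    (ls : seq (seq (nat * nat) * rule * seq (nat * nat))) :=
  [seq (decode tag_of l.1.1, l.1.2, l.2) | l <- ls].

(* One family: three pairwise disjoint bicliques, numbered 1, 2 and 3. *)
Definition theory3 : theory :=
  Theory [:: [:: 0]; [:: 1]; [:: 2]; [:: 3]] (fun _ _ => true) (fun _ _ => false)
    (fun x => x \in [:: 1; 2; 3]).

Definition symmetries3 : seq (seq (nat * seq nat)) :=
  [seq [:: (0, 0 :: p)] | p <- [:: [:: 1; 2; 3]; [:: 1; 3; 2]; [:: 2; 1; 3];
                                   [:: 2; 3; 1]; [:: 3; 1; 2]; [:: 3; 2; 1]]].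

Definition base3 (P : pattern) (r : rule) : bool :=
  match r with
  | Crowd dss => [&& size dss == 4, pcrowd P dss & all (fun ds => mixed P ds) dss]
  | OddTriple a b c =>
      [&& a < size P, b < size P, c < size P, ptag P a == ptag P b, ptag P a == ptag P c,
          nth 0 (ptag P a) 0 != 0 & par (padj P) a b c]
  | _ => false
  end.

(* Found by a search that learns the absent patterns from its dead ends. *)
Definition certificate3 := decode_certificate (fun t => [:: t]) [::
  ([:: (1,2); (1,0); (1,0)], OddTriple 0 1 2, [::]);
  ([:: (1,11); (2,4); (3,0); (1,1); (2,0)], Crowd [:: [:: 1; 3; 4]; [:: 0; 3; 4]; [:: 0; 2; 4]; [:: 0; 1; 2]], [::]);
  ([:: (1,11); (2,0); (3,2); (1,1); (2,0)], Crowd [:: [:: 2; 3; 4]; [:: 0; 3; 4]; [:: 0; 1; 4]; [:: 0; 1; 2]], [::]);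
  ([:: (1,11); (0,6); (2,0); (1,1); (1,0)], Crowd [:: [:: 1; 4]; [:: 0; 2; 4]; [:: 0; 1; 3]; [:: 0; 1; 2]], [::]);
  ([:: (1,23); (0,4); (2,4); (3,0); (1,1); (1,0)], Crowd [:: [:: 2; 4; 5]; [:: 0; 1; 4; 5]; [:: 0; 1; 2; 3]; [:: 0; 1; 3; 5]], [::]);
  ([:: (1,11); (0,6); (2,2); (1,1); (1,0)], Crowd [:: [:: 2; 3; 4]; [:: 1; 2; 4]; [:: 0; 1; 3]; [:: 0; 1; 2]], [::]);
  ([:: (1,7); (0,0); (2,3); (1,0); (3,0)], Crowd [:: [:: 2; 3; 4]; [:: 0; 2; 4]; [:: 0; 1; 3]; [:: 0; 1; 2]], [::]);
  ([:: (1,7); (2,6); (3,0); (1,0); (3,0)], Crowd [:: [:: 1; 3; 4]; [:: 0; 1; 4]; [:: 0; 2; 3]; [:: 0; 1; 2]], [::]);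
  ([:: (1,15); (2,6); (3,2); (1,0); (3,0)], Crowd [:: [:: 0; 3; 4]; [:: 1; 2; 4]; [:: 0; 2; 3]; [:: 0; 1; 2]], [::]);
  ([:: (1,15); (2,2); (3,2); (1,1); (3,0)], Crowd [:: [:: 1; 3; 4]; [:: 0; 1; 4]; [:: 0; 2; 3]; [:: 0; 1; 2]], [::]);
  ([:: (1,15); (0,4); (2,1); (1,0); (1,0)], Crowd [:: [:: 2; 3]; [:: 0; 2; 4]; [:: 0; 1; 3]; [:: 0; 1; 2]], [::]);
  ([:: (1,3); (1,1); (1,0)], OddTriple 0 1 2, [::]);
  ([:: (1,7); (0,0); (2,3); (1,1); (1,0)], Crowd [:: [:: 2; 3]; [:: 0; 2; 4]; [:: 0; 1; 3]; [:: 0; 1; 2]], [::]);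
  ([:: (1,15); (0,0); (2,2); (3,2); (1,1); (1,0)], Crowd [:: [:: 2; 4; 5]; [:: 0; 1; 3; 4]; [:: 0; 3; 4; 5]; [:: 0; 1; 2; 3]], [::]);
  ([:: (1,15); (2,2); (3,2); (1,0); (1,0)], Crowd [:: [:: 1; 3]; [:: 0; 1; 4]; [:: 0; 2; 3]; [:: 0; 1; 2]], [::]);
  ([:: (1,15); (2,6); (3,2); (1,0); (1,0)], Crowd [:: [:: 1; 3; 4]; [:: 1; 2; 4]; [:: 0; 2; 3]; [:: 0; 1; 2]], [::]);
  ([:: (1,7); (0,0); (2,3); (1,0); (2,0)], Crowd [:: [:: 2; 3; 4]; [:: 0; 2; 4]; [:: 0; 1; 3]; [:: 0; 1; 2]], [::]);
  ([:: (1,15); (0,6); (2,1); (1,0); (2,0)], Crowd [:: [:: 0; 3; 4]; [:: 0; 2; 4]; [:: 1; 2; 3]; [:: 0; 1; 2]], [::]);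
  ([:: (1,15); (0,2); (2,3); (1,0); (2,0)], Crowd [:: [:: 0; 3; 4]; [:: 0; 1; 4]; [:: 1; 2; 3]; [:: 0; 1; 2]], [::]);
  ([:: (1,7); (0,2); (2,3); (1,0); (2,0)], Crowd [:: [:: 2; 3; 4]; [:: 0; 2; 4]; [:: 1; 2; 3]; [:: 0; 1; 2]], [::]);
  ([:: (1,7); (0,6); (3,0); (1,0); (2,0)], Crowd [:: [:: 1; 3; 4]; [:: 0; 1; 4]; [:: 0; 2; 3]; [:: 0; 1; 2]], [::]);
  ([:: (1,7); (0,6); (2,1); (1,0); (2,0)], Crowd [:: [:: 1; 3; 4]; [:: 0; 1; 4]; [:: 1; 2; 3]; [:: 0; 1; 2]], [::]);
  ([:: (1,15); (0,6); (2,1); (1,1); (2,0)], Crowd [:: [:: 2; 3; 4]; [:: 0; 2; 4]; [:: 1; 2; 3]; [:: 0; 1; 2]], [::]);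
  ([:: (1,15); (0,2); (2,3); (1,1); (2,0)], Crowd [:: [:: 1; 3; 4]; [:: 0; 1; 4]; [:: 1; 2; 3]; [:: 0; 1; 2]], [::]);
  ([:: (1,11); (0,4); (2,0); (1,1); (2,0)], Crowd [:: [:: 1; 3; 4]; [:: 0; 3; 4]; [:: 0; 2; 4]; [:: 0; 1; 2]], [::]);
  ([:: (1,11); (0,0); (2,2); (1,1); (2,0)], Crowd [:: [:: 2; 3; 4]; [:: 0; 3; 4]; [:: 0; 1; 4]; [:: 0; 1; 2]], [::]);
  ([:: (1,23); (0,8); (2,0); (3,1); (1,1); (1,0)], Crowd [:: [:: 1; 4; 5]; [:: 0; 3; 4; 5]; [:: 0; 1; 2; 3]; [:: 0; 2; 3; 5]], [::]);
  ([:: (1,11); (2,0); (3,3); (1,1); (1,0)], Crowd [:: [:: 2; 4]; [:: 0; 1; 4]; [:: 0; 2; 3]; [:: 0; 1; 2]], [::]);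
  ([:: (1,15); (2,2); (3,3); (1,0); (2,0)], Crowd [:: [:: 0; 3; 4]; [:: 0; 1; 4]; [:: 1; 2; 3]; [:: 0; 1; 2]], [::]);
  ([:: (1,7); (2,6); (3,1); (1,0); (2,0)], Crowd [:: [:: 1; 3; 4]; [:: 0; 1; 4]; [:: 1; 2; 3]; [:: 0; 1; 2]], [::]);
  ([:: (1,7); (0,6); (2,0); (1,0); (2,0)], Crowd [:: [:: 1; 3; 4]; [:: 0; 1; 4]; [:: 0; 2; 3]; [:: 0; 1; 2]], [::]);
  ([:: (1,5); (2,4); (1,3); (1,0); (2,0)], Crowd [:: [:: 2; 3; 4]; [:: 1; 2; 4]; [:: 0; 1; 4]; [:: 0; 1; 3]], [::]);
  ([:: (1,7); (0,2); (2,0); (1,1); (2,0)], Crowd [:: [:: 1; 3; 4]; [:: 0; 3; 4]; [:: 0; 2; 3]; [:: 0; 1; 2]], [::]);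
  ([:: (1,11); (0,4); (2,4); (1,1); (1,1); (2,0)], Crowd [:: [:: 0; 1; 2]; [:: 0; 3; 4; 5]; [:: 0; 2; 4; 5]; [:: 1; 3; 4; 5]], [::]);
  ([:: (1,13); (0,6); (1,1); (1,0); (2,0)], Crowd [:: [:: 0; 1]; [:: 1; 3; 4]; [:: 0; 3; 4]; [:: 1; 2; 3]], [::]);
  ([:: (1,13); (2,6); (1,1); (1,0); (2,0)], Crowd [:: [:: 0; 1]; [:: 1; 3; 4]; [:: 0; 3; 4]; [:: 1; 2; 3]], [::]);
  ([:: (1,27); (0,0); (2,2); (1,3); (1,0); (2,0)], Crowd [:: [:: 2; 3; 4]; [:: 0; 3; 4; 5]; [:: 0; 1; 4; 5]; [:: 0; 1; 2; 5]], [::]);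
  ([:: (1,11); (0,8); (2,2); (1,1); (1,1); (2,0)], Crowd [:: [:: 0; 1; 2]; [:: 0; 3; 4; 5]; [:: 0; 1; 4; 5]; [:: 2; 3; 4; 5]], [::]);
  ([:: (1,5); (2,6); (1,3); (1,1); (2,0)], Crowd [:: [:: 0; 3; 4]; [:: 1; 2; 4]; [:: 0; 1; 4]; [:: 1; 2; 3]], [::]);
  ([:: (1,7); (2,6); (3,0); (1,0); (2,0)], Crowd [:: [:: 1; 3; 4]; [:: 0; 1; 4]; [:: 0; 2; 3]; [:: 0; 1; 2]], [::]);
  ([:: (1,5); (0,4); (1,3); (1,0); (2,0)], Crowd [:: [:: 2; 3; 4]; [:: 1; 2; 4]; [:: 0; 1; 4]; [:: 0; 1; 3]], [::]);
  ([:: (1,11); (0,12); (3,4); (1,1); (1,0); (2,0)], Crowd [:: [:: 1; 3; 4]; [:: 0; 2; 4]; [:: 1; 4; 5]; [:: 0; 1; 2; 5]], [::]);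
  ([:: (1,5); (3,4); (1,3); (1,0); (2,0)], Crowd [:: [:: 2; 3; 4]; [:: 1; 2; 4]; [:: 0; 1; 4]; [:: 0; 1; 3]], [::]);
  ([:: (1,15); (0,6); (3,2); (1,0); (2,0)], Crowd [:: [:: 0; 3; 4]; [:: 1; 2; 4]; [:: 0; 2; 3]; [:: 0; 1; 2]], [::]);
  ([:: (1,7); (0,6); (3,0); (1,1); (2,0)], Crowd [:: [:: 0; 3; 4]; [:: 0; 1; 4]; [:: 0; 2; 3]; [:: 0; 1; 2]], [::]);
  ([:: (1,15); (2,6); (3,1); (1,1); (2,0)], Crowd [:: [:: 2; 3; 4]; [:: 0; 2; 4]; [:: 1; 2; 3]; [:: 0; 1; 2]], [::]);
  ([:: (1,7); (2,2); (3,3); (1,0); (2,0)], Crowd [:: [:: 2; 3; 4]; [:: 0; 2; 4]; [:: 1; 2; 3]; [:: 0; 1; 2]], [::]);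
  ([:: (1,15); (2,2); (3,3); (1,1); (2,0)], Crowd [:: [:: 1; 3; 4]; [:: 0; 1; 4]; [:: 1; 2; 3]; [:: 0; 1; 2]], [::]);
  ([:: (1,13); (0,4); (1,3); (1,1); (2,0)], Crowd [:: [:: 1; 3; 4]; [:: 1; 2; 4]; [:: 0; 2; 4]; [:: 0; 1; 3]], [::]);
  ([:: (1,13); (0,4); (1,1); (1,1); (3,0)], Crowd [:: [:: 0; 4]; [:: 2; 3; 4]; [:: 1; 3; 4]; [:: 0; 1; 3]], [::]);
  ([:: (1,13); (3,4); (1,1); (1,1); (2,0)], Crowd [:: [:: 0; 4]; [:: 2; 3; 4]; [:: 1; 3; 4]; [:: 0; 1; 3]], [::]);
  ([:: (1,21); (0,4); (1,5); (1,0); (3,1); (2,0)], Crowd [:: [:: 0; 2; 4; 5]; [:: 0; 1; 4; 5]; [:: 0; 2; 3; 5]; [:: 0; 1; 3; 5]], [::]);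
  ([:: (1,11); (0,6); (2,2); (3,0); (2,0)], Crowd [:: [:: 1; 3; 4]; [:: 1; 2; 4]; [:: 0; 1; 3]; [:: 0; 1; 2]], [::]);
  ([:: (1,7); (0,6); (2,0); (3,0); (1,0)], Crowd [:: [:: 1; 3; 4]; [:: 0; 1; 4]; [:: 0; 2; 3]; [:: 0; 1; 2]], [::]);
  ([:: (1,7); (0,6); (3,0); (3,0); (1,0)], Crowd [:: [:: 1; 3; 4]; [:: 0; 1; 4]; [:: 0; 2; 3]; [:: 0; 1; 2]], [::]);
  ([:: (1,7); (0,2); (2,0); (3,1); (1,0)], Crowd [:: [:: 1; 3; 4]; [:: 0; 3; 4]; [:: 0; 2; 3]; [:: 0; 1; 2]], [::]);
  ([:: (1,7); (0,6); (1,0); (3,0); (2,0)], Crowd [:: [:: 1; 3; 4]; [:: 0; 1; 4]; [:: 0; 2; 3]; [:: 0; 1; 2]], [::]);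
  ([:: (1,7); (0,4); (2,6); (3,2); (3,0); (2,0)], Crowd [:: [:: 0; 1; 2; 4]; [:: 0; 2; 4; 5]; [:: 0; 1; 2; 3]; [:: 0; 2; 3; 5]], [::]);
  ([:: (1,7); (0,4); (2,6); (1,2); (3,0); (2,0)], Crowd [:: [:: 0; 1; 2; 4]; [:: 0; 2; 4; 5]; [:: 0; 1; 2; 3]; [:: 0; 2; 3; 5]], [::]);
  ([:: (1,11); (0,24); (3,0); (1,1); (1,2); (3,0); (2,0)], Crowd [:: [:: 0; 3; 4; 6]; [:: 0; 1; 2; 4]; [:: 0; 1; 4; 6]; [:: 0; 1; 5; 6]], [::]);
  ([:: (1,7); (0,12); (2,2); (3,2); (3,0); (2,0)], Crowd [:: [:: 0; 1; 2; 4]; [:: 0; 1; 4; 5]; [:: 0; 1; 2; 3]; [:: 0; 1; 3; 5]], [::]);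
  ([:: (1,11); (0,6); (3,0); (3,1); (2,0)], Crowd [:: [:: 0; 3; 4]; [:: 0; 2; 4]; [:: 0; 1; 3]; [:: 0; 1; 2]], [::]);
  ([:: (1,7); (0,4); (2,6); (3,0); (3,1); (2,0)], Crowd [:: [:: 1; 4; 5]; [:: 0; 2; 5]; [:: 0; 1; 2; 4]; [:: 0; 1; 2; 3]], [::]);
  ([:: (1,21); (3,4); (1,5); (1,0); (3,1); (2,0)], Crowd [:: [:: 0; 2; 4; 5]; [:: 0; 1; 4; 5]; [:: 0; 2; 3; 5]; [:: 0; 1; 3; 5]], [::]);
  ([:: (1,15); (2,4); (3,1); (3,0); (2,0)], Crowd [:: [:: 0; 3; 4]; [:: 0; 2; 4]; [:: 0; 1; 3]; [:: 0; 1; 2]], [::]);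
  ([:: (1,15); (2,4); (3,3); (3,0); (2,0)], Crowd [:: [:: 0; 3; 4]; [:: 1; 2; 4]; [:: 0; 1; 3]; [:: 0; 1; 2]], [::]);
  ([:: (1,27); (2,16); (3,4); (1,1); (1,2); (3,0); (2,0)], Crowd [:: [:: 0; 3; 4; 6]; [:: 0; 1; 2; 4]; [:: 0; 1; 4; 5]; [:: 0; 1; 4; 6]], [::]);
  ([:: (1,7); (0,0); (3,3); (3,0); (2,0)], Crowd [:: [:: 2; 3; 4]; [:: 0; 2; 4]; [:: 0; 1; 3]; [:: 0; 1; 2]], [::]);
  ([:: (1,13); (3,12); (1,1); (1,2); (3,0); (2,0)], Crowd [:: [:: 0; 3; 4]; [:: 1; 4; 5]; [:: 0; 2; 3; 5]; [:: 0; 1; 3; 5]], [::]);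
  ([:: (1,11); (2,8); (3,2); (1,2); (3,0); (2,0)], Crowd [:: [:: 0; 1; 4]; [:: 1; 3; 5]; [:: 0; 1; 2]; [:: 0; 1; 5]], [::]);
  ([:: (1,15); (2,4); (3,3); (3,1); (2,0)], Crowd [:: [:: 1; 3; 4]; [:: 1; 2; 4]; [:: 0; 1; 3]; [:: 0; 1; 2]], [::]);
  ([:: (1,7); (0,0); (3,3); (3,1); (2,0)], Crowd [:: [:: 0; 3; 4]; [:: 0; 2; 4]; [:: 0; 1; 3]; [:: 0; 1; 2]], [::]);
  ([:: (1,27); (0,16); (3,4); (1,1); (1,2); (3,0); (2,0)], Crowd [:: [:: 0; 3; 4; 6]; [:: 0; 1; 2; 4]; [:: 0; 1; 4; 5]; [:: 0; 1; 4; 6]], [::]);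
  ([:: (1,11); (0,8); (3,2); (1,2); (3,0); (2,0)], Crowd [:: [:: 0; 1; 4]; [:: 1; 3; 5]; [:: 0; 1; 2]; [:: 0; 1; 5]], [::]);
  ([:: (1,7); (2,12); (3,2); (1,2); (3,0); (2,0)], Crowd [:: [:: 0; 1; 2; 4]; [:: 0; 1; 4; 5]; [:: 0; 1; 2; 3]; [:: 0; 1; 3; 5]], [::]);
  ([:: (1,11); (0,0); (3,3); (3,0); (2,0)], Crowd [:: [:: 2; 3; 4]; [:: 0; 1; 4]; [:: 0; 2; 3]; [:: 0; 1; 2]], [::]);
  ([:: (1,7); (0,0); (2,6); (3,1); (3,1); (2,0)], Crowd [:: [:: 3; 4; 5]; [:: 0; 2; 5]; [:: 0; 2; 3; 4]; [:: 0; 1; 2; 3]], [::]);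
  ([:: (1,15); (2,2); (3,3); (3,0); (2,0)], Crowd [:: [:: 0; 3; 4]; [:: 0; 1; 4]; [:: 1; 2; 3]; [:: 0; 1; 2]], [::]);
  ([:: (1,7); (2,6); (3,1); (3,0); (2,0)], Crowd [:: [:: 1; 3; 4]; [:: 0; 1; 4]; [:: 1; 2; 3]; [:: 0; 1; 2]], [::]);
  ([:: (1,15); (2,2); (3,3); (3,1); (2,0)], Crowd [:: [:: 1; 3; 4]; [:: 0; 1; 4]; [:: 1; 2; 3]; [:: 0; 1; 2]], [::]);
  ([:: (1,43); (0,8); (2,8); (1,5); (1,1); (3,0); (1,0)], Crowd [:: [:: 0; 3; 4; 5]; [:: 0; 1; 2; 4]; [:: 0; 1; 4; 5]; [:: 0; 1; 4; 6]], [::]);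
  ([:: (1,43); (0,8); (3,8); (1,5); (1,1); (3,0); (1,0)], Crowd [:: [:: 0; 3; 4; 5]; [:: 0; 1; 2; 4]; [:: 0; 1; 4; 5]; [:: 0; 1; 4; 6]], [::]);
  ([:: (1,11); (0,8); (2,0); (1,1); (1,3); (3,1); (1,0)], Crowd [:: [:: 1; 5; 6]; [:: 0; 3; 4; 5]; [:: 0; 1; 2; 4]; [:: 0; 1; 4; 5]], [::]);
  ([:: (1,11); (0,8); (2,8); (1,1); (1,1); (3,0); (2,0)], Crowd [:: [:: 0; 2; 6]; [:: 0; 3; 4; 5]; [:: 0; 1; 2; 4]; [:: 0; 1; 4; 5]], [::]);
  ([:: (1,11); (2,24); (3,0); (1,1); (1,1); (3,0); (2,0)], Crowd [:: [:: 0; 3; 4; 5]; [:: 0; 1; 2; 4]; [:: 0; 1; 4; 5]; [:: 0; 1; 5; 6]], [::]);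
  ([:: (1,7); (2,8); (3,2); (1,3); (3,0); (2,0)], Crowd [:: [:: 0; 2; 3; 4]; [:: 0; 3; 4; 5]; [:: 0; 1; 2; 3]; [:: 0; 1; 3; 5]], [::]);
  ([:: (1,43); (0,16); (3,4); (1,5); (1,1); (3,0); (1,0)], Crowd [:: [:: 0; 3; 4; 5]; [:: 0; 1; 2; 4]; [:: 0; 2; 4; 6]; [:: 0; 2; 4; 5]], [::]);
  ([:: (1,11); (0,0); (3,4); (1,1); (1,3); (3,1); (1,0)], Crowd [:: [:: 2; 5; 6]; [:: 0; 3; 4; 5]; [:: 0; 1; 2; 4]; [:: 0; 2; 4; 5]], [::]);
  ([:: (1,11); (2,16); (3,4); (1,1); (1,1); (3,0); (2,0)], Crowd [:: [:: 0; 1; 6]; [:: 0; 3; 4; 5]; [:: 0; 1; 2; 4]; [:: 0; 2; 4; 5]], [::]);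
  ([:: (1,3); (2,4); (3,1); (3,1); (2,0)], Crowd [:: [:: 1; 3; 4]; [:: 0; 1; 4]; [:: 0; 2; 3]; [:: 0; 1; 2]], [::]);
  ([:: (1,11); (0,0); (2,12); (1,1); (1,1); (3,0); (2,0)], Crowd [:: [:: 0; 3; 4; 5]; [:: 0; 1; 2; 4]; [:: 0; 2; 4; 5]; [:: 0; 2; 5; 6]], [::]);
  ([:: (1,7); (0,8); (2,12); (3,0); (1,1); (3,0); (2,0)], Crowd [:: [:: 1; 2; 4; 5]; [:: 0; 1; 2; 3]; [:: 0; 1; 2; 5]; [:: 0; 2; 5; 6]], [::]);
  ([:: (1,11); (0,24); (3,0); (1,3); (1,3); (3,0); (2,0)], Crowd [:: [:: 1; 3; 5]; [:: 0; 3; 4; 6]; [:: 0; 1; 2; 4]; [:: 0; 1; 4; 5; 6]], [::]);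
  ([:: (1,11); (0,0); (3,12); (1,3); (1,3); (3,0); (2,0)], Crowd [:: [:: 2; 3; 5]; [:: 0; 3; 4; 6]; [:: 0; 1; 2; 4]; [:: 0; 2; 4; 5; 6]], [::]);
  ([:: (1,7); (0,0); (2,12); (3,2); (1,1); (3,0); (2,0)], Crowd [:: [:: 2; 3; 4; 5]; [:: 0; 1; 2; 3]; [:: 0; 2; 3; 5]; [:: 0; 2; 5; 6]], [::]);
  ([:: (1,11); (0,6); (2,0); (3,1); (3,0)], Crowd [:: [:: 0; 3; 4]; [:: 0; 2; 4]; [:: 0; 1; 3]; [:: 0; 1; 2]], [::]);
  ([:: (1,11); (2,4); (1,0); (3,1); (3,0)], Crowd [:: [:: 1; 3; 4]; [:: 0; 3; 4]; [:: 0; 2; 4]; [:: 0; 1; 2]], [::]);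
  ([:: (1,7); (0,12); (2,4); (1,0); (3,1); (3,0)], Crowd [:: [:: 2; 4; 5]; [:: 0; 1; 4]; [:: 0; 1; 2; 3]; [:: 0; 1; 2; 5]], [::]);
  ([:: (1,5); (0,12); (1,1); (1,2); (3,1); (3,0)], Crowd [:: [:: 3; 4; 5]; [:: 0; 1; 4]; [:: 0; 2; 3; 5]; [:: 0; 1; 3; 5]], [::]);
  ([:: (3,24); (1,1); (1,4); (3,1); (3,1); (2,0)], Crowd [:: [:: 3; 4; 5]; [:: 2; 4; 5]; [:: 1; 2; 5]; [:: 0; 2; 5]], [::]);
  ([:: (1,7); (0,28); (2,8); (1,0); (3,1); (3,0); (2,0)], Crowd [:: [:: 0; 1; 4; 6]; [:: 0; 1; 2; 3]; [:: 0; 1; 2; 6]; [:: 0; 1; 5; 6]], [::]);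
  ([:: (0,28); (1,1); (1,4); (3,1); (3,0); (2,0)], Crowd [:: [:: 0; 4; 5]; [:: 0; 3; 5]; [:: 1; 2; 5]; [:: 0; 2; 5]], [::]);
  ([:: (1,3); (0,28); (2,8); (1,4); (3,1); (3,0); (2,0)], Crowd [:: [:: 0; 1; 4; 6]; [:: 1; 2; 3; 6]; [:: 0; 1; 2; 6]; [:: 0; 1; 5; 6]], [::]);
  ([:: (1,7); (0,12); (2,4); (1,0); (3,1); (2,0)], Crowd [:: [:: 2; 4; 5]; [:: 0; 1; 4]; [:: 0; 1; 2; 3]; [:: 0; 1; 2; 5]], [::]);
  ([:: (1,19); (0,6); (2,4); (3,1); (3,0); (2,0)], Crowd [:: [:: 0; 1; 4]; [:: 0; 1; 3]; [:: 0; 1; 2]; [:: 0; 1; 5]], [::]);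
  ([:: (1,47); (0,8); (2,0); (3,4); (1,0); (3,1); (3,0)], Maximal 6 2 0, [:: (40,0); (37,0); (39,0); (58,5); (15,0); (8,0); (5,2); (26,2); (39,2); (97,3); (26,4); (64,5)]);
  ([:: (0,14); (3,6); (3,1); (3,1); (2,0)], Crowd [:: [:: 2; 3; 4]; [:: 0; 2; 4]; [:: 0; 1; 4]; [:: 0; 1; 3]], [::]);
  ([:: (1,3); (0,6); (1,4); (3,1); (3,0); (2,0)], Crowd [:: [:: 0; 1; 4]; [:: 0; 1; 3]; [:: 0; 1; 2]; [:: 0; 2; 5]], [::]);
  ([:: (1,19); (0,6); (1,4); (3,1); (3,0); (2,0)], Crowd [:: [:: 0; 1; 4]; [:: 0; 1; 3]; [:: 0; 1; 2]; [:: 0; 1; 5]], [::]);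
  ([:: (1,7); (0,12); (2,0); (1,0); (3,1); (3,0)], Maximal 3 2 0, [:: (69,2); (107,2); (88,3); (5,0); (13,2); (39,2); (4,0); (8,0); (56,0); (1,0); (0,0); (7,2); (6,2); (56,2); (89,5)]);
  ([:: (1,23); (0,16); (2,0); (3,0); (1,1); (1,0); (3,0)], Neighbour 6 0, [:: (109,3); (3,2); (69,3); (79,3); (13,0); (4,0); (11,0); (70,1); (0,0); (12,0); (74,1); (97,1)]);
  ([:: (1,7); (0,2); (2,0); (3,1); (3,0)], Crowd [:: [:: 1; 3; 4]; [:: 0; 3; 4]; [:: 0; 2; 3]; [:: 0; 1; 2]], [::]);
  ([:: (1,15); (0,6); (3,2); (3,1); (3,0)], Crowd [:: [:: 1; 3]; [:: 1; 2; 4]; [:: 0; 2; 3]; [:: 0; 1; 2]], [::]);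
  ([:: (1,7); (0,2); (1,0); (3,1); (3,0)], Crowd [:: [:: 1; 3; 4]; [:: 0; 3; 4]; [:: 0; 2; 3]; [:: 0; 1; 2]], [::]);
  ([:: (1,7); (0,6); (1,0); (3,1); (3,0)], Crowd [:: [:: 0; 3; 4]; [:: 0; 1; 4]; [:: 0; 2; 3]; [:: 0; 1; 2]], [::]);
  ([:: (1,13); (0,4); (1,1); (1,2); (3,1); (3,0)], Crowd [:: [:: 1; 4; 5]; [:: 0; 1; 3]; [:: 0; 3; 4; 5]; [:: 0; 2; 3; 5]], [::]);
  ([:: (1,7); (0,6); (1,2); (3,1); (3,0)], Maximal 2 4 0, [:: (115,3); (104,3); (112,3); (105,3); (110,3); (2,0); (9,2)]);
  ([:: (1,7); (0,4); (2,6); (1,2); (3,0); (3,0)], Crowd [:: [:: 0; 1; 2; 4]; [:: 0; 2; 4; 5]; [:: 0; 1; 2; 3]; [:: 0; 2; 3; 5]], [::]);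
  ([:: (1,39); (2,12); (3,8); (1,0); (3,2); (2,0); (3,0)], Crowd [:: [:: 0; 1; 4; 6]; [:: 0; 1; 4; 5]; [:: 0; 1; 2; 3]; [:: 0; 1; 3; 6]], [::]);
  ([:: (1,23); (0,16); (2,24); (3,0); (1,1); (1,0); (3,0); (2,0)], Neighbour 6 0, [:: (118,3); (78,3); (79,5); (117,1); (76,3); (110,3); (83,1); (98,3); (0,0); (40,0); (79,3); (0,2)]);
  ([:: (1,23); (0,16); (2,8); (3,0); (1,1); (1,0); (3,0)], Maximal 1 2 0, [:: (64,2); (94,0); (94,5); (59,0); (62,0); (95,0); (57,0); (84,0); (61,0); (9,1); (63,1); (70,1); (80,2); (95,4); (0,0); (79,0); (88,0); (60,0); (58,0); (90,2); (46,4)]);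
  ([:: (1,11); (0,4); (3,4); (1,2); (3,1); (3,0)], Crowd [:: [:: 1; 4; 5]; [:: 0; 1; 2]; [:: 2; 3; 4; 5]; [:: 0; 2; 4; 5]], [::]);
  ([:: (1,27); (0,8); (3,0); (1,1); (1,0); (3,0)], Neighbour 2 0, [:: (121,3); (9,0); (73,3); (8,0); (7,0); (5,0); (0,0); (6,0)]);
  ([:: (1,3); (2,4); (3,3); (3,2); (2,1); (2,0)], Crowd [:: [:: 0; 2; 3; 4]; [:: 2; 3; 4; 5]; [:: 0; 1; 2; 4]; [:: 1; 2; 4; 5]], [::]);
  ([:: (1,7); (2,24); (3,10); (1,0); (3,0); (2,0); (2,0)], Crowd [:: [:: 0; 2; 4; 6]; [:: 0; 1; 2; 3]; [:: 0; 1; 2; 6]; [:: 0; 1; 5; 6]], [::]);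
  ([:: (1,11); (2,48); (3,20); (1,1); (1,4); (3,0); (2,0); (2,0)], Crowd [:: [:: 0; 2; 5; 7]; [:: 0; 1; 6; 7]; [:: 0; 3; 4; 7]; [:: 0; 1; 2; 4; 7]], [::]);
  ([:: (1,11); (2,16); (3,4); (1,1); (1,0); (3,0); (2,0)], Cross [:: 0; 2; 5] 2, [:: (125,2); (114,2); (62,2); (83,2); (1,0); (86,2); (90,2); (0,0); (41,4)]);
  ([:: (1,87); (0,0); (2,16); (3,4); (1,1); (1,0); (3,0); (2,0)], Cross [:: 0; 3; 6] 2, [:: (126,2); (0,2); (115,2); (99,4); (8,1); (35,1); (32,1)]);
  ([:: (1,7); (2,8); (3,6); (1,0); (3,0); (2,0)], Maximal 2 1 0, [:: (127,2); (116,2); (96,4); (92,4); (3,0); (9,1); (92,2); (96,2); (9,3); (49,3); (49,4); (4,5)]);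
  ([:: (1,23); (0,32); (2,0); (3,4); (1,5); (1,2); (3,0); (2,0)], Cross [:: 0; 1; 5; 7] 3, [:: (128,3); (99,1); (53,2); (66,4); (36,1); (66,3); (53,0); (37,1)]);
  ([:: (1,23); (0,0); (2,16); (3,4); (1,5); (1,2); (3,0); (2,0)], Cross [:: 0; 2; 5; 7] 3, [:: (129,3); (118,3); (100,1); (66,3); (62,0); (36,1); (53,3); (80,5)]);
  ([:: (1,23); (0,0); (2,0); (3,4); (1,1); (1,0); (3,0)], Maximal 1 2 0, [:: (106,0); (63,1); (90,0); (99,0); (8,1); (52,1); (81,1); (41,2); (68,1); (54,1); (129,0); (20,1); (4,0); (3,0); (2,0); (95,0); (1,0); (0,0); (41,0); (10,1); (39,1); (36,1); (47,1); (42,1); (46,1); (40,1)]);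
  ([:: (1,15); (3,2); (1,2); (3,0); (2,0)], Crowd [:: [:: 0; 3; 4]; [:: 0; 1; 4]; [:: 0; 2; 3]; [:: 0; 1; 2]], [::]);
  ([:: (1,55); (0,0); (2,0); (3,4); (1,1); (1,0); (3,0)], Maximal 1 2 0, [:: (65,0); (67,0); (108,0); (125,3); (68,0); (61,0); (62,0); (10,1); (86,5); (59,0); (63,0); (124,0); (60,0); (0,0); (66,0); (22,1); (1,1); (62,2)]);
  ([:: (1,7); (0,8); (2,2); (3,3); (3,0); (3,0)], Crowd [:: [:: 0; 2; 3; 4]; [:: 0; 3; 4; 5]; [:: 0; 1; 2; 3]; [:: 0; 1; 3; 5]], [::]);
  ([:: (2,28); (1,1); (1,4); (3,1); (3,0); (2,0)], Crowd [:: [:: 0; 4; 5]; [:: 0; 3; 5]; [:: 1; 2; 5]; [:: 0; 2; 5]], [::]);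
  ([:: (1,7); (0,0); (2,6); (3,5); (3,1); (3,0); (2,0)], Crowd [:: [:: 0; 2; 5]; [:: 0; 2; 3; 4]; [:: 0; 3; 4; 6]; [:: 0; 1; 2; 3]], [::]);
  ([:: (1,1); (2,3); (3,3); (3,1); (2,0)], Crowd [:: [:: 1; 3; 4]; [:: 1; 2; 4]; [:: 0; 1; 3]; [:: 0; 1; 2]], [::]);
  ([:: (1,15); (0,0); (2,12); (3,2); (1,0); (3,1); (3,0)], Maximal 3 2 0, [:: (136,4); (130,2); (91,4); (62,0); (63,0); (61,0); (9,1); (59,2); (121,4); (1,0); (41,0); (0,0); (80,1); (59,4)]);
  ([:: (1,23); (0,0); (2,8); (3,4); (1,1); (1,0); (3,0)], Maximal 2 3 0, [:: (138,3); (127,3); (4,0); (137,1); (60,2); (98,3); (130,5); (0,0); (103,1); (107,3); (15,4); (7,0); (5,0); (107,1); (89,5)]);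
  ([:: (1,15); (2,6); (3,1); (3,1); (3,0)], Crowd [:: [:: 0; 3]; [:: 0; 2; 4]; [:: 1; 2; 3]; [:: 0; 1; 2]], [::]);
  ([:: (1,7); (2,6); (3,1); (3,1); (3,0)], Crowd [:: [:: 0; 3; 4]; [:: 0; 1; 4]; [:: 1; 2; 3]; [:: 0; 1; 2]], [::]);
  ([:: (1,55); (0,0); (2,8); (3,4); (1,1); (1,0); (3,0)], Maximal 2 6 0, [:: (141,3); (130,3); (0,0); (1,0); (91,3); (117,1); (116,1); (106,1); (19,0); (8,0)]);
  ([:: (1,23); (0,16); (2,0); (3,0); (1,1); (1,1); (3,0)], Maximal 6 0 0, [:: (142,0); (131,0); (93,0); (102,1); (62,0); (60,0); (75,5); (32,0); (61,0)]);
  ([:: (1,23); (0,16); (2,8); (3,0); (1,1); (1,1); (3,0)], Neighbour 3 0, [:: (143,3); (37,2); (112,3); (118,1); (103,3); (101,3); (105,3); (1,0); (124,3); (12,5); (134,5)]);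
  ([:: (1,23); (0,0); (2,0); (3,4); (1,1); (1,1); (3,0)], Maximal 1 2 0, [:: (119,0); (89,4); (104,0); (113,0); (109,0); (77,4); (55,0); (68,1); (59,0); (34,1); (22,1); (11,1); (24,1); (1,1); (95,1); (0,1); (105,0); (13,1); (70,1); (66,1); (89,1); (16,1); (77,1); (55,2); (79,2); (66,4)]);
  ([:: (1,23); (0,0); (2,8); (3,4); (1,1); (1,1); (3,0)], Maximal 6 4 0, [:: (145,0); (134,0); (114,1); (110,1); (59,0); (58,0); (129,1); (6,0); (139,0)]);
  ([:: (1,23); (0,16); (2,0); (3,0); (1,3); (1,1); (3,0)], Neighbour 3 0, [:: (146,3); (111,3); (40,2); (115,3); (121,1); (106,3); (125,3); (13,0); (4,0)]);
  ([:: (1,23); (0,16); (2,8); (3,0); (1,3); (1,1); (3,0)], Neighbour 6 0, [:: (147,3); (112,3); (41,2); (107,3); (105,3); (109,3); (15,5); (14,0); (126,3)]);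
  ([:: (1,11); (0,0); (3,4); (1,3); (1,3); (3,1); (3,0)], Crowd [:: [:: 2; 3; 5; 6]; [:: 0; 3; 4; 6]; [:: 0; 2; 4; 5]; [:: 0; 1; 2; 4]], [::]);
  ([:: (0,16); (3,12); (1,3); (1,3); (3,0); (3,0)], Crowd [:: [:: 1; 2; 4]; [:: 2; 3; 5]; [:: 1; 3; 4; 5]; [:: 0; 1; 3; 5]], [::]);
  ([:: (1,23); (0,0); (2,0); (3,4); (1,3); (1,1); (3,0)], Maximal 1 2 0, [:: (126,0); (125,0); (111,1); (72,5); (28,1); (75,2); (74,2); (142,5); (75,0); (121,0); (61,0); (40,1); (17,1); (30,1); (76,1); (2,1); (74,1); (19,1); (4,1); (121,1); (142,2)]);
  ([:: (1,3); (0,0); (2,2); (1,3); (3,1); (3,0)], Crowd [:: [:: 2; 3; 4]; [:: 0; 2; 4]; [:: 2; 4; 5]; [:: 0; 1; 2]], [::]);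
  ([:: (1,23); (0,0); (2,8); (3,4); (1,3); (1,1); (3,0)], Maximal 5 3 0, [:: (152,3); (141,3); (121,1); (114,1); (112,3); (103,5); (107,3); (125,0); (3,0); (127,1); (21,0); (19,0); (18,0); (13,0); (10,0); (35,0); (0,0)]);
  ([:: (1,23); (0,0); (2,0); (3,0); (1,1); (1,0)], Maximal 1 3 0, [:: (129,1); (128,1); (31,0); (104,0); (113,1); (122,1); (118,1); (43,0); (33,0); (22,0); (20,0); (14,0); (11,0); (10,0); (9,0); (8,0); (7,0); (6,0); (5,0); (2,0); (0,0)]);
  ([:: (1,55); (0,8); (2,0); (3,0); (1,1); (1,1); (3,0)], Neighbour 6 0, [:: (154,3); (136,1); (135,1); (119,1); (115,1); (153,1); (110,1); (113,1); (111,1); (123,1); (116,1); (115,3); (42,5)]);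
  ([:: (1,23); (0,8); (2,0); (3,0); (1,1); (1,0)], Cross [:: 1; 4; 5] 3, [:: (100,0); (113,0); (135,1); (112,1); (123,1); (105,1); (122,1); (0,0); (120,1)]);
  ([:: (1,23); (0,0); (2,4); (3,0); (1,1); (1,0)], Cross [:: 0; 1; 3; 5] 2, [:: (2,0); (120,0); (155,0); (119,0); (118,0); (117,2); (155,2)]);
  ([:: (1,11); (0,4); (3,4); (1,1); (1,1); (2,0)], Crowd [:: [:: 0; 1; 2]; [:: 0; 3; 4; 5]; [:: 0; 2; 4; 5]; [:: 1; 3; 4; 5]], [::]);
  ([:: (1,11); (0,4); (3,0); (1,1); (1,0)], Cross [:: 0; 2; 4] 2, [:: (2,0); (124,0); (0,0); (148,0); (132,1); (103,1); (47,4); (52,5)]);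
  ([:: (1,23); (0,0); (2,4); (3,2); (1,1); (1,0)], Cross [:: 0; 1; 5] 2, [:: (131,0); (150,1); (124,0); (134,0); (122,0); (121,0); (2,1); (146,1); (134,2); (84,4)]);
  ([:: (1,7); (0,2); (3,1); (1,0)], Maximal 1 2 0, [:: (143,1); (142,1); (139,1); (141,1); (138,1); (137,1)]);
  ([:: (1,7); (0,0); (2,0); (3,0); (1,0)], Neighbour 4 0, [:: (161,0); (2,0); (0,0); (7,0); (4,0); (1,0); (4,1)]);
  ([:: (1,11); (0,10); (2,4); (1,1); (1,0); (2,0)], Crowd [:: [:: 0; 1; 3; 4]; [:: 0; 1; 2; 4]; [:: 0; 1; 3; 5]; [:: 0; 1; 2; 5]], [::]);
  ([:: (1,19); (0,2); (2,2); (1,2); (1,1); (3,0)], Crowd [:: [:: 0; 3; 4; 5]; [:: 0; 2; 4; 5]; [:: 0; 1; 3; 5]; [:: 0; 1; 2; 5]], [::]);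
  ([:: (1,19); (0,2); (2,2); (1,2); (1,1); (2,0)], Crowd [:: [:: 0; 3; 4; 5]; [:: 0; 2; 4; 5]; [:: 0; 1; 3; 5]; [:: 0; 1; 2; 5]], [::]);
  ([:: (1,7); (0,8); (2,2); (1,3); (1,0); (2,0)], Crowd [:: [:: 0; 2; 3; 4]; [:: 0; 3; 4; 5]; [:: 0; 1; 2; 3]; [:: 0; 1; 3; 5]], [::]);
  ([:: (0,18); (2,12); (1,1); (1,3); (1,0); (2,0)], Crowd [:: [:: 1; 3; 4; 5]; [:: 2; 3; 4; 5]; [:: 0; 2; 3; 5]; [:: 0; 1; 3; 5]], [::]);
  ([:: (1,7); (0,4); (2,12); (3,2); (1,0); (1,0); (2,0)], Crowd [:: [:: 0; 1; 4]; [:: 0; 1; 2; 3]; [:: 0; 2; 3; 5]; [:: 0; 2; 5; 6]], [::]);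
  ([:: (1,11); (0,0); (2,3); (1,1); (2,0)], Crowd [:: [:: 0; 3; 4]; [:: 0; 1; 4]; [:: 0; 2; 3]; [:: 0; 1; 2]], [::]);
  ([:: (1,7); (0,8); (2,2); (1,3); (1,0); (3,0)], Crowd [:: [:: 0; 2; 3; 4]; [:: 0; 3; 4; 5]; [:: 0; 1; 2; 3]; [:: 0; 1; 3; 5]], [::]);
  ([:: (1,23); (0,4); (2,8); (3,0); (1,1); (1,1); (1,0)], Cross [:: 0; 1; 4; 5] 2, [:: (8,0); (168,0); (1,0); (4,0); (3,0); (135,0); (145,2); (145,0); (5,0)]);
  ([:: (1,7); (0,4); (2,12); (3,2); (1,0); (1,0); (3,0)], Crowd [:: [:: 0; 1; 4]; [:: 0; 1; 2; 3]; [:: 0; 2; 3; 5]; [:: 0; 2; 5; 6]], [::]);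
  ([:: (1,11); (0,0); (2,3); (1,0); (3,0)], Crowd [:: [:: 2; 3; 4]; [:: 0; 1; 4]; [:: 0; 2; 3]; [:: 0; 1; 2]], [::]);
  ([:: (1,7); (0,0); (2,6); (3,1); (1,1); (3,0)], Crowd [:: [:: 3; 4; 5]; [:: 0; 2; 5]; [:: 0; 2; 3; 4]; [:: 0; 1; 2; 3]], [::]);
  ([:: (1,11); (0,0); (2,3); (1,1); (3,0)], Crowd [:: [:: 0; 3; 4]; [:: 0; 1; 4]; [:: 0; 2; 3]; [:: 0; 1; 2]], [::]);
  ([:: (1,23); (0,4); (2,8); (3,4); (1,1); (1,1); (1,0)], Maximal 2 3 0, [:: (174,1); (13,3); (133,0); (140,1); (0,0); (2,0); (1,0); (2,3); (3,0); (122,0); (5,0); (7,1); (12,1); (144,1); (124,0); (121,0); (4,0); (169,1); (159,1); (6,1); (25,5)]);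
  ([:: (1,23); (0,4); (2,0); (3,0); (1,1); (1,0)], Maximal 1 5 0, [:: (176,0); (165,0); (14,0); (173,0); (5,0); (0,0); (173,1); (5,1)]);
  ([:: (1,15); (0,0); (2,2); (3,1); (1,0)], Maximal 1 0 0, [:: (177,0); (16,0); (166,0); (165,0); (167,1); (15,0); (165,1)]);
  ([:: (1,7); (0,4); (2,0); (3,0); (1,0)], Neighbour 0 0, [:: (178,0); (17,0); (175,1); (0,0); (1,0); (174,0); (174,1)]);
  ([:: (1,7); (2,6); (3,0); (1,1); (3,0)], Crowd [:: [:: 0; 3; 4]; [:: 0; 1; 4]; [:: 0; 2; 3]; [:: 0; 1; 2]], [::]);
  ([:: (1,7); (2,6); (3,0); (1,1); (2,0)], Crowd [:: [:: 0; 3; 4]; [:: 0; 1; 4]; [:: 0; 2; 3]; [:: 0; 1; 2]], [::]);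
  ([:: (1,15); (0,0); (2,2); (3,0); (1,0)], Maximal 3 4 0, [:: (181,0); (170,0); (167,0); (166,0); (154,1); (19,0); (2,0)]);
  ([:: (1,11); (2,8); (3,1); (1,1); (1,1); (3,0)], Crowd [:: [:: 0; 2; 3; 4]; [:: 0; 3; 4; 5]; [:: 0; 1; 2; 4]; [:: 0; 1; 4; 5]], [::]);
  ([:: (1,19); (2,4); (3,1); (1,2); (1,1); (3,0)], Crowd [:: [:: 0; 3; 4; 5]; [:: 0; 1; 4; 5]; [:: 0; 2; 3; 5]; [:: 0; 1; 2; 5]], [::]);
  ([:: (1,23); (0,0); (2,8); (3,1); (1,1); (1,1); (1,0)], Cross [:: 0; 2; 5; 6] 3, [:: (22,0); (0,0); (1,0); (149,1); (47,2); (61,2); (183,3); (160,1); (183,1)]);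
  ([:: (1,23); (0,16); (2,8); (3,1); (1,1); (1,1); (1,0)], Cross [:: 0; 1; 2; 5; 6] 3, [:: (23,0); (23,3); (1,0); (16,1); (62,2); (3,3)]);
  ([:: (1,23); (0,0); (2,0); (3,1); (1,1); (1,0)], Maximal 3 4 0, [:: (186,0); (25,0); (174,1); (24,0); (7,0); (1,0); (0,0)]);
  ([:: (1,7); (0,0); (2,0); (3,1); (1,0)], Neighbour 4 0, [:: (187,0); (26,0); (175,1); (0,0); (5,0); (28,1); (26,1)]);
  ([:: (1,7); (0,4); (2,0); (3,1); (1,0)], Maximal 1 0 0, [:: (188,0); (27,0); (26,0); (0,0); (24,0); (185,0); (0,1); (27,1)]);
  ([:: (1,7); (0,0); (2,0); (3,0)], Maximal 2 0 0, [:: (28,1); (27,0); (10,0); (7,0); (1,0); (0,0); (11,0)]);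
  ([:: (1,19); (0,2); (2,5); (3,0); (1,1); (1,0)], Crowd [:: [:: 2; 4; 5]; [:: 2; 3; 5]; [:: 0; 1; 5]; [:: 0; 1; 2; 3]], [::]);
  ([:: (1,7); (0,0); (2,0); (1,0)], Cross [:: 0; 1; 2; 3] 3, [:: (1,0); (1,3)]);
  ([:: (1,3); (0,2); (2,1); (3,0); (1,0)], Neighbour 0 0, [:: (192,0); (0,0); (33,1); (1,0); (117,5)]);
  ([:: (1,7); (0,2); (2,0); (1,0)], Maximal 2 3 0, [:: (193,0); (182,0); (183,0); (190,0); (32,1); (34,1)]);
  ([:: (1,3); (0,0); (2,1); (1,0)], Neighbour 3 0, [:: (194,0); (2,0); (0,0); (182,0); (33,1)]);
  ([:: (1,3); (0,2); (2,1); (3,0)], Maximal 1 0 0, [:: (1,0); (0,0); (34,1); (2,0); (5,3)]);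
  ([:: (1,3); (0,0); (2,0)], Cross [:: 0; 1; 2] 3, [:: (6,0); (0,0)]);
  ([:: (1,9); (0,7); (2,3); (3,0); (1,0)], Crowd [:: [:: 1; 3; 4]; [:: 0; 2; 4]; [:: 0; 1; 3]; [:: 0; 1; 2]], [::]);
  ([:: (0,15); (2,6); (3,2); (3,0); (1,0)], Crowd [:: [:: 0; 3; 4]; [:: 1; 2; 4]; [:: 0; 2; 3]; [:: 0; 1; 2]], [::]);
  ([:: (1,13); (0,3); (2,1); (3,0); (1,0)], Crowd [:: [:: 0; 3; 4]; [:: 0; 1; 4]; [:: 0; 2; 3]; [:: 0; 1; 2]], [::]);
  ([:: (1,13); (0,7); (2,1); (3,1); (1,0)], Crowd [:: [:: 2; 3; 4]; [:: 1; 2; 4]; [:: 0; 2; 3]; [:: 0; 1; 2]], [::]);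
  ([:: (1,5); (0,7); (2,3); (3,1); (1,0)], Crowd [:: [:: 0; 3; 4]; [:: 0; 1; 4]; [:: 0; 2; 3]; [:: 0; 1; 2]], [::]);
  ([:: (1,9); (0,7); (3,1); (3,0); (1,0)], Crowd [:: [:: 1; 3; 4]; [:: 1; 2; 4]; [:: 0; 1; 3]; [:: 0; 1; 2]], [::]);
  ([:: (1,9); (0,7); (3,3); (3,0); (1,0)], Crowd [:: [:: 1; 3; 4]; [:: 0; 2; 4]; [:: 0; 1; 3]; [:: 0; 1; 2]], [::]);
  ([:: (1,9); (0,7); (3,3); (3,1); (1,0)], Crowd [:: [:: 0; 3; 4]; [:: 0; 2; 4]; [:: 0; 1; 3]; [:: 0; 1; 2]], [::]);
  ([:: (0,15); (2,2); (3,2); (3,1); (3,0)], Crowd [:: [:: 1; 3; 4]; [:: 0; 1; 4]; [:: 0; 2; 3]; [:: 0; 1; 2]], [::]);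
  ([:: (0,15); (2,6); (3,2); (3,1); (3,0)], Crowd [:: [:: 1; 3]; [:: 1; 2; 4]; [:: 0; 2; 3]; [:: 0; 1; 2]], [::]);
  ([:: (1,1); (0,7); (2,2); (3,0); (3,0)], Neighbour 4 0, [:: (207,3); (1,0); (0,0); (10,1); (151,3); (10,4)]);
  ([:: (1,5); (0,3); (2,1); (3,0)], Maximal 2 0 0, [:: (11,2); (8,0); (7,0); (6,0); (10,1); (11,3); (9,4)]);
  ([:: (0,1); (3,1); (3,0)], Cross [:: 0; 1; 2] 2, [:: (12,4); (12,5)]);
  ([:: (1,1); (0,3); (3,1); (3,0)], Neighbour 0 0, [:: (0,4); (6,0); (7,0); (5,0)]);
  ([:: (1,1); (0,3); (2,0); (3,0)], Maximal 2 3 0, [:: (1,0); (0,2); (14,4); (3,0); (2,0)]);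
  ([:: (1,1); (0,1); (2,0)], Cross [:: 0; 1; 2] 3, [:: (0,0); (15,1)]);
  ([:: (1,1); (0,0)], Cross [:: 0; 1] 2, [:: (16,0); (0,0)]);
  ([:: (1,15); (2,12); (1,0); (3,2); (1,0); (2,0)], Crowd [:: [:: 1; 4; 5]; [:: 0; 2; 3; 4]; [:: 0; 1; 2; 3]; [:: 0; 1; 3; 5]], [::]);
  ([:: (1,15); (2,6); (3,2); (1,0); (2,0)], Crowd [:: [:: 0; 3; 4]; [:: 1; 2; 4]; [:: 0; 2; 3]; [:: 0; 1; 2]], [::]);
  ([:: (1,23); (2,2); (3,0); (1,1); (1,1); (2,0)], Crowd [:: [:: 1; 3; 4]; [:: 0; 3; 4; 5]; [:: 0; 2; 3; 5]; [:: 0; 1; 2; 5]], [::]);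
  ([:: (1,7); (2,2); (3,4); (1,3); (1,0); (2,0)], Crowd [:: [:: 0; 1; 2]; [:: 0; 3; 4; 5]; [:: 0; 2; 3; 5]; [:: 1; 3; 4; 5]], [::]);
  ([:: (1,15); (2,2); (1,2); (1,1); (2,0)], Crowd [:: [:: 2; 3; 4]; [:: 1; 3; 4]; [:: 0; 1; 4]; [:: 0; 1; 2]], [::]);
  ([:: (1,15); (2,6); (1,2); (1,1); (2,0)], Crowd [:: [:: 1; 3]; [:: 2; 3; 4]; [:: 1; 2; 4]; [:: 0; 1; 2]], [::]);
  ([:: (1,47); (2,4); (1,4); (3,0); (1,1); (1,0); (2,0)], Neighbour 6 0, [:: (220,2); (185,0); (189,0); (182,0); (0,0); (181,0); (5,0); (4,0); (39,0); (219,0); (181,2)]);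
  ([:: (1,15); (2,4); (1,4); (3,0); (1,1); (1,0)], Cross [:: 0; 2; 3; 4] 2, [:: (0,0); (186,0); (4,0); (220,0); (3,0); (183,0); (182,2); (220,2)]);
  ([:: (1,15); (2,4); (1,0); (3,0); (1,0)], Maximal 3 4 0, [:: (222,0); (211,0); (208,0); (207,0); (0,0); (195,1)]);
  ([:: (1,7); (2,6); (3,0); (3,0); (2,0)], Crowd [:: [:: 1; 3; 4]; [:: 0; 1; 4]; [:: 0; 2; 3]; [:: 0; 1; 2]], [::]);
  ([:: (1,11); (2,12); (1,5); (1,0); (3,0); (2,0)], Crowd [:: [:: 0; 2; 4]; [:: 1; 4; 5]; [:: 0; 2; 3; 5]; [:: 0; 1; 2; 5]], [::]);
  ([:: (1,11); (2,12); (3,4); (1,2); (3,0); (2,0)], Crowd [:: [:: 0; 2; 4]; [:: 1; 4; 5]; [:: 1; 2; 3; 5]; [:: 0; 1; 2; 5]], [::]);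
  ([:: (1,7); (2,8); (1,14); (3,0); (1,0); (3,1); (1,0)], Crowd [:: [:: 1; 5; 6]; [:: 0; 2; 4; 5]; [:: 0; 1; 2; 3]; [:: 0; 1; 2; 5]], [::]);
  ([:: (1,7); (2,0); (1,10); (3,6); (1,2); (3,0); (2,0)], Crowd [:: [:: 3; 4; 6]; [:: 0; 1; 2; 3]; [:: 0; 2; 3; 6]; [:: 0; 3; 5; 6]], [::]);
  ([:: (1,11); (2,8); (3,6); (1,2); (3,0); (2,0)], Crowd [:: [:: 2; 4; 5]; [:: 0; 1; 4]; [:: 1; 2; 3; 5]; [:: 0; 1; 2; 5]], [::]);
  ([:: (1,19); (2,0); (3,2); (1,3); (3,1); (2,0)], Crowd [:: [:: 2; 3; 4]; [:: 0; 3; 5]; [:: 0; 2; 4; 5]; [:: 0; 1; 2; 5]], [::]);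
  ([:: (1,11); (2,10); (1,0); (3,3); (3,0); (2,0)], Crowd [:: [:: 3; 4; 5]; [:: 0; 1; 5]; [:: 0; 1; 3; 4]; [:: 0; 1; 2; 4]], [::]);
  ([:: (1,23); (2,4); (1,0); (3,2); (3,1); (3,0)], Maximal 3 1 0, [:: (223,0); (224,3); (185,5); (224,2); (185,4); (7,2); (192,3); (157,0); (0,0); (135,0); (103,1); (166,2); (181,3); (8,3); (192,4); (153,4); (196,5)]);
  ([:: (1,7); (2,12); (1,0); (3,2); (3,1); (3,0)], Maximal 3 1 0, [:: (231,4); (225,2); (186,4); (158,0); (136,0); (1,0); (154,2); (154,4); (193,4); (0,2); (163,2); (4,5); (197,5); (13,5)]);
  ([:: (1,7); (2,8); (1,2); (3,0); (1,0); (3,0)], Neighbour 5 0, [:: (233,3); (10,5); (191,3); (1,0); (0,0); (198,1); (232,1); (155,2)]);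
  ([:: (1,11); (2,4); (3,4); (1,2); (3,1); (2,0)], Crowd [:: [:: 1; 4; 5]; [:: 0; 1; 2]; [:: 2; 3; 4; 5]; [:: 0; 2; 4; 5]], [::]);
  ([:: (1,15); (2,2); (3,2); (3,1); (3,0)], Crowd [:: [:: 1; 3; 4]; [:: 0; 1; 4]; [:: 0; 2; 3]; [:: 0; 1; 2]], [::]);
  ([:: (1,11); (2,4); (3,4); (1,2); (3,1); (3,0)], Crowd [:: [:: 1; 4; 5]; [:: 0; 1; 2]; [:: 2; 3; 4; 5]; [:: 0; 2; 4; 5]], [::]);
  ([:: (1,23); (2,8); (1,2); (3,0); (1,0); (3,0)], Neighbour 3 0, [:: (237,3); (14,5); (1,0); (141,0); (97,0); (0,0); (12,1); (159,2)]);
  ([:: (1,7); (2,8); (1,6); (3,0); (1,0); (3,0)], Maximal 5 2 0, [:: (238,0); (227,0); (196,0); (188,1); (4,0); (11,0); (15,1); (237,3)]);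
  ([:: (1,39); (2,0); (1,2); (3,2); (1,0); (3,1); (2,0)], Maximal 3 1 0, [:: (239,2); (238,4); (200,4); (15,1); (176,2); (200,2); (5,1); (204,0); (238,0); (197,0); (150,0); (0,1); (161,2); (170,4)]);
  ([:: (1,7); (2,16); (1,10); (3,6); (1,0); (3,0); (2,0)], Maximal 2 1 0, [:: (240,2); (201,2); (229,2); (209,2); (205,2); (1,1); (114,0); (112,0); (162,1); (9,1); (162,4); (209,4)]);
  ([:: (1,7); (2,0); (1,2); (3,2); (1,0); (3,0)], Cross [:: 0; 3; 5] 2, [:: (178,0); (113,0); (240,2); (8,5); (1,0); (206,0); (240,0); (0,0); (199,0); (7,1); (2,1); (202,2)]);
  ([:: (1,23); (2,0); (1,2); (3,2); (1,0); (3,0)], Maximal 5 1 0, [:: (178,0); (177,0); (240,0); (235,3); (196,5); (192,0); (173,0); (13,0); (0,1); (4,1); (176,0); (174,0)]);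
  ([:: (1,7); (2,0); (1,6); (3,2); (1,0); (3,0)], Neighbour 1 0, [:: (208,0); (212,0); (242,0); (204,0); (154,0); (235,2); (0,1); (165,1); (158,0); (1,1); (169,1); (115,1); (165,2); (154,3); (236,5)]);
  ([:: (1,7); (2,8); (1,6); (3,0); (1,1); (3,0)], Maximal 4 1 0, [:: (64,0); (237,1); (237,4); (242,4); (198,0); (198,2); (21,1); (237,2); (175,5); (2,1); (194,1); (9,3); (18,3)]);
  ([:: (1,7); (2,0); (1,6); (3,1); (3,1); (2,0)], Crowd [:: [:: 3; 4; 5]; [:: 0; 2; 5]; [:: 0; 2; 3; 4]; [:: 0; 1; 2; 3]], [::]);
  ([:: (2,16); (1,14); (3,6); (1,1); (3,0); (3,0)], Crowd [:: [:: 2; 3; 4]; [:: 1; 3; 5]; [:: 1; 2; 4; 5]; [:: 0; 1; 2; 5]], [::]);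
  ([:: (1,7); (2,0); (1,6); (3,2); (1,1); (3,0)], Maximal 4 1 0, [:: (245,0); (208,1); (169,5); (205,0); (17,0); (5,1); (4,1); (169,1); (218,1); (2,1); (208,5); (1,0); (24,1); (197,1); (112,4)]);
  ([:: (1,7); (2,0); (1,2); (3,0); (1,0)], Maximal 1 3 0, [:: (246,1); (247,1); (14,0); (10,0); (9,0); (6,0); (5,0); (4,0); (206,0); (3,0); (0,0); (198,1); (213,1); (217,1)]);
  ([:: (1,7); (2,2); (3,1); (1,0)], Maximal 2 1 0, [:: (221,0); (240,1); (220,0); (203,0); (204,0); (202,0)]);
  ([:: (1,7); (2,8); (1,6); (3,1); (1,0); (1,0)], Cross [:: 0; 2; 3; 4] 2, [:: (1,0); (215,0); (66,1); (67,1); (249,2); (127,3); (3,4)]);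
  ([:: (1,7); (2,0); (1,2); (3,1); (1,0)], Maximal 3 2 0, [:: (251,0); (240,0); (2,0); (0,0); (1,0); (28,1)]);
  ([:: (1,7); (2,0); (1,0); (3,0)], Maximal 1 0 0, [:: (252,0); (241,0); (29,0); (3,0); (2,0); (0,0)]);
  ([:: (1,11); (2,10); (1,1); (3,2); (1,0); (3,0)], Crowd [:: [:: 2; 3; 5]; [:: 0; 1; 5]; [:: 0; 1; 2; 4]; [:: 0; 1; 2; 3]], [::]);
  ([:: (1,13); (2,5); (3,0); (1,1); (3,0)], Crowd [:: [:: 1; 3; 4]; [:: 1; 2; 4]; [:: 0; 1; 3]; [:: 0; 1; 2]], [::]);
  ([:: (1,13); (1,5); (3,0); (1,1); (3,0)], Crowd [:: [:: 0; 4]; [:: 1; 3; 4]; [:: 1; 2; 4]; [:: 0; 1; 2]], [::]);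
  ([:: (1,11); (2,2); (1,1); (3,0); (1,0)], Maximal 0 3 0, [:: (3,0); (1,0); (225,1); (32,2); (6,3); (2,0); (188,0); (0,0); (167,2); (3,3)]);
  ([:: (1,13); (2,7); (3,0); (1,1); (2,0)], Cross [:: 1; 2; 4] 1, [:: (37,0); (257,0); (246,0)]);
  ([:: (1,5); (2,3); (3,0); (1,0)], Neighbour 1 0, [:: (5,2); (8,2); (0,0); (126,4)]);
  ([:: (2,6); (1,3); (3,1); (1,0)], Maximal 1 0 0, [:: (0,4); (9,0); (79,1); (251,1); (181,5); (182,5); (180,5)]);
  ([:: (1,3); (2,2); (1,1); (3,0)], Maximal 3 0 0, [:: (1,0); (260,0); (3,0); (249,0); (0,0); (1,1)]);
  ([:: (1,3); (2,0); (1,0)], Cross [:: 0; 1; 2] 3, [:: (8,0); (0,0)]);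
  ([:: (1,3); (2,1); (1,0)], Cross [:: 1; 2] 3, [:: (0,1); (3,0); (12,0)]);
  ([:: (1,1); (2,0)], Neighbour 0 0, [:: (1,0); (0,0)])].

Lemma certificate3_ok :
  check symmetries3 base3 (fun=> false) (candidates theory3) [::] certificate3.
Proof. by vm_cast_no_check (erefl true). Qed.

Section ThreeDisjoint.
Variables (G : bgraph) (sG : simple_graph G).
Local Notation V := (gV G).
Local Notation adj := (@gadj G).
Local Notation hadj := (@gadj (KB G)).
Hypothesis cG : forall x y : V, connect adj x y.
Hypothesis no5 : ~ has_clique (KB (KB G)) 5.
Hypothesis no5' : ~ has_clique (KB G) 5.

Definition model3 (tag : V -> seq nat) : Prop :=
  [/\ forall v, tag v \in tags theory3,
      forall v c, nth 0 (tag v) c != 0 ->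
        exists B : biclique G, forall w, (w \in val B) = (nth 0 (tag w) c == nth 0 (tag v) c) &
      forall x, x \in [:: 1; 2; 3] -> exists v, tag v = [:: x]].

(** Only [named_cross] has content. One of two different labels is nonzero, so [D] meets a member
    [Y]. If [D] missed the member [X], then [X] would differ from [Y] and be disjoint from it, and
    transitivity of non-adjacency through [X] would separate [D] from [Y]. *)
Lemma model3_named tag : model3 tag -> named theory3 tag.
Proof.
have [hC hI] := KB_simple G.
case=> Ht Hb Hx; split=> // D a b x aD bD ab; rewrite [crossed _ _]/= => xin.
have [v0 v0x] := Hx x xin.
have x0 : x != 0 by move: xin; rewrite !inE => /or3P[]/eqP->.
have tagE w y : nth 0 (tag w) 0 = y -> tag w = [:: y].
  by move=> <-; have := Ht w; rewrite !inE => /or4P[]/eqP->.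
have [X XE] : exists B : biclique G, forall w, (w \in val B) = (tag w == [:: x]).
  have [|B BE] := Hb v0 0; first by rewrite v0x.
  exists B => w; rewrite BE v0x /=; apply/eqP/eqP => [/tagE//|-> //].
case DX: (hadj D X).
  by have [z zD zX] := hadjE DX; exists z => //; apply/eqP; rewrite -XE.
have XD : X != D.
  by apply/eqP=> E; subst D; rewrite !XE in aD bD; rewrite (eqP aD) (eqP bD) eqxx in ab.
wlog ya : a b aD bD ab / nth 0 (tag a) 0 != 0.
  move=> H; case: (eqVneq (nth 0 (tag a) 0) 0) => [a0|]; last exact: H ab.
  apply: (H b a) => //; first by rewrite eq_sym.
  by apply: contraNneq ab => b0; rewrite (tagE a 0) // (tagE b 0).
have [Y YE] := Hb a 0 ya.
have DY : hadj D Y.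
  apply: (hadjI aD); first by rewrite YE.
  apply: contraNneq ab => E; have := bD; rewrite E YE => /eqP bE.
  by rewrite (tagE b _ bE); apply/eqP/tagE.
have nXa : tag a != [:: x].
  apply/negP=> ax; case/negP: (negbT DX).
  by apply: (hadjI aD); rewrite ?XE // eq_sym.
have nXY w : w \in val X -> w \in val Y -> False.
  rewrite XE YE => /eqP-> /= /eqP xa; case/negP: nXa.
  by rewrite (tagE a x).
have XY : hadj X Y = false by apply/negP=> /hadjE[w wX wY]; apply: nXY wX wY.
have XnY : X != Y.
  by apply/eqP=> E; subst Y; have [w [_ [wX _ _]]] := biclique_edge sG X; exact: (nXY w wX wX).
by have := KB_nonadj_trans sG no5 cG DX XY XD XnY; rewrite DY.
Qed.

Lemma model3_act s tag : s \in symmetries3 -> model3 tag -> model3 (act s \o tag).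
Proof.
have key p : size p = 3 -> (forall x, x \in [:: 1; 2; 3] -> x \in p) -> model3 tag ->
    model3 (act [:: (0, 0 :: p)] \o tag).
  case: p => [|p1 [|p2 [|p3 []]]] // _ sp [Ht Hb Hx].
  have [P1 P2 P3] : [/\ 1 \in [:: p1; p2; p3], 2 \in [:: p1; p2; p3] & 3 \in [:: p1; p2; p3]].
    by split; apply: sp.
  have inj a b : nth 0 [:: 0; p1; p2; p3] a = nth 0 [:: 0; p1; p2; p3] b -> a <= 3 -> b <= 3 -> a = b.
    move=> E a3 b3; apply/eqP; rewrite -(@nth_uniq _ 0 [:: 0; p1; p2; p3] a b) ?E //.
    by move: P1 P2 P3; rewrite /= !inE; lia.
  have T3 v : nth 0 (tag v) 0 <= 3 by have := Ht v; rewrite !inE => /or4P[]/eqP->.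
  have pin a : a <= 3 -> nth 0 [:: 0; p1; p2; p3] a \in [:: 0; 1; 2; 3].
    by move: P1 P2 P3; case: a => [|[|[|[|]]]] //=; rewrite !inE; lia.
  split.
  - move=> v; have := pin _ (T3 v); rewrite /act /= !inE.
    by case/or4P=> /eqP->.
  - move=> v [|c] /=; last by rewrite nth_nil.
    move=> nz; have nz' : nth 0 (tag v) 0 != 0 by apply: contraNneq nz => ->.
    have [B BE] := Hb v 0 nz'; exists B => w; rewrite BE.
    by apply/eqP/eqP => [->//|E]; apply: inj.
  - move=> x xin; have := sp x xin; rewrite !inE.
    case/or3P=> /eqP->.
    + by have [v vE] := Hx 1 isT; exists v; rewrite /= vE.
    + by have [v vE] := Hx 2 isT; exists v; rewrite /= vE.
    + by have [v vE] := Hx 3 isT; exists v; rewrite /= vE.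
rewrite /symmetries3 => /mapP[p pin ->] mt; move: pin; rewrite !inE.
by do 5 (case/orP=> [/eqP->|]; first by apply: key mt => // x; rewrite !inE => /or3P[]/eqP->);
  move/eqP->; apply: key mt => // x; rewrite !inE => /or3P[]/eqP->.
Qed.

(** The extensions of the four sets of a crowd are mixed, so each of them meets member 1 and differs
    from it. Together with that member they form a clique of size 5 in [KB G]. *)
Lemma base3_sound P r : base3 P r -> absent adj model3 P.
Proof.
have [hC hI] := KB_simple G.
case: r => // [dss|a b c] /= + tag mt vs PE; have nt := model3_named mt; rewrite -PE.
- case/and3P=> /eqP s4 cr /allP mx; case: mt => Ht Hb Hx.
  have [v0 v0E] := Hx 1 isT.
  have [|X XE] := Hb v0 0; first by rewrite v0E.
  rewrite v0E /= in XE.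
  have [|f [fs finj fadj]] := pcrowd_ext sG v0 _ cr; first by rewrite s4.
  have fX i : hadj (f i) X.
    have di : nth [::] dss i \in dss by rewrite mem_nth.
    have := mx _ di; case/andP: cr => /allP/(_ _ di)/and3P[/allP dv _ _] _.
    have {}dv k : k \in nth [::] dss i -> k < size vs by move/dv; rewrite /= size_pat.
    case/hasP=> k kd /hasP[l ld]; rewrite !(ptag_pat _ _ v0) ?dv // => kl.
    have inf j : j \in nth [::] dss i -> nth v0 vs j \in val (f i).
      by move=> jd; apply: (subsetP (fs i)); rewrite inE map_f.
    have [z zf zE] := named_cross nt (x := 1) (inf _ kd) (inf _ ld) kl isT.
    apply: (hadjI zf); first by rewrite XE zE.
    apply: contraNneq kl => E; have := inf _ kd; have := inf _ ld; rewrite E !XE.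
    have := Ht (nth v0 vs k); have := Ht (nth v0 vs l).
    by rewrite !inE => /or4P[]/eqP-> /or4P[]/eqP->.
  apply: no5'; exists (X |: f @: setT).
    have -> : #|X |: f @: setT| = (size dss).+1; last by rewrite s4.
    rewrite cardsU1 card_imset // cardsT card_ord.
    by case: imsetP => // -[i _ E]; have := fX i; rewrite -E hI.
  move=> x y; rewrite !inE => /orP[/eqP->|/imsetP[i _ ->]] /orP[/eqP->|/imsetP[j _ ->]].
  + by rewrite eqxx.
  + by rewrite hC fX.
  + by rewrite fX.
  + by move=> ne; apply: fadj; apply: contraNneq ne => ->.
case/and5P=> aP bP cP /eqP ab /and3P[/eqP ac nz pr].
have [v0 _] : exists v0 : V, True by move: aP; rewrite size_pat; case: (vs) => // v; exists v.
have [_ Hb _] := mt.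
move: pr; rewrite /par !(padj_pat (adjC sG) (adjxx sG) _ v0) -?(size_pat adj tag) //.
rewrite !(ptag_pat _ _ v0) -?(size_pat adj tag) // in ab ac nz *.
have [B BE] := Hb _ _ nz.
have := @biclique_even _ sG B (nth v0 vs a) (nth v0 vs b) (nth v0 vs c).
by rewrite !BE -ab -ac eqxx /par => ->.
Qed.

Lemma absent3 : {in [seq l.1.1 | l <- certificate3], forall P, absent adj model3 P}.
Proof.
apply: (check_sound (adjC sG) (adjxx sG) model3_act base3_sound _ _ _ certificate3_ok) => //.
exact: (candidates_sound sG model3_named).
Qed.

(** Connectivity provides an edge [p q] that leaves [B1]. After exchanging [B2] and [B3] if
    necessary, [q] has label 0 or 2, and the certificate contains both patterns of such an edge. *)
Lemma no_three_disjoint (B1 B2 B3 : biclique G) : B1 != B2 -> B1 != B3 -> B2 != B3 ->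
  hadj B1 B2 = false -> hadj B1 B3 = false -> hadj B2 B3 = false -> False.
Proof.
have [hC hI] := KB_simple G.
have [x1 [_ [x1B _ _]]] := biclique_edge sG B1.
have [x2 [_ [x2B _ _]]] := biclique_edge sG B2.
move=> n12 n13 n23 a12 a13 a23.
have x21 : x2 \notin val B1 by apply/negP=> x21; rewrite (hadjI x21 x2B n12) in a12.
have [p [q [pB qB pq]]] : exists p q, [/\ p \in val B1, q \notin val B1 & adj p q].
  have /connectP[s pth sE] := cG x1 x2; subst x2; clear x2B.
  elim: s x1 x1B pth x21 => [|z s IH] x xB /=; first by rewrite xB.
  case/andP=> xz pth lB; case zB: (z \in val B1); first exact: IH pth lB.
  by exists x, z; rewrite xB zB.
wlog qB3 : B2 B3 n12 n13 n23 a12 a13 a23 {x2 x2B x21} / q \notin val B3.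
  move=> H; case q3: (q \in val B3); last by apply: (H B2 B3 n12 n13 n23 a12 a13 a23); rewrite q3.
  apply: (H B3 B2 n13 n12 _ a13 a12); first by rewrite eq_sym.
    by rewrite hC.
  by apply/negP=> q2; rewrite (hadjI q2 q3 n23) in a23.
pose t v := if v \in val B1 then 1 else if v \in val B2 then 2 else if v \in val B3 then 3 else 0.
have d12 v : v \in val B1 -> v \in val B2 = false by apply: hadjN.
have d13 v : v \in val B1 -> v \in val B3 = false by apply: hadjN.
have d23 v : v \in val B2 -> v \in val B3 = false by apply: hadjN.
have t1 v : (t v == 1) = (v \in val B1) by rewrite /t; case: (v \in val B1); case: (v \in val B2); case: (v \in val B3).
have t2 v : (t v == 2) = (v \in val B2).
  by rewrite /t; case E: (v \in val B1); first (by rewrite d12); case: (v \in val B2); case: (v \in val B3).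
have t3 v : (t v == 3) = (v \in val B3).
  rewrite /t; case E: (v \in val B1); first by rewrite d13.
  by case F: (v \in val B2); first (by rewrite d23); case: (v \in val B3).
have mt : model3 (fun v => [:: t v]).
  split=> [v|v [|c] /=|x].
  - by rewrite /t; case: (v \in val B1); case: (v \in val B2); case: (v \in val B3).
  - move=> nz; have : t v \in [:: 1; 2; 3] by move: nz; rewrite /t; case: (v \in val B1); case: (v \in val B2); case: (v \in val B3).
    rewrite !inE => /or3P[]/eqP->; [exists B1 | exists B2 | exists B3] => w.
    + by rewrite t1.
    + by rewrite t2.
    + by rewrite t3.
  - by rewrite nth_nil.
  - have ne (B : biclique G) : exists v, v \in val B by have [v [_ [? _ _]]] := biclique_edge sG B; exists v.
    rewrite !inE => /or3P[]/eqP->; [have [v] := ne B1 | have [v] := ne B2 | have [v] := ne B3];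
      by rewrite -?t1 -?t2 -?t3 => /eqP E; exists v; rewrite E.
have tq : t q = 0 \/ t q = 2 by rewrite /t (negbTE qB) (negbTE qB3); case: ifP; [right | left].
have tp : t p = 1 by apply/eqP; rewrite t1.
case: tq => tq.
- apply: (@absent3 [:: ([:: 1], [:: true]); ([:: 0], [::])] _ _ mt [:: p; q]).
    by vm_compute.
  by rewrite /= tp tq pq.
- apply: (@absent3 [:: ([:: 1], [:: true]); ([:: 2], [::])] _ _ mt [:: p; q]).
    by vm_compute.
  by rewrite /= tp tq pq.
Qed.
End ThreeDisjoint.

(** * Three pairs of disjoint bicliques *)

(** A common nonzero component means that the vertices lie together in one member of a family; a
    common 0 only says that they are outside both members. The 4 is the number of families. *)
Definition share (ts : seq (seq nat)) : bool :=
  has (fun c => let x := nth 0 (head [::] ts) c in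
         (x != 0) && all (fun t => nth 0 t c == x) ts) (iota 0 4).

(* Four families of two disjoint bicliques which comprise all bicliques of the graph; the second
   member of the last family may be missing, whence the absence of (3, 2). *)
Definition slots : seq (nat * nat) :=
  [:: (0, 1); (0, 2); (1, 1); (1, 2); (2, 1); (2, 2); (3, 1)].

(** The ends of an edge lie in a common biclique, which belongs to one of the families, so their
    labels [share]. No biclique is left outside the families for a [Cross] rule; instead, members of
    different families meet. *)
Definition theory222 : theory :=
  Theory [seq x :: t | x <- iota 0 3, t <- [seq y :: t | y <- iota 0 3, t <- [seq z :: t | z <- iota 0 3, t <- [seq [:: w] | w <- iota 0 3]]]]
    (fun t t' => share [:: t; t'])
    (fun p q => [&& p \in slots, q \in slots & p.1 != q.1])
    pred0.

(** Six permutations of the first three families times eight choices of swaps inside them. The last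
    family is kept fixed because its two members are not interchangeable. *)
Definition symmetries222 : seq (seq (nat * seq nat)) :=
  let id := [:: 0; 1; 2] in let swap := [:: 0; 2; 1] in
  [seq zip (rcons p 3) (rcons q id) |
     p <- [:: [:: 0; 1; 2]; [:: 0; 2; 1]; [:: 1; 0; 2]; [:: 1; 2; 0]; [:: 2; 0; 1]; [:: 2; 1; 0]],
     q <- [seq a :: q | a <- [:: id; swap], q <- [seq [:: b; c] | b <- [:: id; swap], c <- [:: id; swap]]]].

(* A vertex set of a complete bipartite subgraph is contained in some biclique, and conversely
   vertices of a common biclique span no odd triple. *)
Definition uncovered (P : pattern) (t : seq nat) (row : seq bool) (s : seq nat) : bool :=
  let r := nth false row in
  let sh := share (t :: map (ptag P) s) in
  (* Triples through the new vertex suffice: if they are even, adjacency of [i] and [j] is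
     [r i (+) r j], so the whole set is even, and it has an edge exactly when the new vertex has a
     neighbour in [s]. *)
  if pairwise (fun i j => ~~ (r i (+) padj P i j (+) r j)) s then has r s && ~~ sh else sh.

(** The sets tested have three or four vertices including the new one; pairs of vertices are already
    filtered by [link] when the rows are enumerated. *)
Definition bad222 (Q : pattern) : bool :=
  if Q is (t, row) :: P then
    let pairs n := [seq [:: j; i] | i <- iota 0 n, j <- iota 0 i] in
    let n := size P in
    has (uncovered P t row) (pairs n) ||
    has (uncovered P t row) [seq rcons s i | i <- iota 0 n, s <- pairs i]
  else false.

(* Labels are written in base 3. *)
Definition certificate222 :=
  decode_certificate (fun t => [:: t %% 3; t %/ 3 %% 3; t %/ 9 %% 3; t %/ 27]) [::
  ([:: (29,2); (28,1); (27,0)], Maximal 0 1 0, [::]);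
  ([:: (29,2); (28,1); (36,0)], Maximal 0 1 0, [::]);
  ([:: (29,2); (28,1); (39,0)], Maximal 0 1 0, [::]);
  ([:: (29,2); (28,1); (28,0)], Maximal 1 0 0, [::]);
  ([:: (29,2); (28,1); (37,0)], Maximal 1 0 0, [::]);
  ([:: (29,2); (28,1); (40,0)], Maximal 1 0 0, [::]);
  ([:: (29,0); (28,0)], Neighbour 0 3, [:: (5,0); (4,0); (3,0); (2,0); (1,0); (0,0); (4,1); (3,1); (1,1); (0,1); (3,2); (0,2); (3,3); (0,3); (2,4); (1,4); (0,4); (1,5); (0,5); (0,6); (0,7); (4,8); (1,8); (4,9); (1,9); (1,12); (1,13)]);
  ([:: (29,1); (28,1); (37,0)], Maximal 2 0 0, [::]);
  ([:: (29,1); (28,1); (40,0)], Maximal 2 0 0, [::]);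
  ([:: (29,1); (28,0)], Neighbour 1 0, [:: (2,0); (1,0); (0,0); (1,1); (0,1); (0,2); (0,3); (1,8); (1,9)]);
  ([:: (29,2); (37,1); (27,0)], Maximal 1 0 0, [::]);
  ([:: (29,2); (37,1); (36,0); (20,0)], Neighbour 0 0, [::]);
  ([:: (29,1); (36,1); (47,0)], Maximal 0 2 2, [::]);
  ([:: (29,2); (37,1); (36,0); (74,0)], Neighbour 3 0, [::]);
  ([:: (29,2); (37,1); (36,0); (23,0)], Neighbour 0 0, [::]);
  ([:: (37,1); (36,1); (50,0)], Maximal 0 2 2, [::]);
  ([:: (29,2); (37,1); (36,0); (77,0)], Neighbour 0 0, [::]);
  ([:: (37,3); (36,0); (47,0)], Maximal 1 2 2, [::]);
  ([:: (29,2); (37,1); (50,0)], Maximal 0 1 0, [::]);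
  ([:: (29,2); (37,1); (36,0)], Meet 2 2 0 2, [:: (7,0); (1,0); (6,0); (5,0); (4,0); (0,0); (3,0); (2,0); (4,2); (0,2); (3,2); (2,2)]);
  ([:: (29,2); (37,1); (45,0)], Maximal 0 1 2, [::]);
  ([:: (29,2); (37,1); (30,0)], Maximal 1 0 0, [::]);
  ([:: (29,2); (37,1); (29,0)], Maximal 0 1 0, [::]);
  ([:: (29,6); (37,1); (39,1); (11,0)], Maximal 0 1 0, [::]);
  ([:: (29,6); (37,1); (39,1); (65,0)], Maximal 3 1 0, [::]);
  ([:: (29,6); (37,3); (39,0); (38,0)], Maximal 2 0 0, [::]);
  ([:: (29,2); (37,1); (32,0)], Maximal 0 1 0, [::]);
  ([:: (29,6); (37,3); (39,0); (41,0)], Maximal 2 0 0, [::]);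
  ([:: (29,6); (37,1); (39,1); (14,0)], Maximal 3 1 0, [::]);
  ([:: (29,6); (37,1); (39,1); (68,0)], Maximal 0 1 0, [::]);
  ([:: (29,6); (37,1); (39,1); (17,0)], Maximal 0 1 0, [::]);
  ([:: (29,6); (37,1); (39,1); (71,0)], Maximal 3 1 0, [::]);
  ([:: (29,6); (37,3); (39,0); (44,0)], Maximal 2 0 0, [::]);
  ([:: (29,2); (37,1); (39,0)], Neighbour 0 0, [:: (10,0); (9,0); (7,0); (8,0); (6,0); (4,0); (5,0); (3,0); (14,0); (2,0); (0,0); (1,0); (6,2); (14,2); (15,45)]);
  ([:: (29,2); (37,1); (48,0)], Maximal 0 1 0, [::]);
  ([:: (29,2); (37,1); (37,0); (20,0)], Neighbour 3 0, [::]);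
  ([:: (29,1); (37,1); (47,0)], Maximal 0 2 2, [::]);
  ([:: (29,2); (37,1); (37,0); (74,0)], Neighbour 3 0, [::]);
  ([:: (29,2); (37,1); (37,0); (23,0)], Neighbour 3 0, [::]);
  ([:: (29,1); (37,1); (50,0)], Maximal 0 2 1, [::]);
  ([:: (29,2); (37,1); (37,0); (77,0)], Neighbour 0 0, [::]);
  ([:: (29,2); (37,1); (37,0)], Meet 2 2 0 2, [:: (5,0); (4,0); (3,0); (2,0); (22,0); (1,0); (0,0); (2,2); (22,2); (1,2); (0,2); (23,45)]);
  ([:: (29,2); (37,1); (46,0)], Maximal 1 0 0, [::]);
  ([:: (29,2); (37,1); (31,0)], Maximal 1 0 0, [::]);
  ([:: (29,2); (37,1); (40,0); (20,0)], Neighbour 0 0, [::]);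
  ([:: (29,1); (40,1); (47,0)], Maximal 0 2 2, [::]);
  ([:: (29,2); (37,1); (40,0); (74,0)], Neighbour 3 0, [::]);
  ([:: (29,10); (37,1); (40,2); (23,1); (14,0)], Neighbour 3 2, [::]);
  ([:: (29,10); (37,1); (40,2); (23,1); (68,0)], Neighbour 3 2, [::]);
  ([:: (29,2); (37,1); (40,0); (23,0)], Neighbour 3 0, [:: (1,0); (0,0)]);
  ([:: (29,10); (37,1); (40,2); (77,1); (14,0)], Neighbour 3 2, [::]);
  ([:: (29,1); (40,2); (77,0); (53,0)], Maximal 0 2 2, [::]);
  ([:: (29,10); (37,1); (40,2); (77,1); (68,0)], Meet 3 1 2 2, [:: (6,0); (0,0)]);
  ([:: (29,2); (37,1); (40,0); (77,0)], Neighbour 0 0, [:: (2,0); (0,0)]);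
  ([:: (37,5); (40,1); (50,1); (41,0)], Maximal 1 2 0, [::]);
  ([:: (29,2); (37,1); (40,1); (50,1); (21,0)], Neighbour 0 0, [:: (28,0); (0,0); (36,0)]);
  ([:: (29,2); (37,1); (40,1); (50,1); (75,0)], Neighbour 3 0, [:: (29,0); (1,0); (37,0)]);
  ([:: (29,2); (37,1); (40,1); (50,0)], Maximal 0 3 2, [:: (1,0); (0,0)]);
  ([:: (29,2); (37,1); (40,0); (26,0)], Neighbour 3 0, [::]);
  ([:: (29,1); (40,1); (53,0)], Maximal 0 2 2, [::]);
  ([:: (29,2); (37,1); (40,0); (80,0)], Neighbour 3 0, [::]);
  ([:: (29,2); (37,1); (40,0)], Meet 2 2 0 2, [:: (16,0); (15,0); (14,0); (11,0); (42,0); (3,0); (7,0); (2,0); (1,0); (0,0); (42,2); (43,45)]);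
  ([:: (29,2); (37,1); (49,0)], Maximal 1 0 0, [::]);
  ([:: (37,1); (38,1); (48,0)], Maximal 0 2 2, [::]);
  ([:: (29,2); (37,1); (38,1); (49,0)], Neighbour 1 0, [:: (54,0); (22,0); (21,0); (20,0); (2,0); (1,0); (20,2); (2,2); (1,2)]);
  ([:: (29,1); (38,1); (47,0)], Maximal 0 2 2, [::]);
  ([:: (29,1); (38,1); (50,0)], Maximal 0 2 2, [::]);
  ([:: (29,2); (37,1); (38,0)], Meet 3 1 2 2, [:: (3,0); (24,0); (4,0); (2,0); (1,0); (48,0); (0,0); (3,2); (4,2); (2,2); (48,2); (0,2); (3,4); (3,6); (24,40); (24,41); (49,41); (49,45)]);
  ([:: (37,5); (41,1); (33,1); (44,0)], Maximal 0 2 1, [::]);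
  ([:: (29,2); (37,1); (41,1); (33,0)], Neighbour 3 1, [:: (0,0); (47,2); (35,2); (7,2); (6,2); (42,2); (50,2); (53,9); (53,39)]);
  ([:: (37,1); (41,1); (42,0)], Maximal 2 0 0, [::]);
  ([:: (29,2); (37,1); (41,1); (51,0)], Neighbour 3 2, [:: (50,0); (36,0); (28,0); (8,0); (52,0); (36,2); (8,2); (52,2); (53,45)]);
  ([:: (37,1); (41,1); (43,0)], Maximal 0 2 1, [::]);
  ([:: (37,1); (41,1); (52,0)], Maximal 0 2 2, [::]);
  ([:: (29,1); (41,1); (35,0)], Maximal 0 2 1, [::]);
  ([:: (37,1); (41,1); (44,0)], Maximal 2 0 0, [::]);
  ([:: (29,1); (41,1); (53,0)], Maximal 0 2 1, [::]);
  ([:: (29,3); (41,0); (44,0)], Maximal 1 2 1, [::]);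
  ([:: (29,2); (37,1); (41,0)], Meet 3 1 1 2, [:: (8,0); (7,0); (6,0); (5,0); (4,0); (3,0); (0,0); (2,0); (1,0); (56,2); (44,2); (43,2); (34,2); (16,2); (15,2); (51,2); (59,2); (59,9)]);
  ([:: (29,0); (37,0)], Neighbour 1 3, [:: (68,0); (59,0); (58,0); (57,0); (45,0); (44,0); (69,0); (37,0); (36,0); (35,0); (17,0); (16,0); (56,0); (11,0); (52,0); (0,0); (60,0); (57,2); (45,2); (44,2); (35,2); (17,2); (16,2); (52,2); (0,2); (60,2); (61,45)]);
  ([:: (29,1); (37,1); (45,0)], Maximal 2 0 0, [::]);
  ([:: (29,1); (37,1); (48,0)], Maximal 2 0 0, [::]);
  ([:: (29,3); (37,0); (48,0)], Maximal 1 2 2, [::]);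
  ([:: (29,3); (37,0); (46,0)], Maximal 2 1 2, [::]);
  ([:: (29,3); (37,0); (49,0)], Maximal 1 2 1, [::]);
  ([:: (29,1); (37,1); (49,0)], Maximal 2 0 0, [::]);
  ([:: (29,3); (37,0); (47,0)], Maximal 2 1 0, [::]);
  ([:: (29,3); (37,0); (50,0)], Maximal 2 1 0, [::]);
  ([:: (29,1); (37,0)], Meet 3 1 2 2, [:: (7,0); (5,0); (6,0); (4,0); (3,0); (2,0); (1,0); (51,0); (0,0); (48,0); (8,1); (5,2); (6,2); (3,2); (2,2); (0,2); (48,2); (8,40)]);
  ([:: (29,2); (40,1); (27,0)], Maximal 0 1 0, [::]);
  ([:: (29,1); (36,1); (49,0)], Maximal 0 2 0, [::]);
  ([:: (29,1); (36,1); (53,0)], Maximal 0 2 2, [::]);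
  ([:: (29,6); (40,3); (36,0); (50,0)], Maximal 2 1 1, [::]);
  ([:: (40,3); (36,0); (53,0)], Maximal 1 2 2, [::]);
  ([:: (29,2); (40,1); (36,0)], Meet 3 1 2 2, [:: (3,0); (1,0); (0,0); (2,0); (3,1); (5,1); (14,1); (3,2); (2,2); (84,32); (14,36); (5,36); (14,37); (5,37); (3,45); (14,45); (5,45); (3,47)]);
  ([:: (40,1); (39,1); (48,0)], Maximal 0 2 2, [::]);
  ([:: (29,3); (39,0); (48,0)], Maximal 2 1 2, [::]);
  ([:: (29,1); (39,1); (51,0)], Maximal 2 0 0, [::]);
  ([:: (29,3); (39,0); (51,0)], Maximal 1 2 1, [::]);
  ([:: (40,1); (39,1); (49,0)], Maximal 0 2 2, [::]);
  ([:: (29,2); (40,1); (39,1); (52,0)], Maximal 0 1 0, [::]);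
  ([:: (29,3); (39,0); (49,0)], Maximal 1 2 0, [::]);
  ([:: (29,6); (40,3); (39,0); (52,0)], Maximal 0 1 1, [::]);
  ([:: (29,1); (39,1); (47,0)], Maximal 0 2 2, [::]);
  ([:: (40,1); (39,1); (50,0)], Maximal 0 2 2, [::]);
  ([:: (29,1); (39,1); (53,0)], Maximal 0 2 1, [::]);
  ([:: (29,2); (40,1); (47,0)], Maximal 0 1 0, [::]);
  ([:: (40,3); (39,0); (50,0)], Maximal 1 2 2, [::]);
  ([:: (29,2); (40,1); (39,0)], Meet 3 1 2 2, [:: (11,0); (12,0); (9,0); (10,0); (6,0); (8,0); (5,0); (7,0); (1,0); (4,0); (0,0); (3,0); (2,0); (19,1); (28,1); (14,31); (28,32); (19,32)]);
  ([:: (29,2); (40,3); (48,0); (4,0)], Neighbour 0 0, [:: (38,12); (33,36); (36,36)]);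
  ([:: (29,2); (40,3); (48,0); (58,0)], Neighbour 0 0, [:: (39,12); (34,36); (37,36)]);
  ([:: (29,2); (40,3); (48,0); (13,0)], Neighbour 0 0, [:: (40,12); (35,36); (38,36)]);
  ([:: (29,2); (40,3); (48,0); (67,0)], Neighbour 0 0, [:: (41,12); (36,36); (39,36)]);
  ([:: (29,2); (40,3); (48,0); (22,0)], Neighbour 0 0, [:: (42,12); (37,36); (40,36)]);
  ([:: (29,2); (40,3); (48,0); (76,0)], Neighbour 0 0, [:: (43,12); (38,36); (41,36)]);
  ([:: (29,2); (40,1); (48,0)], Maximal 0 1 0, [:: (5,0); (4,0); (3,0); (2,0); (1,0); (0,0)]);
  ([:: (29,2); (40,1); (51,0)], Maximal 0 1 0, [::]);
  ([:: (29,1); (40,1); (45,0)], Maximal 2 0 0, [::]);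
  ([:: (40,2); (48,1); (21,0)], Maximal 1 0 2, [::]);
  ([:: (40,2); (48,1); (75,0)], Maximal 1 0 2, [::]);
  ([:: (40,5); (40,1); (48,1); (22,0)], Maximal 0 2 2, [::]);
  ([:: (40,5); (40,1); (48,1); (76,0)], Maximal 0 2 2, [::]);
  ([:: (29,5); (40,1); (48,1); (52,0)], Maximal 1 2 2, [::]);
  ([:: (40,5); (40,1); (48,1); (23,0)], Maximal 2 1 2, [::]);
  ([:: (40,2); (48,1); (77,0)], Maximal 1 0 2, [::]);
  ([:: (29,2); (40,1); (40,1); (48,0)], Neighbour 3 2, [:: (6,0); (9,0); (5,0); (8,0); (4,0); (3,0); (2,0); (18,0); (1,0); (0,0); (34,1); (36,1); (25,1); (20,5); (51,19)]);
  ([:: (29,1); (40,1); (51,0)], Maximal 0 2 1, [::]);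
  ([:: (40,1); (40,1); (49,0)], Maximal 0 2 2, [::]);
  ([:: (29,1); (40,1); (52,0)], Maximal 2 0 0, [::]);
  ([:: (40,1); (40,3); (50,0); (44,0)], Maximal 0 3 0, [::]);
  ([:: (29,2); (40,1); (40,1); (50,0)], Meet 3 1 1 2, [:: (2,8); (13,0); (3,0); (1,0); (0,0); (70,0); (53,2); (1,3); (14,8); (4,8); (84,8); (41,9); (50,9); (63,11); (1,16); (1,19); (36,31)]);
  ([:: (29,3); (40,0); (50,0)], Maximal 2 1 0, [::]);
  ([:: (29,2); (40,1); (40,0)], Meet 3 1 2 2, [:: (4,0); (14,0); (16,0); (6,0); (15,0); (5,0); (3,0); (25,0); (86,0); (0,0); (1,0); (72,0); (41,1); (43,1); (52,1); (3,3); (38,31)]);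
  ([:: (29,2); (40,1); (49,0); (11,0)], Neighbour 0 0, [::]);
  ([:: (29,2); (40,1); (49,0); (65,0)], Neighbour 3 0, [::]);
  ([:: (29,2); (40,1); (49,1); (41,0)], Maximal 1 0 0, [::]);
  ([:: (29,2); (40,3); (49,2); (14,0); (52,0)], Neighbour 0 0, [::]);
  ([:: (29,2); (40,3); (49,0); (14,0)], Meet 1 2 0 1, [:: (0,0); (61,30)]);
  ([:: (29,2); (40,3); (49,2); (68,0); (52,0)], Neighbour 0 0, [::]);
  ([:: (29,2); (40,7); (49,0); (68,1); (61,0)], Neighbour 4 1, [::]);
  ([:: (29,2); (40,7); (49,0); (68,1); (79,0)], Neighbour 2 2, [:: (12,1)]);
  ([:: (29,2); (40,3); (49,0); (68,0)], Meet 1 2 0 1, [:: (1,0); (2,0); (0,0); (65,30)]);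
  ([:: (29,2); (40,1); (49,0); (17,0)], Neighbour 0 0, [::]);
  ([:: (29,2); (40,1); (49,0); (71,0)], Neighbour 0 0, [::]);
  ([:: (29,6); (40,1); (49,1); (14,0)], Neighbour 1 2, [:: (35,0); (16,0); (6,0); (2,0)]);
  ([:: (29,6); (40,1); (49,1); (68,0)], Neighbour 3 2, [:: (17,0); (7,0); (3,0); (20,1)]);
  ([:: (29,6); (40,3); (49,0); (44,0)], Maximal 0 2 0, [::]);
  ([:: (29,2); (40,1); (49,0)], Meet 2 1 0 2, [:: (13,0); (12,0); (2,0); (9,0); (11,0); (1,0); (5,0); (4,0); (0,0); (3,0); (101,1); (15,1); (87,1); (131,41)]);
  ([:: (29,2); (40,1); (29,0)], Maximal 0 1 0, [::]);
  ([:: (40,1); (38,1); (48,0)], Maximal 0 2 2, [::]);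
  ([:: (29,2); (40,1); (38,1); (51,0)], Neighbour 3 1, [:: (33,0); (21,3); (74,4); (77,4); (76,4); (34,8); (43,8); (59,9); (61,9)]);
  ([:: (29,3); (38,0); (50,0)], Maximal 2 1 2, [::]);
  ([:: (29,2); (40,1); (38,0)], Meet 3 1 2 2, [:: (36,0); (2,0); (35,0); (1,0); (4,0); (45,0); (86,0); (0,0); (85,0); (63,1); (72,1); (45,1); (0,2); (85,2); (23,3); (45,3); (72,41); (63,41)]);
  ([:: (29,2); (40,1); (41,1); (51,0)], Neighbour 3 1, [:: (36,0); (75,0); (24,3); (5,8); (46,8); (64,9); (46,18); (77,20); (59,31)]);
  ([:: (40,1); (41,1); (43,0)], Maximal 0 2 1, [::]);
  ([:: (29,10); (40,1); (41,1); (44,1); (8,0)], Maximal 0 1 2, [::]);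
  ([:: (29,5); (41,1); (44,1); (62,0)], Maximal 1 2 1, [::]);
  ([:: (29,10); (40,1); (41,1); (44,1); (26,0)], Maximal 0 2 2, [::]);
  ([:: (29,6); (40,1); (41,0); (80,0)], Maximal 2 3 1, [:: (4,0); (3,0); (78,9); (82,22); (10,24); (64,25)]);
  ([:: (29,2); (40,1); (41,1); (44,0)], Maximal 1 3 1, [:: (3,0); (2,0); (1,0); (0,0)]);
  ([:: (29,2); (40,1); (41,0)], Meet 3 1 1 2, [:: (43,0); (6,0); (5,0); (85,0); (0,0); (83,0); (31,3); (5,4); (12,8); (53,8); (71,9); (80,9); (84,20); (84,22); (12,24); (12,25); (66,25); (66,31)]);
  ([:: (29,2); (40,3); (50,2); (4,0); (42,0)], Neighbour 1 2, [:: (28,0); (0,0); (65,8)]);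
  ([:: (29,2); (40,3); (50,2); (4,0); (51,0)], Meet 2 2 0 1, [:: (7,10); (7,36)]);
  ([:: (29,2); (40,3); (50,2); (4,0); (53,0)], Meet 2 2 0 1, [:: (8,10); (8,19)]);
  ([:: (29,2); (40,3); (50,0); (4,0)], Meet 3 1 1 2, [:: (2,0); (1,0); (0,0); (89,1); (87,1); (35,19)]);
  ([:: (29,2); (40,3); (50,2); (58,0); (42,0)], Neighbour 1 2, [:: (32,0); (4,0); (69,8)]);
  ([:: (29,2); (40,3); (50,2); (58,0); (51,0)], Meet 2 2 0 1, [:: (11,10); (11,36)]);
  ([:: (29,2); (40,3); (50,2); (58,0); (53,0)], Meet 2 2 0 1, [:: (12,10); (12,19)]);
  ([:: (29,2); (40,3); (50,0); (58,0)], Meet 3 1 1 2, [:: (2,0); (1,0); (0,0); (93,1); (91,1); (39,19)]);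
  ([:: (29,2); (40,3); (50,2); (13,0); (51,0)], Meet 2 1 0 2, [:: (14,12); (14,34)]);
  ([:: (29,2); (40,3); (50,2); (13,0); (53,0)], Meet 2 2 0 1, [:: (15,10); (15,19)]);
  ([:: (29,2); (40,3); (50,0); (13,0)], Meet 3 1 1 2, [:: (1,0); (0,0); (96,1); (42,19)]);
  ([:: (29,2); (40,3); (50,2); (67,0); (51,0)], Meet 2 1 0 2, [:: (17,12); (17,34)]);
  ([:: (29,2); (40,3); (50,2); (67,0); (53,0)], Meet 2 2 0 1, [:: (18,10); (18,19)]);
  ([:: (29,2); (40,3); (50,0); (67,0)], Meet 3 1 1 2, [:: (1,0); (0,0); (99,1); (45,19)]);
  ([:: (40,3); (50,2); (22,1); (50,0)], Meet 1 2 0 1, [::]);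
  ([:: (29,2); (40,3); (50,0); (22,0)], Neighbour 2 2, [:: (0,0); (15,1); (68,5)]);
  ([:: (29,2); (40,3); (50,2); (76,1); (50,0)], Meet 2 1 0 2, [:: (49,5); (102,10); (47,38)]);
  ([:: (29,2); (40,3); (50,0); (76,0)], Neighbour 2 2, [:: (0,0); (17,1); (70,5)]);
  ([:: (29,2); (40,1); (50,0)], Maximal 0 1 0, [:: (14,0); (10,0); (7,0); (4,0); (2,0); (0,0)]);
  ([:: (29,0); (40,0)], Neighbour 0 3, [:: (90,0); (85,0); (71,0); (64,0); (63,0); (170,0); (91,0); (47,0); (32,0); (31,0); (27,0); (73,0); (19,0); (0,0); (89,1); (91,1); (51,3); (85,8); (64,8); (91,8); (32,8); (27,8); (73,8); (0,8); (89,9); (91,9); (86,31)]);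
  ([:: (29,1); (40,0)], Neighbour 1 0, [:: (174,0); (101,0); (0,0); (101,1); (0,1); (0,2); (0,3); (101,8); (101,9)]);
  ([:: (29,0)], Meet 3 1 0 1, [:: (172,0); (175,0); (93,0); (102,0); (0,0); (1,0); (93,1); (102,1); (0,1); (1,1); (0,2); (1,2); (0,3); (1,3); (93,8); (102,8); (93,9); (102,9)]);
  ([:: (38,1); (27,1); (48,0)], Maximal 2 0 0, [::]);
  ([:: (38,3); (27,0); (48,0)], Maximal 1 2 2, [::]);
  ([:: (38,1); (27,1); (46,0)], Maximal 0 2 2, [::]);
  ([:: (38,3); (27,0); (46,0)], Maximal 1 2 0, [::]);
  ([:: (38,1); (27,1); (49,0)], Maximal 0 2 0, [::]);
  ([:: (38,3); (27,0); (49,0)], Maximal 1 2 1, [::]);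
  ([:: (38,1); (27,1); (47,0)], Maximal 0 2 2, [::]);
  ([:: (38,1); (27,1); (50,0)], Maximal 0 2 2, [::]);
  ([:: (47,1); (20,1); (19,0)], Maximal 0 2 0, [::]);
  ([:: (47,1); (20,1); (73,0)], Maximal 0 2 0, [::]);
  ([:: (47,1); (20,1); (22,0)], Maximal 0 2 0, [::]);
  ([:: (47,1); (20,1); (76,0)], Maximal 0 2 0, [::]);
  ([:: (38,1); (47,1); (20,0)], Meet 2 2 0 1, [:: (3,0); (2,0); (1,0); (0,0); (1,2); (0,2)]);
  ([:: (47,1); (74,1); (19,0)], Maximal 0 2 0, [::]);
  ([:: (38,5); (47,1); (5,1); (50,0)], Maximal 0 2 1, [::]);
  ([:: (38,3); (27,0); (47,5); (74,1); (73,0); (5,0)], Neighbour 5 1, [:: (0,0)]);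
  ([:: (38,1); (27,1); (32,0)], Maximal 0 2 1, [::]);
  ([:: (38,3); (27,0); (47,1); (14,0)], Meet 3 1 0 1, [:: (13,0); (11,0); (11,2); (17,4); (15,45); (15,47)]);
  ([:: (38,3); (27,0); (47,2); (73,1); (23,0)], Maximal 1 3 0, [::]);
  ([:: (47,3); (74,0); (77,0)], Maximal 1 2 1, [::]);
  ([:: (38,3); (47,0); (50,0)], Maximal 1 2 1, [::]);
  ([:: (38,3); (27,0); (47,1); (74,1); (73,0)], Meet 1 1 0 2, [:: (5,0); (4,0); (3,0); (2,0); (0,0); (1,0); (0,1)]);
  ([:: (38,3); (27,0); (47,1); (74,1); (22,0)], Neighbour 4 0, [::]);
  ([:: (38,3); (27,0); (47,5); (74,1); (76,0); (8,0)], Neighbour 5 1, [:: (2,2)]);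
  ([:: (47,2); (76,1); (26,0)], Maximal 0 1 0, [::]);
  ([:: (38,3); (27,0); (47,1); (74,1); (76,0)], Meet 1 2 0 2, [:: (1,0); (0,0); (8,2); (7,2); (4,2); (5,2); (4,3)]);
  ([:: (38,3); (27,0); (47,1); (74,0)], Meet 2 2 0 1, [:: (12,0); (4,0); (3,0); (0,0); (3,2); (0,2)]);
  ([:: (38,11); (27,0); (47,1); (23,0); (39,0)], Neighbour 4 1, [::]);
  ([:: (38,11); (27,0); (47,1); (23,0); (40,0)], Maximal 1 3 1, [::]);
  ([:: (38,5); (47,1); (23,1); (32,0)], Maximal 0 1 2, [::]);
  ([:: (38,3); (27,0); (47,1); (23,0)], Meet 3 1 1 1, [:: (2,0); (1,0); (0,0); (13,0); (9,0); (9,1); (117,18); (117,19); (30,20); (28,45)]);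
  ([:: (38,11); (27,0); (47,1); (77,0); (39,0)], Neighbour 3 1, [::]);
  ([:: (38,11); (27,0); (47,1); (77,0); (40,0)], Maximal 1 3 1, [::]);
  ([:: (38,3); (47,0); (32,0)], Maximal 2 1 2, [::]);
  ([:: (38,3); (27,0); (47,1); (77,0)], Meet 3 1 1 1, [:: (2,0); (1,0); (0,0); (13,0); (0,1); (13,1); (121,18); (121,19); (34,20); (32,45)]);
  ([:: (38,3); (27,0); (47,0)], Maximal 1 2 2, [:: (22,0); (8,0); (4,0); (0,0); (4,2); (0,2)]);
  ([:: (38,11); (27,0); (50,1); (5,0); (43,0)], Meet 2 1 1 1, [:: (146,6); (114,25)]);
  ([:: (38,3); (27,0); (50,1); (5,0)], Meet 3 1 0 1, [:: (33,0); (0,0); (31,2); (37,4); (1,45); (35,47)]);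
  ([:: (38,11); (27,0); (50,1); (59,0); (43,0)], Meet 2 1 1 1, [:: (148,6); (116,25)]);
  ([:: (38,3); (27,0); (50,1); (59,0)], Meet 3 1 0 1, [:: (35,0); (0,0); (33,2); (39,4); (3,45); (37,47)]);
  ([:: (38,3); (27,0); (50,1); (14,0)], Meet 3 1 0 1, [:: (36,0); (34,2); (40,4); (38,47)]);
  ([:: (38,3); (27,0); (50,1); (68,0)], Meet 3 1 0 1, [:: (37,0); (35,2); (41,4); (39,47)]);
  ([:: (38,11); (27,0); (50,1); (23,0); (43,0)], Meet 2 1 1 1, [:: (152,6); (120,25)]);
  ([:: (38,3); (27,0); (50,1); (23,0)], Meet 3 1 0 1, [:: (0,0); (43,4); (7,45); (41,47)]);
  ([:: (38,11); (27,0); (50,1); (77,0); (43,0)], Meet 2 1 1 1, [:: (154,6); (122,25)]);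
  ([:: (38,3); (27,0); (50,1); (77,0)], Meet 3 1 0 1, [:: (0,0); (45,4); (9,45); (43,47)]);
  ([:: (38,3); (27,0); (50,0)], Maximal 1 2 1, [:: (8,0); (6,0); (5,0); (4,0); (2,0); (0,0)]);
  ([:: (38,1); (27,0)], Meet 3 1 2 2, [:: (47,32); (45,0); (46,0); (43,0); (44,0); (41,0); (42,0); (11,0); (40,0); (0,0); (39,0); (45,2); (46,2); (41,2); (42,2); (0,2); (39,2)]);
  ([:: (38,3); (39,0); (48,0)], Maximal 1 2 2, [::]);
  ([:: (38,1); (39,1); (37,0)], Maximal 2 0 0, [::]);
  ([:: (38,1); (39,3); (48,0); (46,0)], Maximal 0 2 2, [::]);
  ([:: (38,5); (39,1); (48,1); (46,0)], Maximal 3 2 1, [::]);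
  ([:: (38,1); (39,1); (43,0)], Maximal 0 2 0, [::]);
  ([:: (38,1); (39,1); (52,0)], Maximal 0 2 2, [::]);
  ([:: (38,1); (39,1); (48,0)], Meet 3 1 0 1, [:: (54,4); (4,0); (2,0); (3,0); (141,0); (1,0); (0,0); (141,1); (173,4); (20,20); (33,20); (20,21); (33,21); (1,22); (0,22); (173,32); (173,36)]);
  ([:: (38,1); (39,1); (51,0)], Maximal 0 2 2, [::]);
  ([:: (38,3); (39,0); (51,0)], Maximal 1 2 2, [::]);
  ([:: (38,3); (39,0); (49,0)], Maximal 1 2 2, [::]);
  ([:: (39,3); (49,0); (35,0)], Maximal 1 2 1, [::]);
  ([:: (38,1); (39,1); (44,0)], Maximal 0 2 1, [::]);
  ([:: (38,5); (39,1); (49,1); (53,0)], Maximal 3 1 2, [::]);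
  ([:: (38,1); (39,1); (49,0)], Meet 3 1 1 2, [:: (61,16); (5,0); (8,0); (7,0); (2,0); (1,0); (0,0); (7,2); (2,11); (8,22); (7,22); (3,22); (170,32); (94,36); (2,37); (27,38); (7,47)]);
  ([:: (38,2); (50,1); (34,0)], Maximal 1 0 2, [::]);
  ([:: (38,1); (39,1); (50,0)], Meet 3 1 0 1, [:: (63,4); (141,0); (5,0); (1,0); (0,0); (10,0); (9,0); (1,4); (4,4); (175,10); (10,12); (7,22); (6,22); (10,22); (9,22); (173,34); (29,45)]);
  ([:: (38,1); (39,0)], Meet 3 1 2 2, [:: (64,32); (15,0); (9,0); (7,0); (8,0); (6,0); (2,0); (10,0); (0,0); (8,22); (7,22); (10,22); (9,22); (15,22); (0,22); (2,22); (6,22)]);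
  ([:: (38,1); (48,1); (37,0)], Maximal 2 0 0, [::]);
  ([:: (38,3); (48,0); (46,0)], Maximal 1 2 0, [::]);
  ([:: (38,3); (48,0); (31,0)], Maximal 2 1 2, [::]);
  ([:: (38,3); (48,0); (49,0)], Maximal 1 2 0, [::]);
  ([:: (38,1); (48,1); (40,0)], Meet 3 1 1 2, [:: (69,16); (10,1); (4,2); (10,10); (2,23); (188,23); (0,23); (102,23); (102,24); (4,25); (10,29); (144,29); (102,32); (6,32); (178,36); (6,45); (6,47)]);
  ([:: (38,1); (48,1); (34,0)], Maximal 2 0 0, [::]);
  ([:: (38,3); (48,0); (44,1); (13,0)], Maximal 1 3 0, [:: (12,28); (158,29); (12,29); (8,47)]);
  ([:: (38,5); (48,1); (49,3); (44,1); (67,0)], Meet 1 2 0 1, [::]);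
  ([:: (38,5); (48,1); (49,1); (44,0)], Neighbour 2 0, [:: (6,0); (5,0); (1,0); (0,0); (4,0); (73,4); (151,29); (14,29); (182,30); (10,32); (182,40)]);
  ([:: (38,1); (48,1); (49,0)], Meet 3 1 1 2, [:: (74,16); (3,0); (0,0); (9,2); (161,10); (15,10); (149,10); (152,10); (15,11); (7,23); (3,23); (6,23); (5,23); (9,25); (15,29); (11,32); (11,47)]);
  ([:: (38,1); (48,0)], Meet 3 1 0 1, [:: (75,4); (194,0); (9,0); (8,0); (7,0); (108,0); (5,0); (6,0); (0,0); (4,0); (10,5); (16,10); (10,14); (4,23); (16,29); (12,32); (12,47)]);
  ([:: (38,3); (37,0); (38,0)], Maximal 2 1 0, [::]);
  ([:: (37,3); (52,0); (49,0)], Maximal 1 2 1, [::]);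
  ([:: (38,3); (37,2); (65,0); (52,0)], Meet 3 1 1 1, [:: (13,0); (0,0); (13,4); (2,4); (78,20); (165,24); (165,25); (13,28); (57,44); (57,45)]);
  ([:: (38,3); (37,0); (65,0)], Meet 3 1 1 2, [:: (0,0); (14,2); (14,6); (3,6); (79,16); (14,24); (166,28); (166,29); (58,46); (58,47)]);
  ([:: (38,3); (37,2); (47,0); (13,0)], Meet 3 1 1 1, [:: (15,0); (4,0); (59,0); (4,1); (59,1); (167,18); (80,20); (167,24); (15,29); (59,45)]);
  ([:: (38,3); (37,2); (47,0); (67,0)], Meet 3 1 1 1, [:: (16,0); (5,0); (60,0); (5,1); (60,1); (168,18); (81,20); (168,24); (16,29); (60,45)]);
  ([:: (38,3); (37,0); (47,0)], Maximal 2 1 0, [:: (1,0); (0,0); (1,2); (0,2); (2,4); (69,45)]);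
  ([:: (38,3); (37,2); (14,0); (52,0)], Meet 3 1 1 1, [:: (18,0); (5,0); (18,4); (7,4); (83,20); (170,24); (170,25); (18,28); (62,44); (62,45)]);
  ([:: (38,3); (37,0); (14,0)], Meet 3 1 1 2, [:: (0,0); (19,2); (19,6); (8,6); (84,16); (19,24); (171,28); (171,29); (63,46); (63,47)]);
  ([:: (38,3); (37,2); (68,0); (52,0)], Meet 3 1 1 1, [:: (20,0); (7,0); (20,4); (9,4); (85,20); (172,24); (172,25); (20,28); (64,44); (64,45)]);
  ([:: (38,3); (37,0); (68,0)], Meet 3 1 1 2, [:: (0,0); (21,2); (21,6); (10,6); (86,16); (21,24); (173,28); (173,29); (65,46); (65,47)]);
  ([:: (38,3); (37,2); (50,0); (15,0)], Maximal 2 1 0, [:: (7,4); (2,4); (0,4); (2,6); (0,6); (74,45)]);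
  ([:: (38,3); (37,2); (50,0); (69,0)], Maximal 2 1 0, [:: (8,4); (3,4); (1,4); (3,6); (1,6); (75,45)]);
  ([:: (38,3); (37,0); (50,0)], Meet 2 1 1 2, [:: (1,0); (0,0); (24,2); (24,6); (4,6); (2,6); (176,28); (176,29); (68,46); (68,47)]);
  ([:: (38,1); (37,0)], Neighbour 0 0, [:: (90,0); (13,0); (10,0); (7,0); (5,0); (3,0); (0,0); (5,2); (3,2); (0,2); (177,25); (25,25); (25,29); (177,29); (77,44)]);
  ([:: (38,3); (46,0); (40,0)], Maximal 2 1 2, [::]);
  ([:: (38,3); (46,0); (49,0)], Maximal 1 2 1, [::]);
  ([:: (46,3); (49,0); (52,0)], Maximal 1 2 1, [::]);
  ([:: (46,1); (49,1); (44,0); (6,0)], Neighbour 2 1, [::]);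
  ([:: (46,1); (49,1); (44,0); (60,0)], Neighbour 2 1, [::]);
  ([:: (38,5); (46,1); (49,1); (44,0)], Maximal 0 3 1, [:: (1,0); (0,0)]);
  ([:: (38,1); (46,1); (49,0)], Meet 3 1 1 2, [:: (97,16); (3,0); (0,0); (32,2); (21,2); (5,2); (4,2); (21,7); (32,7); (4,7); (5,7); (21,24); (32,25); (32,26); (21,27); (5,42); (5,47)]);
  ([:: (38,1); (46,0)], Meet 3 1 1 1, [:: (98,20); (33,0); (22,0); (6,0); (5,0); (0,0); (22,5); (33,5); (0,5); (5,5); (6,5); (22,28); (33,29); (33,30); (22,31); (6,40); (6,45)]);
  ([:: (38,7); (40,2); (11,0); (23,0)], Neighbour 3 2, [:: (88,44); (87,44)]);
  ([:: (38,7); (40,2); (11,0); (77,0)], Meet 3 1 1 2, [:: (210,4); (178,29)]);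
  ([:: (38,3); (40,0); (11,0)], Meet 2 2 0 2, [:: (1,0); (0,0); (92,44); (91,44); (90,44); (89,44); (90,46); (89,46)]);
  ([:: (38,3); (40,0); (38,0)], Maximal 2 1 0, [::]);
  ([:: (38,3); (40,2); (65,0); (51,0)], Neighbour 3 2, [::]);
  ([:: (38,3); (40,6); (65,0); (34,0); (48,0)], Meet 1 1 0 2, [:: (187,25); (211,36)]);
  ([:: (38,3); (40,2); (65,0); (34,0)], Meet 3 1 2 2, [:: (0,0); (1,0); (217,28); (212,28); (215,28); (105,32)]);
  ([:: (38,11); (40,2); (65,0); (52,0); (15,0)], Neighbour 3 1, [::]);
  ([:: (38,11); (40,2); (65,0); (52,0); (69,0)], Neighbour 3 1, [::]);
  ([:: (38,5); (65,0); (52,0); (17,0)], Neighbour 3 1, [::]);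
  ([:: (38,3); (40,2); (65,0); (52,0)], Meet 2 1 1 2, [:: (2,0); (1,0); (0,0); (44,2); (89,3); (221,4); (219,4); (137,28); (187,29); (137,42)]);
  ([:: (38,3); (40,0); (65,0)], Meet 3 1 1 2, [:: (6,0); (4,0); (0,0); (45,2); (222,4); (217,4); (220,4); (110,16); (188,29); (32,41)]);
  ([:: (38,3); (40,0); (14,1); (20,0)], Neighbour 3 2, [::]);
  ([:: (38,3); (40,0); (14,1); (74,0)], Neighbour 3 2, [::]);
  ([:: (38,1); (14,1); (26,0)], Maximal 0 2 2, [::]);
  ([:: (38,3); (40,0); (14,0)], Meet 2 2 0 2, [:: (2,0); (1,0); (0,0); (89,46)]);
  ([:: (38,3); (40,2); (68,0); (51,0)], Neighbour 3 2, [::]);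
  ([:: (38,3); (40,2); (68,0); (46,0)], Meet 3 1 1 2, [:: (0,0); (38,1); (228,4); (223,4); (226,4); (40,7); (116,16); (228,28); (194,29); (226,44)]);
  ([:: (38,3); (40,2); (68,0); (52,1); (7,0)], Meet 1 2 0 2, [::]);
  ([:: (38,3); (40,2); (68,0); (52,1); (61,0)], Meet 2 1 1 2, [:: (146,42)]);
  ([:: (38,3); (40,2); (68,0); (52,1); (25,0)], Meet 2 1 1 2, [:: (147,42)]);
  ([:: (38,3); (40,2); (68,0); (52,1); (79,0)], Meet 2 1 1 2, [:: (148,42)]);
  ([:: (38,3); (40,2); (68,0); (52,0)], Neighbour 3 1, [:: (3,0); (2,0); (1,0); (0,0); (56,2); (199,29); (149,42)]);
  ([:: (38,3); (40,0); (68,0)], Meet 3 1 2 2, [:: (6,0); (5,0); (0,0); (122,32)]);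
  ([:: (38,3); (40,2); (50,0); (10,0)], Meet 3 1 1 2, [:: (58,2); (47,2); (235,4); (233,4); (45,4); (123,16); (201,22); (58,25); (45,41); (232,41)]);
  ([:: (38,3); (40,2); (50,0); (64,0)], Meet 3 1 1 2, [:: (59,2); (48,2); (236,4); (234,4); (46,4); (124,16); (202,22); (59,25); (46,41); (233,41)]);
  ([:: (38,3); (40,2); (50,0); (16,0)], Meet 3 1 1 2, [:: (60,2); (49,2); (237,4); (235,4); (47,4); (125,16); (203,22); (60,25); (47,41); (234,41)]);
  ([:: (38,3); (40,2); (50,0); (70,0)], Meet 3 1 1 2, [:: (61,2); (50,2); (238,4); (236,4); (48,4); (126,16); (204,22); (61,25); (48,41); (235,41)]);
  ([:: (38,3); (40,0); (50,0)], Maximal 2 1 0, [:: (3,0); (2,0); (1,0); (0,0)]);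
  ([:: (38,1); (5,1); (35,0)], Maximal 2 0 2, [::]);
  ([:: (38,7); (40,1); (5,0); (53,0)], Maximal 1 3 1, [::]);
  ([:: (38,3); (40,1); (5,0)], Meet 3 1 1 2, [:: (1,0); (0,0); (240,4); (239,4); (65,25); (208,29)]);
  ([:: (38,3); (40,3); (59,1); (35,0)], Meet 2 1 1 2, [:: (241,4); (209,29)]);
  ([:: (38,7); (40,1); (59,0); (53,0)], Maximal 2 3 1, [::]);
  ([:: (38,3); (40,1); (59,0)], Meet 3 1 1 2, [:: (1,0); (0,0); (243,4); (242,4); (68,25); (211,29)]);
  ([:: (38,1); (23,1); (35,0)], Maximal 2 0 2, [::]);
  ([:: (38,7); (40,1); (23,0); (53,0)], Maximal 2 3 1, [::]);
  ([:: (38,3); (40,1); (23,0)], Meet 3 1 1 2, [:: (1,0); (0,0); (246,4); (245,4); (71,25); (214,29)]);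
  ([:: (38,1); (77,1); (35,0)], Maximal 0 2 1, [::]);
  ([:: (38,7); (40,1); (77,0); (53,0)], Meet 2 1 1 2, [:: (248,4); (216,29)]);
  ([:: (38,3); (40,1); (77,0)], Meet 3 1 1 2, [:: (1,0); (0,0); (249,4); (248,4); (74,25); (217,29)]);
  ([:: (38,1); (17,1); (20,0)], Maximal 0 2 2, [::]);
  ([:: (38,3); (40,0); (17,1); (74,0)], Neighbour 3 2, [::]);
  ([:: (40,0); (17,3); (26,0); (52,0)], Maximal 2 0 0, [::]);
  ([:: (38,3); (40,0); (17,1); (26,0)], Meet 3 1 1 2, [:: (0,0); (67,2); (253,4); (143,16); (67,24); (221,29)]);
  ([:: (38,7); (40,0); (17,1); (52,0)], Maximal 2 1 1, [::]);
  ([:: (38,3); (40,0); (17,1); (80,0)], Meet 3 1 1 2, [:: (0,0); (69,2); (255,4); (145,16); (69,24); (223,29)]);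
  ([:: (38,3); (40,0); (17,0)], Meet 2 2 0 2, [:: (5,0); (4,0); (9,0); (6,0); (2,0); (0,0); (32,2); (121,44)]);
  ([:: (40,2); (71,1); (12,0)], Maximal 0 1 1, [::]);
  ([:: (38,3); (40,0); (71,1); (23,0)], Neighbour 3 2, [:: (11,0); (8,0)]);
  ([:: (38,3); (40,2); (71,3); (39,1); (77,0)], Maximal 0 4 2, [::]);
  ([:: (38,3); (40,2); (71,1); (39,0)], Meet 2 2 0 2, [:: (13,0); (1,0); (10,0); (0,0)]);
  ([:: (38,3); (40,2); (71,1); (66,0)], Maximal 2 1 0, [::]);
  ([:: (38,3); (40,2); (71,0); (48,0)], Meet 1 1 0 2, [:: (21,0); (18,0); (15,0); (12,0); (235,25); (259,36)]);
  ([:: (38,1); (71,1); (41,0)], Maximal 0 2 1, [::]);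
  ([:: (38,3); (40,2); (71,0); (31,0)], Meet 1 1 0 2, [:: (23,0); (20,0); (0,0); (17,0); (14,0); (237,25)]);
  ([:: (38,3); (40,2); (71,1); (13,0)], Maximal 2 1 0, [::]);
  ([:: (38,3); (40,2); (71,1); (67,0)], Maximal 2 1 3, [::]);
  ([:: (38,3); (40,2); (71,0); (49,0)], Meet 1 1 0 2, [:: (26,0); (23,0); (3,0); (20,0); (17,0); (185,32)]);
  ([:: (38,3); (40,2); (71,1); (14,0)], Maximal 2 0 3, [::]);
  ([:: (38,3); (40,2); (71,1); (68,0)], Meet 2 2 1 1, [::]);
  ([:: (38,3); (40,0); (71,0)], Neighbour 1 1, [:: (12,0); (9,0); (8,0); (7,0); (5,0); (4,0); (3,0); (2,0); (29,0); (26,0); (1,0); (6,0); (0,0); (23,0); (20,0); (160,20); (218,24)]);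
  ([:: (38,3); (40,2); (53,1); (51,0)], Maximal 1 2 0, [::]);
  ([:: (38,3); (40,2); (53,1); (34,0)], Meet 1 1 0 2, [:: (34,0); (240,18); (274,27); (97,29); (272,43); (269,43)]);
  ([:: (38,3); (40,2); (53,1); (52,0)], Maximal 3 0 0, [::]);
  ([:: (38,3); (40,0); (53,1); (8,0)], Meet 2 1 1 2, [:: (274,4); (242,29); (33,47); (30,47); (27,47); (24,47)]);
  ([:: (38,3); (40,6); (53,1); (35,1); (16,0)], Maximal 0 1 0, [::]);
  ([:: (38,3); (40,6); (53,1); (35,1); (70,0)], Maximal 0 4 0, [::]);
  ([:: (38,3); (40,2); (53,1); (35,0)], Maximal 2 1 0, [:: (1,0); (0,0); (30,47); (27,47)]);
  ([:: (38,3); (40,0); (53,1); (62,0)], Meet 2 1 1 2, [:: (278,4); (246,29); (37,47); (34,47); (31,47); (28,47)]);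
  ([:: (38,3); (40,0); (53,1); (26,0)], Meet 2 1 1 2, [:: (279,4); (247,29); (38,47); (35,47); (32,47); (29,47)]);
  ([:: (38,3); (40,0); (53,1); (80,0)], Meet 2 1 1 2, [:: (280,4); (248,29); (39,47); (36,47); (33,47); (30,47)]);
  ([:: (38,3); (40,0); (53,0)], Neighbour 2 1, [:: (9,0); (8,0); (7,0); (6,0); (3,0); (2,0); (1,0); (0,0); (283,4); (278,4); (281,4); (280,4); (171,16); (40,47); (37,47); (34,47); (31,47)]);
  ([:: (38,1); (40,0)], Neighbour 0 0, [:: (172,0); (70,0); (69,0); (61,0); (41,0); (38,0); (57,0); (49,0); (35,0); (44,0); (32,0); (25,0); (11,0); (0,0); (255,25); (107,25); (107,29); (250,29); (81,41)]);
  ([:: (38,1); (49,1); (42,0)], Maximal 0 2 1, [::]);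
  ([:: (38,3); (49,0); (52,0)], Maximal 2 1 1, [::]);
  ([:: (38,1); (49,1); (43,0)], Maximal 2 0 0, [::]);
  ([:: (38,1); (49,1); (52,1); (24,0)], Neighbour 0 0, [:: (3,3); (3,45); (3,47)]);
  ([:: (38,1); (49,1); (52,1); (78,0)], Neighbour 0 0, [:: (4,3); (4,45); (4,47)]);
  ([:: (38,0); (52,1); (16,1); (8,0)], Neighbour 0 0, [::]);
  ([:: (52,1); (16,1); (62,0)], Maximal 0 2 0, [::]);
  ([:: (38,1); (49,1); (52,1); (16,0)], Meet 1 2 0 2, [:: (1,0); (0,0)]);
  ([:: (38,0); (52,1); (70,1); (8,0)], Neighbour 0 0, [::]);
  ([:: (38,1); (49,1); (52,1); (70,1); (62,0)], Neighbour 4 0, [::]);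
  ([:: (38,1); (49,1); (52,1); (70,0)], Meet 1 2 0 2, [:: (1,0); (0,0)]);
  ([:: (38,1); (49,1); (52,1); (25,0)], Neighbour 0 2, [:: (11,0); (11,2); (11,46)]);
  ([:: (38,1); (49,1); (52,1); (79,0)], Neighbour 0 2, [:: (12,0); (12,2); (12,46)]);
  ([:: (38,5); (49,1); (52,1); (44,0)], Maximal 1 3 1, [::]);
  ([:: (38,1); (49,1); (52,0)], Neighbour 2 1, [:: (10,0); (9,0); (6,0); (3,0); (2,0); (12,0); (1,0); (0,0); (111,2); (14,2); (14,11); (187,16); (111,24); (14,37); (10,45); (9,45); (6,45); (3,45); (14,47)]);
  ([:: (38,1); (49,1); (44,0)], Maximal 0 2 1, [::]);
  ([:: (38,3); (49,0); (44,1); (15,0)], Neighbour 1 0, [:: (13,0); (16,6); (264,29)]);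
  ([:: (38,3); (49,0); (44,1); (69,0)], Neighbour 1 0, [:: (14,0); (17,6); (265,29)]);
  ([:: (38,3); (49,0); (44,1); (16,1); (24,0)], Meet 2 2 0 2, [:: (100,41); (18,45)]);
  ([:: (38,3); (49,0); (44,1); (16,0)], Meet 2 2 1 2, [:: (0,0); (12,40)]);
  ([:: (38,3); (49,0); (44,1); (70,1); (24,0)], Meet 2 2 0 2, [:: (102,41); (20,45)]);
  ([:: (38,3); (49,0); (44,0); (78,0)], Neighbour 3 2, [::]);
  ([:: (38,3); (49,0); (44,1); (70,0)], Meet 2 2 1 2, [:: (1,0); (0,0)]);
  ([:: (38,3); (49,0); (44,1); (17,0)], Neighbour 1 2, [:: (23,1); (271,22); (20,45)]);
  ([:: (38,3); (49,0); (44,1); (71,0)], Neighbour 1 0, [:: (21,0); (24,6); (272,29)]);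
  ([:: (38,3); (49,0); (44,0)], Neighbour 2 1, [:: (8,0); (24,0); (7,0); (5,0); (22,0); (2,0); (10,0); (1,0); (9,0); (0,0); (25,13); (198,16); (25,17); (24,27); (8,45); (7,45); (5,45); (22,45); (2,45)]);
  ([:: (38,1); (49,0)], Meet 3 1 1 2, [:: (199,16); (25,0); (23,0); (24,0); (11,0); (0,0); (10,0); (134,2); (123,2); (26,2); (26,17); (123,24); (134,25); (26,26); (25,27); (23,45); (26,47)]);
  ([:: (38,1); (38,0)], Meet 3 1 2 2, [:: (124,0); (101,0); (0,0); (124,2); (0,2); (200,32); (109,41); (27,45); (27,47)]);
  ([:: (38,1); (41,6); (3,0); (52,1); (10,0)], Maximal 2 3 2, [:: (102,0); (1,0); (1,2)]);
  ([:: (38,9); (41,3); (52,1); (64,0); (77,0)], Meet 1 1 0 1, [::]);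
  ([:: (38,1); (41,14); (3,0); (52,3); (64,1); (74,0)], Meet 2 2 1 1, [:: (3,0); (0,0)]);
  ([:: (41,7); (52,3); (64,1); (80,0)], Meet 2 1 1 2, [::]);
  ([:: (38,1); (41,6); (3,0); (52,1); (64,0)], Maximal 2 3 2, [:: (106,0); (5,0); (1,0); (0,0); (5,2)]);
  ([:: (38,1); (41,6); (3,0); (52,1); (16,0)], Maximal 2 3 2, [:: (107,0); (6,0); (130,2); (6,2); (33,47)]);
  ([:: (38,1); (41,6); (3,0); (52,1); (70,0)], Neighbour 3 2, [:: (108,0); (7,0); (131,2); (7,2); (2,45); (34,47)]);
  ([:: (38,1); (41,2); (3,0); (52,0)], Neighbour 3 0, [:: (6,0); (2,0); (109,0); (35,0); (8,0); (1,0); (0,0); (35,2); (8,2); (208,4); (132,24); (132,28); (35,46)]);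
  ([:: (38,1); (41,1); (44,0)], Maximal 0 2 1, [::]);
  ([:: (38,1); (41,0); (3,0)], Meet 3 1 1 2, [:: (210,16); (1,0); (0,0); (145,2); (134,2); (37,2); (10,2); (116,5); (10,13); (37,18); (285,18); (10,19); (134,24); (285,25); (145,25); (37,25); (37,47)]);
  ([:: (38,1); (41,1); (12,0)], Meet 3 1 1 2, [:: (1,0); (146,2); (135,2); (38,2); (11,2); (117,5); (211,16); (38,18); (135,24); (286,25); (146,25); (38,47)]);
  ([:: (41,6); (57,1); (39,0); (52,0)], Neighbour 3 2, [:: (39,21); (39,36); (39,38)]);
  ([:: (38,1); (41,2); (57,1); (39,0)], Meet 3 1 1 2, [:: (0,0); (3,0); (288,12); (13,13); (213,16); (40,18); (288,18); (13,19); (40,25)]);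
  ([:: (38,1); (41,1); (66,0)], Meet 3 1 2 2, [:: (115,0); (138,2); (14,2); (214,32); (123,41); (41,47)]);
  ([:: (38,1); (41,2); (57,1); (13,0)], Meet 3 1 1 2, [:: (5,0); (139,2); (15,2); (215,16); (42,18); (139,24); (290,25); (150,25); (42,47)]);
  ([:: (38,1); (41,3); (40,0); (52,0)], Maximal 0 3 0, [::]);
  ([:: (38,1); (41,1); (40,0)], Meet 3 1 1 2, [:: (217,16); (0,0); (7,0); (44,2); (17,2); (17,9); (17,13); (44,16); (17,17); (44,18); (292,18); (17,19); (44,24); (292,25); (44,25); (292,29); (44,47)]);
  ([:: (38,1); (41,2); (57,1); (67,0)], Meet 3 1 2 2, [:: (119,0); (142,2); (18,2); (218,32); (127,41); (45,47)]);
  ([:: (41,3); (49,0); (52,0)], Maximal 1 2 1, [::]);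
  ([:: (38,1); (41,1); (49,0)], Meet 3 1 1 2, [:: (220,16); (0,0); (10,0); (47,2); (20,2); (0,5); (20,11); (20,13); (20,16); (47,17); (47,18); (295,18); (20,19); (295,25); (47,25); (47,26); (47,47)]);
  ([:: (38,1); (41,1); (14,0)], Meet 3 1 1 2, [:: (11,0); (156,2); (145,2); (48,2); (21,2); (127,5); (221,16); (48,18); (296,18); (145,24); (296,25); (156,25); (48,25); (48,47)]);
  ([:: (38,1); (41,2); (57,1); (41,1); (21,0)], Neighbour 4 2, [:: (1,0); (277,4); (49,34); (6,45); (3,45)]);
  ([:: (57,1); (41,1); (75,0)], Maximal 0 2 2, [::]);
  ([:: (38,1); (41,2); (57,1); (41,1); (22,0)], Neighbour 4 0, [:: (8,0); (5,0); (3,0); (51,12); (279,25)]);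
  ([:: (38,1); (41,2); (57,1); (41,1); (76,0)], Neighbour 4 0, [:: (9,0); (6,0); (4,0); (52,12); (280,25)]);
  ([:: (38,9); (41,2); (57,1); (41,1); (23,0)], Meet 1 1 0 1, [:: (1,0); (0,0); (3,45); (2,45)]);
  ([:: (38,9); (41,2); (57,1); (41,1); (77,0)], Meet 1 1 0 1, [:: (2,0); (1,0); (4,45); (3,45)]);
  ([:: (38,1); (41,2); (57,1); (41,0)], Meet 2 2 1 1, [:: (283,4); (55,34); (5,0); (4,0); (3,0); (28,0); (7,0); (2,0); (1,0); (0,0); (12,45); (9,45)]);
  ([:: (38,1); (41,1); (68,0)], Meet 3 1 1 2, [:: (19,0); (164,2); (153,2); (56,2); (29,2); (135,5); (229,16); (56,18); (304,18); (153,24); (304,25); (164,25); (56,25); (56,47)]);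
  ([:: (38,1); (41,0); (57,0)], Neighbour 1 1, [:: (18,0); (16,0); (15,0); (14,0); (12,0); (11,0); (9,0); (8,0); (1,0); (0,0); (57,12); (230,20); (57,34); (18,45); (16,45); (15,45); (14,45); (12,45); (11,45)]);
  ([:: (38,1); (41,3); (52,1); (23,0)], Neighbour 2 0, [:: (132,0); (31,2)]);
  ([:: (21,2); (52,1); (77,0)], Maximal 0 1 1, [::]);
  ([:: (38,1); (41,2); (21,0); (52,0)], Neighbour 2 2, [:: (1,0); (0,0)]);
  ([:: (38,1); (41,0); (21,0)], Meet 3 1 1 2, [:: (234,16); (0,0); (24,0); (169,2); (158,2); (61,2); (34,2); (140,5); (34,13); (61,18); (309,18); (34,19); (158,24); (309,25); (169,25); (61,25); (61,47)]);
  ([:: (38,1); (41,6); (75,2); (52,1); (77,0)], Meet 1 2 0 2, [:: (25,0); (62,25)]);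
  ([:: (38,1); (41,2); (75,0); (52,0)], Neighbour 2 2, [:: (4,0); (0,0)]);
  ([:: (38,1); (41,0); (75,0)], Meet 3 1 1 2, [:: (237,16); (0,0); (27,0); (172,2); (161,2); (64,2); (37,2); (143,5); (37,13); (64,18); (312,18); (37,19); (161,24); (312,25); (172,25); (64,25); (64,47)]);
  ([:: (38,1); (41,6); (22,2); (52,1); (67,0)], Meet 2 1 1 2, [:: (28,0); (65,18)]);
  ([:: (38,1); (41,2); (22,0); (52,0)], Neighbour 2 0, [:: (0,0); (7,45)]);
  ([:: (38,1); (41,0); (22,0)], Meet 3 1 1 2, [:: (240,16); (0,0); (30,0); (175,2); (164,2); (67,2); (40,2); (146,5); (40,13); (67,18); (315,18); (40,19); (164,24); (315,25); (175,25); (67,25); (67,47)]);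
  ([:: (38,1); (41,6); (76,2); (52,1); (77,0)], Meet 1 2 0 2, [:: (31,0); (68,25)]);
  ([:: (38,1); (41,2); (76,0); (52,0)], Neighbour 3 2, [:: (10,0); (0,0)]);
  ([:: (38,1); (41,0); (76,0)], Meet 3 1 1 2, [:: (243,16); (0,0); (33,0); (178,2); (167,2); (70,2); (43,2); (149,5); (43,13); (70,18); (318,18); (43,19); (167,24); (318,25); (178,25); (70,25); (70,47)]);
  ([:: (38,1); (41,0)], Maximal 0 1 1, [:: (33,0); (13,0); (9,0); (6,0); (3,0); (0,0); (9,45); (6,45)]);
  ([:: (38,0)], Neighbour 0 3, [:: (197,0); (180,0); (169,0); (154,0); (146,0); (72,0); (45,0); (245,0); (44,0); (0,0); (180,2); (169,2); (72,2); (45,2); (0,2); (245,4); (245,16); (245,20); (169,24); (180,25); (169,28); (180,29); (245,32); (245,36); (154,41); (72,45); (72,47)]);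
  ([:: (41,1); (27,1); (40,0)], Maximal 0 2 0, [::]);
  ([:: (41,1); (27,1); (49,0)], Maximal 2 0 2, [::]);
  ([:: (41,5); (40,1); (10,1); (44,0)], Maximal 3 2 0, [::]);
  ([:: (41,11); (27,0); (40,1); (10,0); (53,0)], Maximal 3 0 1, [:: (3,8); (249,20); (3,21); (277,45)]);
  ([:: (41,3); (27,0); (40,1); (10,0)], Meet 3 1 1 2, [:: (4,16); (278,0); (1,0); (0,0); (278,4); (2,8); (4,9); (250,16); (4,17)]);
  ([:: (41,5); (40,1); (64,1); (44,0)], Maximal 0 2 0, [::]);
  ([:: (41,7); (27,0); (40,2); (53,0); (75,0)], Neighbour 3 2, [::]);
  ([:: (41,11); (27,0); (40,1); (64,0); (53,0)], Meet 2 2 1 1, [:: (0,0); (7,21); (281,45)]);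
  ([:: (41,3); (27,0); (40,1); (64,0)], Meet 3 1 1 2, [:: (8,16); (282,0); (2,0); (0,0); (282,4); (6,8); (8,9); (254,16); (8,17)]);
  ([:: (41,3); (27,0); (40,1); (15,0)], Maximal 1 3 1, [:: (9,16); (283,0); (283,4); (7,8); (4,22)]);
  ([:: (41,3); (27,0); (40,3); (13,0); (69,0)], Maximal 3 0 0, [:: (256,0); (10,1); (3,8); (10,9)]);
  ([:: (40,3); (13,0); (16,0)], Maximal 1 2 1, [::]);
  ([:: (40,3); (13,0); (70,0)], Maximal 1 2 1, [::]);
  ([:: (41,3); (27,0); (40,3); (13,0); (17,0)], Meet 3 1 2 2, [:: (287,8); (13,17); (13,21); (259,32)]);
  ([:: (41,3); (27,0); (40,3); (13,0); (71,0)], Maximal 0 4 1, [:: (260,16); (14,17)]);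
  ([:: (41,5); (40,1); (13,1); (44,0)], Maximal 1 0 0, [::]);
  ([:: (41,3); (27,0); (40,1); (13,0)], Meet 2 1 1 2, [:: (16,16); (6,0); (5,0); (4,0); (290,0); (3,0); (2,0); (0,0); (1,0); (290,4); (14,8)]);
  ([:: (41,3); (27,0); (40,3); (67,0); (75,0)], Maximal 0 4 2, [:: (10,0); (17,1); (17,17); (263,32)]);
  ([:: (40,3); (67,0); (22,0)], Maximal 1 2 2, [::]);
  ([:: (40,3); (67,0); (76,0)], Maximal 1 2 2, [::]);
  ([:: (41,3); (27,0); (40,3); (67,0); (23,0)], Maximal 0 4 2, [:: (20,17); (266,32)]);
  ([:: (41,3); (27,0); (40,3); (67,0); (77,0)], Meet 3 1 1 2, [:: (295,0); (267,16); (21,16); (21,17)]);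
  ([:: (41,5); (40,1); (67,1); (50,0)], Maximal 1 3 2, [::]);
  ([:: (41,3); (27,0); (40,1); (67,0)], Meet 2 2 1 1, [:: (23,21); (5,0); (4,0); (21,0); (3,0); (2,0); (0,0); (1,0); (13,8); (297,8); (297,12)]);
  ([:: (41,5); (40,1); (22,1); (50,0)], Meet 2 2 1 2, [::]);
  ([:: (41,11); (27,0); (40,1); (22,0); (53,0)], Maximal 1 4 2, [::]);
  ([:: (41,3); (27,0); (40,1); (22,0)], Meet 3 1 2 2, [:: (26,21); (24,0); (1,0); (0,0); (26,1); (300,8); (300,12); (26,17); (272,32)]);
  ([:: (41,5); (40,1); (76,1); (50,0)], Maximal 1 3 2, [::]);
  ([:: (41,11); (27,0); (40,1); (76,0); (53,0)], Neighbour 3 2, [::]);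
  ([:: (41,3); (27,0); (40,1); (76,0)], Meet 3 1 2 2, [:: (29,21); (27,0); (1,0); (0,0); (29,1); (303,8); (303,12); (29,17); (275,32)]);
  ([:: (41,3); (27,0); (40,0)], Maximal 1 2 0, [:: (25,0); (21,0); (13,0); (6,0); (3,0); (0,0); (25,8); (21,8); (3,8); (0,8)]);
  ([:: (41,7); (27,0); (49,0); (43,0)], Maximal 1 2 0, [::]);
  ([:: (41,3); (27,0); (49,0)], Meet 3 1 1 2, [:: (32,9); (32,13); (278,16); (32,16); (32,17); (0,0); (58,0); (58,5); (30,8); (1,17); (30,19); (1,22); (0,38)]);
  ([:: (41,1); (27,1); (52,0)], Maximal 0 2 1, [::]);
  ([:: (41,3); (27,0); (52,0)], Maximal 1 2 1, [::]);
  ([:: (41,1); (27,0)], Meet 3 1 0 1, [:: (281,4); (35,4); (35,5); (35,12); (35,13); (4,0); (34,0); (2,0); (33,0); (0,0); (1,0); (2,8); (33,8)]);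
  ([:: (41,1); (11,1); (20,0)], Maximal 0 2 2, [::]);
  ([:: (41,3); (40,0); (11,1); (74,0)], Neighbour 3 2, [::]);
  ([:: (41,3); (40,0); (11,1); (26,0)], Neighbour 3 2, [::]);
  ([:: (41,3); (40,0); (11,0)], Meet 2 2 0 2, [:: (2,0); (1,0); (0,0); (137,25)]);
  ([:: (41,1); (65,1); (20,0)], Maximal 0 2 2, [::]);
  ([:: (41,11); (40,0); (65,3); (74,0); (75,0)], Neighbour 4 2, [::]);
  ([:: (41,3); (40,4); (65,1); (74,0); (52,0)], Meet 2 2 1 1, [:: (0,0); (42,21); (316,44)]);
  ([:: (40,0); (65,1); (74,1); (44,0)], Maximal 1 0 3, [::]);
  ([:: (41,3); (40,0); (65,1); (74,0)], Meet 3 1 1 2, [:: (318,0); (1,0); (0,0); (318,4); (44,13); (290,16); (44,16); (44,17)]);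
  ([:: (41,3); (40,0); (65,1); (26,0)], Neighbour 3 2, [::]);
  ([:: (41,11); (40,0); (65,1); (80,0); (15,0)], Neighbour 4 1, [::]);
  ([:: (41,3); (40,4); (65,1); (80,0); (52,0)], Meet 2 1 1 2, [:: (0,0); (321,4)]);
  ([:: (41,11); (40,0); (65,1); (80,1); (44,0)], Maximal 2 3 1, [::]);
  ([:: (41,3); (40,0); (65,1); (80,0)], Meet 3 1 1 2, [:: (323,0); (1,0); (0,0); (323,4); (49,13); (295,16); (49,16); (49,17)]);
  ([:: (41,3); (40,0); (65,0)], Meet 2 2 0 2, [:: (9,0); (5,0); (4,0); (0,0)]);
  ([:: (41,11); (40,2); (14,0); (52,0); (15,0)], Neighbour 4 1, [::]);
  ([:: (41,11); (40,2); (14,0); (52,0); (69,0)], Neighbour 4 1, [::]);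
  ([:: (41,5); (40,1); (52,1); (44,0)], Maximal 1 2 1, [::]);
  ([:: (41,3); (40,2); (14,0); (52,0)], Meet 2 1 1 2, [:: (54,16); (2,0); (1,0); (328,0); (0,0); (42,4); (328,4); (41,4); (328,28)]);
  ([:: (41,3); (40,0); (14,0)], Maximal 2 1 0, [:: (0,0); (301,4); (55,5); (55,13)]);
  ([:: (41,11); (40,2); (68,0); (52,0); (15,0)], Meet 2 2 1 1, [:: (330,12); (56,21); (330,44)]);
  ([:: (41,11); (40,2); (68,0); (52,0); (69,0)], Neighbour 4 1, [::]);
  ([:: (41,3); (40,2); (68,0); (52,0)], Meet 2 1 1 2, [:: (58,16); (1,0); (0,0); (332,0); (4,0); (332,4); (39,12); (38,12); (332,28)]);
  ([:: (41,3); (40,0); (68,0)], Maximal 2 1 0, [:: (0,0); (305,4); (59,5); (59,13)]);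
  ([:: (41,7); (40,4); (23,1); (52,1); (52,0)], Meet 1 2 0 2, [::]);
  ([:: (41,7); (40,0); (23,1); (52,0)], Neighbour 3 0, [:: (0,0); (61,5); (61,12); (362,24)]);
  ([:: (41,1); (23,2); (52,0); (8,0)], Maximal 0 2 1, [::]);
  ([:: (41,3); (40,2); (23,0); (52,0)], Meet 1 2 0 2, [:: (0,0); (129,17)]);
  ([:: (41,7); (40,4); (23,0); (50,1); (43,0)], Meet 2 2 0 1, [:: (39,4); (338,8)]);
  ([:: (41,7); (40,0); (23,0); (50,0)], Maximal 2 3 3, [:: (0,0); (29,1); (311,4); (65,4); (65,13); (311,16); (65,16); (311,36)]);
  ([:: (41,3); (40,0); (23,0)], Meet 3 1 2 2, [:: (66,5); (66,17); (66,21); (312,32); (4,0); (2,0); (0,0); (41,4); (340,8); (340,12)]);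
  ([:: (41,3); (40,4); (50,1); (80,0); (70,0)], Meet 3 1 1 2, [:: (341,4); (313,16)]);
  ([:: (41,3); (40,0); (50,1); (80,0)], Maximal 2 1 0, [:: (0,0); (28,4); (17,4); (1,12)]);
  ([:: (41,3); (40,0); (50,0)], Maximal 1 2 2, [:: (0,0); (2,34); (29,41); (18,41)]);
  ([:: (41,1); (77,1); (8,0)], Maximal 0 2 1, [::]);
  ([:: (41,3); (40,4); (77,1); (62,2); (52,1); (61,0)], Maximal 2 1 2, [:: (20,24); (317,36)]);
  ([:: (41,3); (40,4); (77,1); (62,0); (52,0)], Neighbour 4 1, [:: (0,0)]);
  ([:: (41,3); (40,0); (77,1); (62,0)], Meet 3 1 1 2, [:: (0,0); (3,12); (73,13); (319,16); (73,16); (73,17)]);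
  ([:: (41,5); (40,0); (26,0); (52,0)], Neighbour 1 0, [:: (320,4); (74,4); (74,12); (375,24)]);
  ([:: (41,3); (40,0); (77,1); (26,0)], Maximal 2 0 3, [:: (0,0); (39,4); (321,4); (75,4); (75,5); (5,12); (75,13); (321,16); (75,16); (75,17); (321,32); (321,36)]);
  ([:: (41,3); (40,0); (77,1); (80,0)], Neighbour 1 0, [:: (322,4); (36,4); (76,4); (9,12); (6,12); (76,13)]);
  ([:: (41,3); (40,0); (77,0)], Meet 1 2 0 2, [:: (6,0); (3,0); (1,0); (0,0)]);
  ([:: (41,3); (40,2); (53,1); (52,0)], Maximal 3 0 0, [::]);
  ([:: (41,3); (40,0); (53,0)], Neighbour 1 0, [:: (0,0); (325,4); (39,4); (79,4); (28,4); (23,4); (19,4); (12,4); (9,4); (1,4); (79,5); (39,12); (79,12); (28,12); (12,12); (9,12); (1,12); (79,13); (380,24)]);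
  ([:: (41,1); (40,0)], Neighbour 0 0, [:: (326,0); (40,0); (80,0); (29,0); (24,0); (20,0); (13,0); (10,0); (2,0); (0,0); (80,1); (40,8); (80,8); (29,8); (13,8); (10,8); (2,8); (80,9); (381,25)]);
  ([:: (41,7); (49,0); (43,0); (53,0)], Maximal 1 2 1, [::]);
  ([:: (41,3); (49,0); (43,0)], Neighbour 0 0, [:: (328,0); (82,0); (0,0); (82,1); (381,4); (82,8); (82,9); (1,18); (1,34)]);
  ([:: (41,1); (49,0)], Meet 3 1 1 2, [:: (83,9); (83,13); (329,16); (83,16); (83,17); (0,0); (109,0); (109,5); (0,5); (2,17); (2,18); (0,32); (0,38)]);
  ([:: (41,7); (52,1); (15,2); (41,1); (16,0)], Maximal 1 0 1, [::]);
  ([:: (41,7); (52,3); (15,0); (16,0)], Meet 1 1 0 1, [::]);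
  ([:: (41,3); (15,0); (70,0)], Maximal 1 2 0, [::]);
  ([:: (41,7); (52,1); (15,0); (41,0)], Meet 2 1 0 1, [:: (6,0); (87,4); (1,0); (2,0); (0,0); (100,7)]);
  ([:: (41,3); (52,1); (15,0)], Neighbour 0 1, [:: (7,0); (0,0); (88,20)]);
  ([:: (41,3); (52,1); (69,1); (16,0)], Maximal 3 0 0, [:: (89,9); (8,3); (5,19)]);
  ([:: (41,5); (52,2); (70,0); (75,0)], Meet 1 1 0 1, [:: (0,8); (90,12)]);
  ([:: (41,11); (52,1); (69,1); (70,1); (41,0)], Meet 1 1 0 1, [::]);
  ([:: (41,3); (52,1); (69,1); (70,0)], Neighbour 0 1, [:: (1,0); (0,0); (92,20); (133,33)]);
  ([:: (41,3); (69,0); (16,0)], Maximal 1 2 0, [::]);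
  ([:: (41,3); (69,0); (70,0)], Maximal 1 2 0, [::]);
  ([:: (41,3); (52,1); (69,0)], Meet 2 1 0 1, [:: (95,4); (14,0); (1,0); (5,0); (0,0); (2,0); (11,17)]);
  ([:: (41,3); (52,1); (16,1); (17,0)], Maximal 3 1 0, [:: (342,4); (96,5); (96,12); (15,17)]);
  ([:: (41,3); (52,1); (16,1); (71,0)], Maximal 3 1 0, [:: (343,4); (97,5); (97,12); (16,17)]);
  ([:: (41,7); (52,3); (16,0); (17,0)], Meet 2 2 0 2, [::]);
  ([:: (41,3); (16,0); (71,0)], Maximal 2 1 0, [::]);
  ([:: (41,3); (52,1); (16,0)], Meet 1 2 0 2, [:: (100,9); (1,0); (3,0); (0,0); (2,0); (19,3); (16,19)]);
  ([:: (41,3); (52,1); (70,1); (13,0)], Maximal 3 1 2, [:: (20,3); (101,17)]);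
  ([:: (41,3); (52,1); (70,1); (67,0)], Maximal 3 2 1, [:: (21,3); (102,9); (348,16); (102,17)]);
  ([:: (41,7); (52,3); (70,0); (67,0)], Maximal 2 0 1, [::]);
  ([:: (41,3); (52,1); (70,0)], Meet 1 1 0 1, [:: (104,12); (2,0); (0,0); (1,0); (20,0); (23,17); (3,26)]);
  ([:: (41,1); (52,0); (21,0)], Maximal 2 1 0, [:: (105,12); (24,0); (4,0); (0,0); (351,4); (105,4); (105,13); (21,17); (16,22); (9,22); (24,33)]);
  ([:: (41,1); (52,1); (52,1); (75,0)], Neighbour 3 1, [:: (10,7); (25,0); (17,7); (5,7); (1,7); (5,8); (1,8); (106,8); (106,12); (352,20); (106,20)]);
  ([:: (41,1); (52,0); (22,0)], Maximal 2 1 1, [:: (18,0); (11,0); (23,2); (107,9); (6,15); (2,15); (353,16); (107,16); (18,33); (11,33)]);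
  ([:: (41,1); (52,1); (52,1); (76,0)], Neighbour 0 2, [:: (19,0); (12,0); (108,4); (3,8); (7,15); (3,15); (108,20); (7,26); (3,26); (27,33)]);
  ([:: (41,1); (52,0); (77,0)], Neighbour 0 0, [:: (355,0); (109,0); (8,7); (4,7); (109,8); (109,9); (0,15); (20,17); (13,17); (28,18); (8,29); (4,29)]);
  ([:: (41,1); (52,1); (52,0)], Meet 2 2 1 1, [:: (26,10); (29,17); (110,21); (4,0); (3,0); (2,0); (0,0); (21,7); (14,7); (9,7); (5,7); (9,8); (5,8); (0,15); (2,15)]);
  ([:: (41,1); (52,0)], Neighbour 1 1, [:: (22,0); (15,0); (10,0); (6,0); (0,0); (27,2); (30,3); (111,9); (111,13); (10,15); (6,15); (357,16); (111,16); (111,17); (10,29); (6,29); (30,33); (22,33); (15,33)]);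
  ([:: (41,1); (41,0)], Meet 3 1 2 2, [:: (28,0); (0,0); (112,1); (112,5); (112,17); (28,19); (112,21); (358,32); (31,34)]);
  ([:: (41,0)], Neighbour 0 3, [:: (77,0); (32,0); (29,0); (1,0); (359,0); (113,0); (0,0); (113,1); (359,4); (113,4); (113,5); (29,8); (113,8); (113,9); (113,12); (113,13); (359,16); (113,16); (113,17); (32,18); (29,19); (359,20); (113,20); (113,21); (359,32); (32,34); (359,36)]);
  ([::], Meet 3 1 0 2, [:: (360,0); (114,0); (0,0); (114,1); (0,1); (0,2); (0,3); (114,8); (114,9)])].

Lemma certificate222_ok :
  check symmetries222 (fun _ _ => false) bad222 (candidates theory222) [::] certificate222.
Proof. by vm_cast_no_check (erefl true). Qed.

Lemma in_tags222 t : (t \in tags theory222) = (size t == 4) && all (fun x => x < 3) t.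
Proof.
apply/idP/idP.
  by move: t; apply/allP; vm_compute.
case: t => [|x [|y [|z [|w []]]]] //= /and5P[x3 y3 z3 w3 _].
by move: x y z w x3 y3 z3 w3; do 4 (case=> [|[|[|//]]]).
Qed.

(** These facts, checked on all 48 symmetries, make each of them a permutation of the families that
    fixes the last one together with its numbering. *)
Lemma symmetries222_prop s : s \in symmetries222 ->
  [/\ size s = 4, uniq (map fst s), all (fun m => m.1 < 4) s,
      all (fun m => (m.2 == [:: 0; 1; 2]) || (m.2 == [:: 0; 2; 1])) s &
      nth (0, [::]) s 3 = (3, [:: 0; 1; 2])].
Proof.
move=> sS; suff: [&& size s == 4, uniq (map fst s), all (fun m => m.1 < 4) s,
      all (fun m => (m.2 == [:: 0; 1; 2]) || (m.2 == [:: 0; 2; 1])) s &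
      nth (0, [::]) s 3 == (3, [:: 0; 1; 2])] by case/and5P=> /eqP-> -> -> -> /eqP->.
by move: s sS; apply/allP; vm_compute.
Qed.

Section ThreePairs.
Variables (G : bgraph) (sG : simple_graph G).
Local Notation V := (gV G).
Local Notation adj := (@gadj G).

Definition model222 (tag : V -> seq nat) : Prop :=
  [/\ forall v, tag v \in tags theory222,
      forall v c, nth 0 (tag v) c != 0 ->
        exists B : biclique G, forall w, (w \in val B) = (nth 0 (tag w) c == nth 0 (tag v) c),
      forall B : biclique G, exists c x, x != 0 /\ {in val B, forall v, nth 0 (tag v) c = x} &
      forall p q, meet theory222 p q -> exists v, nth 0 (tag v) p.1 = p.2 /\ nth 0 (tag v) q.1 = q.2].

Lemma cover_share tag (vs : seq V) (B : biclique G) : model222 tag -> vs != [::] ->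
  {subset vs <= val B} -> share (map tag vs).
Proof.
case=> Ht _ Hc _; case: vs => [//|v vs] _ sB; have [c [x [x0 cB]]] := Hc B.
have vB w : w \in v :: vs -> nth 0 (tag w) c = x by move=> /sB; apply: cB.
have c4 : c < 4.
  rewrite ltnNge; apply/negP=> c4; have := Ht v; rewrite in_tags222 => /andP[/eqP s4 _].
  by move: (vB v (mem_head _ _)) x0; rewrite nth_default ?s4 // => <-.
apply/hasP; exists c; rewrite ?mem_iota //= vB ?mem_head // x0 eqxx /=.
by apply/allP=> _ /mapP[w wv ->]; rewrite vB // inE wv orbT.
Qed.

Lemma model222_named tag : model222 tag -> named theory222 tag.
Proof.
move=> mt; have [Ht Hb Hc Hm] := mt; split=> // v u vu.
have [B /subsetP sB] := biclique_ext (cbip2 sG vu).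
apply: (@cover_share tag [:: v; u] B) => // w; rewrite !inE => /orP[]/eqP->; apply: sB.
  exact: set21.
exact: set22.
Qed.

Lemma model222_act s tag : s \in symmetries222 -> model222 tag -> model222 (act s \o tag).
Proof.
move=> /symmetries222_prop[s4 su /allP s1 /allP s2 s3] [Ht Hb Hc Hm].
pose m c := nth (0, [::]) s c.
have actE t c : c < 4 -> nth 0 (act s t) c = nth 0 (m c).2 (nth 0 t (m c).1).
  by move=> c4; rewrite /act (nth_map (0, [::])) // s4.
have actN t c : 4 <= c -> nth 0 (act s t) c = 0 by move=> c4; rewrite nth_default // size_map s4.
have m2 c : c < 4 -> (m c).2 = [:: 0; 1; 2] \/ (m c).2 = [:: 0; 2; 1].
  by move=> c4; have := s2 (m c); rewrite mem_nth ?s4 // => /(_ isT)/orP[]/eqP->; [left | right].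
have m1 c : c < 4 -> (m c).1 < 4 by move=> c4; apply: s1; rewrite mem_nth ?s4.
have t3 v c : nth 0 (tag v) c < 3.
  have := Ht v; rewrite in_tags222 => /andP[/eqP vs4 /allP v3].
  by case: (ltnP c 4) => c4; [apply: v3; rewrite mem_nth ?vs4 | rewrite nth_default ?vs4].
have p3 c x : c < 4 -> x < 3 -> nth 0 (m c).2 x < 3.
  by move=> /m2[]->; case: x => [|[|[|]]].
have p0 c x : c < 4 -> x < 3 -> (nth 0 (m c).2 x == 0) = (x == 0).
  by move=> /m2[]->; case: x => [|[|[|]]].
(* Each renumbering is the identity or a swap, hence its own inverse. *)
have pp c x : c < 4 -> x < 3 -> nth 0 (m c).2 (nth 0 (m c).2 x) = x.
  by move=> /m2[]->; case: x => [|[|[|]]].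
have minj c d : c < 4 -> d < 4 -> (m c).1 = (m d).1 -> c = d.
  move=> c4 d4 E; apply/eqP; rewrite -(@nth_uniq _ 0 (map fst s)) ?size_map ?s4 //.
  by rewrite !(nth_map (0, [::])) ?s4 // -/(m c) -/(m d) E.
split.
- move=> v; rewrite in_tags222 size_map s4 /=; apply/allP=> x /(nthP 0)[c]; rewrite size_map s4 => c4 <-.
  by rewrite actE // p3.
- move=> v c /=; case: (ltnP c 4) => c4; last by rewrite actN.
  rewrite actE // p0 // => nz; have [B BE] := Hb _ _ nz; exists B => w; rewrite BE /= !actE //.
  by apply/eqP/eqP=> [->//|E]; rewrite -(pp c (nth 0 (tag w) _)) // E pp.
- move=> B; have [c0 [x [x0 cB]]] := Hc B.
  have [v [_ [vB _ _]]] := biclique_edge sG B.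
  have x3 : x < 3 by rewrite -(cB v vB).
  have c04 : c0 < 4.
    rewrite ltnNge; apply/negP=> c4; have := Ht v; rewrite in_tags222 => /andP[/eqP vs4 _].
    by move: (cB v vB) x0; rewrite nth_default ?vs4 // => <-.
  have : c0 \in map fst s.
    (* Four distinct families below 4 are all of them, so the family of [B] is the source of some
       component [c] of the new labels. *)
    have sub : {subset map fst s <= iota 0 4}.
      by move=> k /mapP[u /s1 + ->]; rewrite mem_iota.
    by rewrite (uniq_min_size su sub) ?size_map ?s4 // mem_iota.
  case/(nthP 0)=> c; rewrite size_map s4 => c4; rewrite (nth_map (0, [::])) ?s4 // -/(m c) => mc.
  exists c, (nth 0 (m c).2 x); rewrite p0 //; split=> // w wB.
  by rewrite /= actE // mc cB.
(* Slots go to slots: the one excluded pair [(3, 2)] is fixed by every symmetry, so nothing else is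
   sent to it. *)
- have ok p : p \in slots -> [/\ p.1 < 4, p.2 < 3 & ((m p.1).1, nth 0 (m p.1).2 p.2) \in slots].
    have okE q : (q \in slots) = [&& q.1 < 4, q.2 != 0, q.2 < 3 & q != (3, 2)].
      by case: q => [[|[|[|[|c]]]] [|[|[|x]]]].
    case: p => c x; rewrite !okE /= => /and4P[c4 x0 x3 n32]; rewrite c4 x3; split=> //.
    rewrite m1 // p0 // x0 p3 //=; apply: contraNneq n32 => -[mc mx].
    have c3 : c = 3 by apply: minj => //; rewrite mc /m s3.
    by move: mx; rewrite c3 /m s3 /= => <-; case: x x0 x3 {c3} => [|[|[|]]].
  move=> p q /= /and3P[/ok[p1 p2 pP] /ok[q1 q2 qP] ne].
  have [|v [/= vp vq]] := Hm ((m p.1).1, nth 0 (m p.1).2 p.2) ((m q.1).1, nth 0 (m q.1).2 q.2).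
    by rewrite /= pP qP /=; apply: contraNneq ne => E; rewrite (minj _ _ p1 q1 E).
  by exists v; rewrite !actE // vp vq !pp.
Qed.

Lemma bad222_sound tag vs : model222 tag -> bad222 (pat adj tag vs) = false.
Proof.
move=> mt; have [Ht Hb _ _] := mt; case: vs => [//|v vs]; set P := pat adj tag vs.
pose r := nth false (map (adj v) vs).
have key s : {subset s <= gtn (size vs)} -> uncovered P (tag v) (map (adj v) vs) s = false.
  move=> sv; have v0 := v; have {}sv k : k \in s -> k < size vs by apply: sv.
  have tE : tag v :: map (ptag P) s = map tag (v :: [seq nth v0 vs k | k <- s]).
    rewrite [RHS]/= -map_comp; congr (_ :: _); apply/eq_in_map=> k /sv ks.
    by rewrite /= (ptag_pat _ _ v0).
  have rE k : k \in s -> r k = adj v (nth v0 vs k) by move=> /sv ks; rewrite /r (nth_map v0).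
  have pE k l : k \in s -> l \in s -> padj P k l = adj (nth v0 vs k) (nth v0 vs l).
    by move=> /sv ks /sv ls; rewrite (padj_pat (adjC sG) (adjxx sG) _ v0).
  rewrite /uncovered tE -/r; case: ifP => ev.
    apply/negbTE; rewrite negb_and negbK; case hr: (has r s) => //=.
    have parE : {in v :: [seq nth v0 vs k | k <- s] &, forall x y, adj x y = adj v x (+) adj v y}.
      have inner : {in s &, forall k l, adj (nth v0 vs k) (nth v0 vs l) =
                                        adj v (nth v0 vs k) (+) adj v (nth v0 vs l)}.
        have half k l : k < l -> l < size s ->
            adj (nth v0 vs (nth 0 s k)) (nth v0 vs (nth 0 s l)) =
            adj v (nth v0 vs (nth 0 s k)) (+) adj v (nth v0 vs (nth 0 s l)).
          move=> kl ls; have ks := ltn_trans kl ls.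
          have := pairwiseP 0 ev k l; rewrite !inE => /(_ ks ls kl).
          rewrite rE ?mem_nth // rE ?mem_nth // pE ?mem_nth //.
          by case: (adj v _); case: (adj v _); case: (adj _ _).
        move=> k l /(nthP 0)[k' ks <-] /(nthP 0)[l' ls <-].
        case: (ltngtP k' l') => [lt|lt|->]; first exact: half.
          by rewrite (adjC sG) addbC; apply: half.
        by rewrite adjxx ?addbb.
      move=> x y; rewrite !inE => /orP[/eqP->|/mapP[k ks ->]] /orP[/eqP->|/mapP[l ls ->]].
      - by rewrite (adjxx sG).
      - by rewrite (adjxx sG) addFb.
      - by rewrite (adjxx sG) addbF (adjC sG).
      - exact: inner.
    have [B /subsetP sB] : exists B : biclique G,
        [set x in v :: [seq nth v0 vs k | k <- s]] \subset val B.
      apply/biclique_ext/(cbipP sG); split.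
        move=> x y z; rewrite !in_set => xs ys zs; rewrite /par !(parE x, parE y) //.
        by case: (adj v x); case: (adj v y); case: (adj v z).
      case/hasP: hr => k ks rk; exists v, (nth v0 vs k); rewrite !in_set mem_head.
      by rewrite inE map_f ?orbT // -rE.
    by apply: (@cover_share tag (v :: [seq nth v0 vs k | k <- s]) B) => // x xs; apply: sB; rewrite in_set.
  apply/negbTE; apply: contraFN ev => /hasP[c _ /andP[x0 /allP/= cE]].
  have [B BE] := Hb _ _ x0.
  have inB x : x \in v :: [seq nth v0 vs k | k <- s] -> x \in val B.
    by move=> xs; rewrite BE; apply: cE; rewrite -map_cons map_f.
  have kB k : k \in s -> nth v0 vs k \in val B by move=> ks; apply: inB; rewrite inE map_f ?orbT.
  apply/(pairwiseP 0) => k l /(mem_nth 0) ks /(mem_nth 0) ls _; rewrite rE // rE // pE //.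
  by have := biclique_even sG (inB v (mem_head _ _)) (kB _ ks) (kB _ ls); rewrite /par => ->.
rewrite /bad222 /= -/P.
have sub n s : s \in [seq [:: j; i] | i <- iota 0 n, j <- iota 0 i] -> all (gtn n) s.
  case/allpairsPdep=> i [j [+ + ->]]; rewrite !mem_iota /= => i_n j_i.
  by rewrite i_n (ltn_trans j_i i_n).
have kill s : all (gtn (size P)) s -> uncovered P (tag v) (map (adj v) vs) s = false.
  by move=> /allP sv; apply: key => k /sv; rewrite size_pat.
apply/negbTE; rewrite negb_or; apply/andP; split; apply/hasPn=> s.
  by move=> /sub sP; rewrite kill.
case/allpairsPdep=> i [u [+ /sub uP ->]]; rewrite mem_iota /= => iP.
rewrite kill // all_rcons /= iP; apply/allP=> k /(allP uP) /= ki; exact: ltn_trans ki iP.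
Qed.

(** The certificate contains the empty pattern. The empty tuple realizes it in every graph, so its
    absence refutes the labelling itself. *)
Lemma no_model222 tag : model222 tag -> False.
Proof.
move=> mt.
have ab : {in [seq l.1.1 | l <- certificate222], forall P, absent adj model222 P}.
  apply: (check_sound (adjC sG) (adjxx sG) model222_act _ _ _ _ certificate222_ok) => //.
    by move=> t vs; apply: bad222_sound.
  exact: (candidates_sound sG model222_named).
by apply: (ab [::] _ _ mt [::]) => //; vm_compute.
Qed.
End ThreePairs.

(** * Counting bicliques *)

Section Count.
Variables (G : bgraph) (sG : simple_graph G).
Local Notation V := (gV G).
Local Notation adj := (@gadj G).
Local Notation hadj := (@gadj (KB G)).

Definition slot (L : seq ({set V} * {set V})) (p : nat * nat) : {set V} :=
  let q := nth (set0, set0) L p.1 in if p.2 == 1 then q.1 else q.2.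

(** Families are pairs of vertex sets instead of pairs of bicliques, so that a missing second member
    can be the empty set; label 2 then never occurs in that family. *)
Lemma no_pairs (L : seq ({set V} * {set V})) : size L = 4 ->
  {in L, forall p, [/\ p.1 :&: p.2 = set0, exists B : biclique G, val B = p.1 &
                       p.2 = set0 \/ exists B : biclique G, val B = p.2]} ->
  (forall B : biclique G, exists2 p, p \in L & val B = p.1 \/ val B = p.2) ->
  {in slots &, forall p q, p.1 != q.1 -> slot L p :&: slot L q != set0} -> False.
Proof.
move=> sL HL cov mt.
pose t (v : V) (p : {set V} * {set V}) := if v \in p.1 then 1 else if v \in p.2 then 2 else 0.
pose tag v := map (t v) L.
have tagE v c : c < 4 -> nth 0 (tag v) c = t v (nth (set0, set0) L c).
  by move=> c4; rewrite (nth_map (set0, set0)) // sL.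
have t1 v p : (t v p == 1) = (v \in p.1) by rewrite /t; case: (v \in p.1); case: (v \in p.2).
have t2 v p : p \in L -> (t v p == 2) = (v \in p.2).
  move=> pL; have [/setP/(_ v)] := HL p pL; rewrite /t !inE.
  by move=> + _ _; case: (v \in p.1); case: (v \in p.2).
have inL c : c < 4 -> nth (set0, set0) L c \in L by move=> c4; rewrite mem_nth // sL.
apply: (no_model222 sG (tag := tag)); split.
- move=> v; rewrite in_tags222 size_map sL /=; apply/allP=> _ /mapP[p _ ->].
  by rewrite /t; case: (v \in p.1); case: (v \in p.2).
- move=> v c; case: (ltnP c 4) => c4; last by rewrite nth_default // size_map sL.
  rewrite tagE //; have pL := inL c c4; have [_ [B1 E1] H2] := HL _ pL.
  case v1: (v \in (nth (set0, set0) L c).1).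
    have -> : t v (nth (set0, set0) L c) = 1 by apply/eqP; rewrite t1.
    by exists B1 => w; rewrite tagE // t1 E1.
  case v2: (v \in (nth (set0, set0) L c).2); last by rewrite /t v1 v2.
  have -> : t v (nth (set0, set0) L c) = 2 by apply/eqP; rewrite t2.
  case: H2 => [E|[B2 E2] _]; first by rewrite E inE in v2.
  by exists B2 => w; rewrite tagE // t2 // E2.
- move=> B; have [p pL pB] := cov B.
  have [c c4 pE] : exists2 c, c < 4 & nth (set0, set0) L c = p.
    by have /(nthP (set0, set0))[c] := pL; rewrite sL; exists c.
  case: pB => pB; [exists c, 1 | exists c, 2]; split=> // v vB; rewrite tagE // pE; apply/eqP.
    by rewrite t1 -pB.
  by rewrite t2 // -pB.
- have sl p v : p \in slots -> v \in slot L p -> nth 0 (tag v) p.1 = p.2.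
    move=> ps; have [p4 p12] : p.1 < 4 /\ (p.2 = 1 \/ p.2 = 2).
      by move: ps; rewrite !inE => /or4P[|||/or4P[]] /eqP-> /=; split; auto.
    by rewrite /slot tagE //; case: p12 => -> /= vp; apply/eqP; rewrite ?t1 ?t2 ?inL.
  move=> p q /= /and3P[ps qs ne]; case/set0Pn: (mt p q ps qs ne) => v; rewrite inE => /andP[vp vq].
  by exists v; rewrite (sl p) // (sl q).
Qed.

Hypothesis cG : forall x y : V, connect adj x y.
Hypothesis no5 : ~ has_clique (KB (KB G)) 5.
Hypothesis no5' : ~ has_clique (KB G) 5.

Lemma few_bicliques : #|{: biclique G}| <= 6.
Proof.
have [hC hI] := KB_simple G.
pose R B C := (B == C) || ~~ hadj B C.
have Rrefl B : R B B by rewrite /R eqxx.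
have Rsym B C : R B C = R C B by rewrite /R eq_sym hC.
have Rtrans B C D : R B C -> R C D -> R B D.
  rewrite /R; case/orP=> [/eqP-> //|bc]; case/orP=> [/eqP<-|cd]; first by rewrite bc orbT.
  case: (eqVneq C B) => [<-|nB]; first by rewrite cd orbT.
  case: (eqVneq C D) => [<-|nD]; first by rewrite bc orbT.
  by rewrite (KB_nonadj_trans sG no5 cG (negbTE bc) (negbTE cd) nB nD) orbT.
have eqR : {in setT & &, equivalence_rel R}.
  move=> x y z _ _ _; split=> // xy; apply/idP/idP; last exact: Rtrans.
  by apply: Rtrans; rewrite Rsym.
pose P := equivalence_partition R [set: biclique G].
have pP : partition P setT := equivalence_partitionP eqR.
have [/eqP covP trP P0] := and3P pP.
have sameR b x y : b \in P -> x \in b -> y \in b -> R x y.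
  move=> bP xb yb; rewrite -(pblock_equivalence_partition eqR) ?inE //.
  by rewrite (def_pblock trP bP xb).
have diffR b c x y : b \in P -> c \in P -> b != c -> x \in b -> y \in c -> hadj x y.
  move=> bP cP bc xb yc; apply/negPn/negP=> nxy; case/negP: bc; apply/eqP.
  rewrite -(def_pblock trP bP xb) -(def_pblock trP cP yc); apply: (same_pblock trP).
  by rewrite (pblock_equivalence_partition eqR) ?inE // Rsym /R nxy orbT.
have b2 b : b \in P -> #|b| <= 2.
  move=> bP; rewrite leqNgt; apply/negP=> /card_gt2P[x [y [z [[xb yb zb] [xy yz zx]]]]].
  have := sameR b x y bP xb yb; rewrite /R (negbTE xy) /= => /negbTE axy.
  have := sameR b y z bP yb zb; rewrite /R (negbTE yz) /= => /negbTE ayz.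
  have xz : x != z by rewrite eq_sym.
  have := sameR b x z bP xb zb; rewrite /R (negbTE xz) /= => /negbTE axz.
  exact: (no_three_disjoint sG cG no5 no5' xy xz yz axy axz ayz).
(* Bicliques from different classes are adjacent, so a transversal of the classes is a clique of
   [KB G]. *)
have P4 : #|P| <= 4.
  rewrite leqNgt; apply/negP=> P5; apply: no5'; exists (transversal P setT).
    by rewrite (card_transversal (transversalP pP)).
  have tP := transversalP pP.
  move=> x y xX yX ne; have xT : x \in cover P by rewrite covP inE.
  have yT : y \in cover P by rewrite covP inE.
  apply: (diffR (pblock P x) (pblock P y)); rewrite ?pblock_mem ?mem_pblock //.
  by apply: contraNneq ne => E; apply/eqP; apply: (pblock_inj tP).
rewrite leqNgt; apply/negP=> card7.
have sumP : 6 < \sum_(b in P) #|b| by rewrite -(card_partition pP) cardsT.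
have sumle (Q : {set {set biclique G}}) : Q \subset P -> \sum_(b in Q) #|b| <= #|Q| * 2.
  by move=> /subsetP QP; rewrite -sum_nat_const; apply: leq_sum => b /QP/b2.
have cP : #|P| = 4 by have := leq_trans sumP (sumle P (subxx _)); move: P4; move: #|P| => n; lia.
(* The fourth family is to be a class with a single member if there is one, as it alone may lack a
   second member. *)
have [b3 b3P b3min] : exists2 b3, b3 \in P & forall b, b \in P -> #|b| <= 1 -> #|b3| <= 1.
  case: (boolP [exists b in P, #|b| <= 1]) => [/exists_inP[b bP b1] | /exists_inPn H].
    by exists b.
  have [b bP] : exists b, b \in P by apply/card_gt0P; rewrite cP.
  by exists b => // c cP' c1; case/negP: (H c cP').
pose Q := P :\ b3.
have QP b : b \in Q -> b \in P by rewrite in_setD1 => /andP[].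
have cQ : #|Q| = 3 by have := cardsD1 b3 P; rewrite b3P cP /= -/Q add1n => -[<-].
(* A second class of size at most 1 would leave at most [1 + 1 + 2 + 2] bicliques, one too few. *)
have Q2 b : b \in Q -> #|b| = 2.
  move=> bQ; apply/eqP; rewrite eqn_leq b2 ?QP //= ltnNge; apply/negP=> b1.
  have b31 := b3min b (QP b bQ) b1.
  have QbP : Q :\ b \subset P by apply/subsetP=> c; rewrite in_setD1 => /andP[_ /QP].
  have c2 : #|Q :\ b| = 2 by have := cardsD1 b Q; rewrite bQ cQ add1n => -[<-].
  have := sumle _ QbP; rewrite c2; move: sumP; rewrite (big_setD1 b3) //= -/Q (big_setD1 b) //=.
  by move: (\sum_(_ in _) _) b1 b31 => m; move: #|b| #|b3| => n1 n2; lia.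
have [d0 [d1 [d2 [[Q0 Q1 Q2'] [n01 n12 n20]]]]] : exists x y z : {set biclique G},
    [/\ x \in Q, y \in Q & z \in Q] /\ [/\ x != y, y != z & z != x].
  by apply/card_gt2P; rewrite cQ.
have QE b : b \in Q -> [|| b == d0, b == d1 | b == d2].
  move=> bQ; apply/negPn/negP; rewrite !negb_or => /and3P[e0 e1 e2].
  have h1 : d1 \in Q :\ d0 by rewrite in_setD1 eq_sym n01 Q1.
  have h2 : d2 \in Q :\ d0 :\ d1 by rewrite 2!in_setD1 [d2 == d1]eq_sym n12 n20 Q2'.
  have r1 : #|Q :\ d0| = 2 by have := cardsD1 d0 Q; rewrite Q0 cQ add1n => -[<-].
  have r2 : #|Q :\ d0 :\ d1| = 1 by have := cardsD1 d1 (Q :\ d0); rewrite h1 r1 add1n => -[<-].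
  have /eqP : #|Q :\ d0 :\ d1 :\ d2| = 0.
    by have := cardsD1 d2 (Q :\ d0 :\ d1); rewrite h2 r2 add1n => -[<-].
  by rewrite cards_eq0 => /eqP/setP/(_ b); rewrite 3!in_setD1 e0 e1 e2 bQ inE.
have two b : b \in Q -> exists x y, [/\ x != y & b = [set x; y]].
  by move=> /Q2/eqP/cards2P[x [y [ne E]]]; exists x, y.
have [x0 [y0 [ne0 E0]]] := two _ Q0.
have [x1 [y1 [ne1 E1]]] := two _ Q1.
have [x2 [y2 [ne2 E2]]] := two _ Q2'.
have [x3 x3b] : exists x, x \in b3.
  by apply/set0Pn; apply: contraNneq P0 => <-.
(* [S3] is the second biclique of the last class, or [set0] when [x3] is alone in it. *)
have [S3 [S3v b3E]] : exists S3 : {set V},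
    (S3 = set0 \/ exists2 y, y \in b3 :\ x3 & val y = S3) /\
    (forall y, y \in b3 -> y = x3 \/ val y = S3).
  have c3 : #|b3 :\ x3| <= 1.
    by have := cardsD1 x3 b3; rewrite x3b add1n => E; rewrite -ltnS -E b2.
  have [E|[y yb]] := set_0Vmem (b3 :\ x3).
    exists set0; split=> [|y yb]; [by left | left].
    by apply/eqP/negPn/negP=> ny; have := in_set0 y; rewrite -E in_setD1 ny yb.
  exists (val y); split=> [|z zb]; first by right; exists y.
  case: (eqVneq z x3) => [|nz]; [by left | right].
  have zb' : z \in b3 :\ x3 by rewrite in_setD1 nz.
  by have /card_le1P/(_ y yb z) := c3; rewrite zb' inE => /esym/eqP->.
pose L := [:: (val x0, val y0); (val x1, val y1); (val x2, val y2); (val x3, S3)].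
have dis (b : {set biclique G}) x y : b \in P -> x \in b -> y \in b -> x != y -> val x :&: val y = set0.
  move=> bP xb yb xy; have := sameR b x y bP xb yb; rewrite /R (negbTE xy) /= negb_and xy /=.
  by rewrite negbK => /eqP.
have [m0 m0'] : x0 \in d0 /\ y0 \in d0 by rewrite E0 !inE !eqxx orbT.
have [m1 m1'] : x1 \in d1 /\ y1 \in d1 by rewrite E1 !inE !eqxx orbT.
have [m2 m2'] : x2 \in d2 /\ y2 \in d2 by rewrite E2 !inE !eqxx orbT.
apply: (@no_pairs L) => //.
- move=> p; rewrite !inE => /or4P[]/eqP-> /=; split.
  + exact: dis (QP _ Q0) m0 m0' ne0.
  + by exists x0.
  + by right; exists y0.
  + exact: dis (QP _ Q1) m1 m1' ne1.
  + by exists x1.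
  + by right; exists y1.
  + exact: dis (QP _ Q2') m2 m2' ne2.
  + by exists x2.
  + by right; exists y2.
  + case: S3v => [->|[y + <-]]; first by rewrite setI0.
    by rewrite in_setD1 eq_sym => /andP[ny yb]; apply: dis b3P x3b yb ny.
  + by exists x3.
  + by case: S3v => [->|[y _ <-]]; [left | right; exists y].
- move=> B; have : B \in cover P by rewrite covP inE.
  case/bigcupP=> b bP Bb; case: (eqVneq b b3) => [E|nb].
    exists (val x3, S3); first by rewrite !inE eqxx !orbT.
    by rewrite E in Bb; have [->|E3] := b3E B Bb; [left | right].
  have /QE : b \in Q by rewrite in_setD1 nb.
  case/or3P=> /eqP E; move: Bb; rewrite E ?E0 ?E1 ?E2 !inE => /orP[]/eqP->.
  + by exists (val x0, val y0); rewrite ?inE ?eqxx ?orbT //; left.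
  + by exists (val x0, val y0); rewrite ?inE ?eqxx ?orbT //; right.
  + by exists (val x1, val y1); rewrite ?inE ?eqxx ?orbT //; left.
  + by exists (val x1, val y1); rewrite ?inE ?eqxx ?orbT //; right.
  + by exists (val x2, val y2); rewrite ?inE ?eqxx ?orbT //; left.
  + by exists (val x2, val y2); rewrite ?inE ?eqxx ?orbT //; right.
pose d c := nth set0 [:: d0; d1; d2; b3] c.
have dP c : c < 4 -> d c \in P by case: c => [|[|[|[|]]]] //= _; apply: QP.
have nb3 b : b \in Q -> b != b3 by rewrite in_setD1 => /andP[].
have dinj c c' : c < 4 -> c' < 4 -> c != c' -> d c != d c'.
  have n02 : d0 != d2 by rewrite eq_sym.
  case: c => [|[|[|[|]]]] //; case: c' => [|[|[|[|]]]] // _ _ _; rewrite /d /= ?nb3 // eq_sym ?nb3 //.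
have sl p : p \in slots -> exists2 x, x \in d p.1 & val x = slot L p.
  rewrite !inE => /or4P[|||/or4P[]] /eqP->; rewrite /slot /d /=.
  + by exists x0.
  + by exists y0.
  + by exists x1.
  + by exists y1.
  + by exists x2.
  + by exists y2.
  + by exists x3.
have s4 p : p \in slots -> p.1 < 4 by rewrite !inE => /or4P[|||/or4P[]] /eqP->.
move=> p q ps qs ne; have [x xd <-] := sl p ps; have [y yd <-] := sl q qs.
have := diffR _ _ x y (dP _ (s4 _ ps)) (dP _ (s4 _ qs)) (dinj _ _ (s4 _ ps) (s4 _ qs) ne) xd yd.
by case/andP.
Qed.
End Count.

Theorem theorem2 (G : bgraph) :
  simple_graph G -> connected_graph G ->
  (7 <= #|gV (KB G)|)%N ->
  diverges_KB G.
Proof.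
move=> sG [_ cG] card7.
case: (boolP [exists K : {set gV (KB G)},
    (4 < #|K|) && [forall x in K, forall y in K, (x != y) ==> gadj x y]]).
  case/existsP=> K /andP[K5 /forall_inP HK]; apply: (@KBiter_clique_diverges G 1) => //.
  exists K => // x y xK yK ne; have /forall_inP/(_ y yK) := HK x xK.
  by rewrite ne.
move/existsPn=> no5'.
case: (boolP [exists K : {set gV (KB (KB G))},
    (4 < #|K|) && [forall x in K, forall y in K, (x != y) ==> gadj x y]]).
  case/existsP=> K /andP[K5 /forall_inP HK]; apply: (@KBiter_clique_diverges G 2) => //.
  exists K => // x y xK yK ne; have /forall_inP/(_ y yK) := HK x xK.
  by rewrite ne.
move/existsPn=> no5; have := card7; rewrite leqNgt ltnS few_bicliques //.
- case=> K K5 HK; case/negP: (no5 K); rewrite K5 /=.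
  by apply/forall_inP=> x xK; apply/forall_inP=> y yK; apply/implyP; apply: HK.
- case=> K K5 HK; case/negP: (no5' K); rewrite K5 /=.
  by apply/forall_inP=> x xK; apply/forall_inP=> y yK; apply/implyP; apply: HK.
Qed.
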